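(* Let $M$ be a smooth manifold. The two correspondences $\mathfrak s\mapsto\nabla^{\mathfrak s}$ (from holonomic symmetry jets on $M$ to torsionless affine connections on $M$) and $\nabla\mapsto\mathfrak a^{\nabla}$ (from torsionless affine connections on $M$ to holonomic symmetry jets on $M$) are inverse to one another. In particular, any torsionless affine connection $\nabla$ on $M$ is recovered from the family of $2$-jets of its geodesic symmetries $a^\nabla_x$ through the relation $$\bigl(\nabla_XY\bigr)_x=\tfrac12\bigl[X,\;Y+(a^\nabla_x)_*Y\bigr]_x ,\qquad X,Y\in\mathfrak X(M),\ x\in M.$$
   Context: All objects are smooth. A holonomic symmetry jet on $M$ is a smooth assignment $x\mapsto\mathfrak s(x)$, where $\mathfrak s(x)=j^2_xs_x$ is the $2$-jet at $x$ of a local diffeomorphism $s_x$ of $M$ defined near $x$ with $s_x(x)=x$ and differential $(s_x)_{*_x}=-\mathrm{id}_{T_xM}$. The associated connection $\nabla^{\mathfrak s}$ is defined by $(\nabla^{\mathfrak s}_XY)_x=\frac12[X,Y+(s_x)_*Y]_x$, where $(s_x)_*Y$ is the local vector field whose value at $x'$ is $(s_x)_{*}\bigl(Y_{s_x^{-1}(x')}\bigr)$; it depends only on the $2$-jets $j^2_xs_x$ and it is a torsionless affine connection. For a torsionless affine connection $\nabla$ with exponential map $\exp_x$ at $x$, the geodesic symmetry at $x$ is the local involutive diffeomorphism $a^\nabla_x(y)=\exp_x(-\exp_x^{-1}(y))$, defined near $x$, and $\mathfrak a^\nabla(x)=j^2_xa^\nabla_x$. *)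

(* Defs.v *)
From HB Require Import structures.
From mathcomp Require Import all_boot all_order all_algebra.
From mathcomp Require Import all_classical all_reals all_analysis.
Set Implicit Arguments.
Unset Strict Implicit.
Unset Printing Implicit Defensive.
Import Order.TTheory GRing.Theory Num.Theory.
Import numFieldNormedType.Exports.
Local Open Scope classical_set_scope.
Local Open Scope ring_scope.

(* Like xget, without requiring a choiceType. *)
Definition choose_in {T : Type} (x0 : T) (P : set T) : T :=
  if pselect (exists x, P x) is left exP then projT1 (cid exP) else x0.

(* C^k and C^oo for real functions on an open set of a finite-dimensional
   normed space, used for V = R and V = 'rV[R]_n only: all iterated directional
   derivatives exist and are continuous. *)
Fixpoint Ck {R : realType} {V : normedModType R} (k : nat) (U : set V)
    (f : V -> R) : Prop :=
  (forall u, U u -> {for u, continuous f}) /\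
  if k is k'.+1 then
    forall v : V, (forall u, U u -> derivable f u v) /\ Ck k' U ('D_v f)
  else True.

(* Smoothness "at u" always means smoothness on a neighbourhood of u. *)
Definition smooth_at {R : realType} {V : normedModType R} (f : V -> R) (u : V) :=
  exists2 U : set V, open U /\ U u & forall k, Ck k U f.

(* A chart is a homeomorphism from cdom onto an open set of R^n; both it and its
   inverse are given by total functions, arbitrary outside these open sets. *)
Record chart (R : realType) (n : nat) (M : topologicalType) := Chart {
  cdom : set M;
  cmap :> M -> 'rV[R]_n;
  cinv : 'rV[R]_n -> M;
  cdom_open : open cdom;
  cimg_open : open (cmap @` cdom);
  cmapK : forall x, cdom x -> cinv (cmap x) = x;
  cmap_continuous : forall x, cdom x -> {for x, continuous cmap};
  cinv_continuous : forall u, (cmap @` cdom) u -> {for u, continuous cinv} }.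

Definition charts_compatible (R : realType) (n : nat) (M : topologicalType)
    (c d : chart R n M) :=
  forall x, cdom c x -> cdom d x ->
  forall k, smooth_at (fun u => d (cinv c u) ord0 k) (c x).

Record manifold (R : realType) (n : nat) := Manifold {
  point :> topologicalType;
  atlas : set (chart R n point);
  manifold_hausdorff : hausdorff_space point;
  manifold_second_countable : @second_countable point;
  atlas_cover : forall x : point, exists2 c, atlas c & cdom c x;
  atlas_compatible : forall c d, atlas c -> atlas d -> charts_compatible c d }.

Section Manifold.
Context {R : realType} {n : nat} {M : manifold R n}.
Local Notation E := 'rV[R]_n.

Definition chart_at (x : M) (c : chart R n M) := atlas c /\ cdom c x.

Definition smooth_fun (f : M -> R) (x : M) :=
  exists2 c, chart_at x c & smooth_at (f \o cinv c) (c x).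

(* Smoothness at a of a map from a space A, with respect to a notion P of
   smoothness at a point for real functions on A. *)
Definition smooth_into (A : topologicalType) (P : (A -> R) -> A -> Prop)
    (phi : A -> M) (a : A) :=
  {for a, continuous phi} /\
  exists2 c, chart_at (phi a) c & forall k, P (fun z => c (phi z) ord0 k) a.

Definition smooth_map : (M -> M) -> M -> Prop := smooth_into smooth_fun.
Definition smooth_param : (E -> M) -> E -> Prop := smooth_into (@smooth_at R E).
Definition smooth_curve : (R -> M) -> R -> Prop := smooth_into (@smooth_at R R).

(* Tangent vectors at x are velocities of curves through x, seen as derivations
   of the functions smooth near x.  By convention they vanish on the other
   functions, so that equality of tangent vectors is equality of functions. *)
Definition tvec := (M -> R) -> R.

Definition velocity (g : R -> M) (t : R) : tvec :=
  fun f => if `[< smooth_fun f (g t) >] then 'D_1 (f \o g : R -> R) t else 0.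

Definition tangent (x : M) (v : tvec) :=
  exists g, [/\ smooth_curve g 0, g 0 = x & v = velocity g 0].

(* The vector with coordinates u in the coordinate basis of c at x. *)
Definition coord_tvec (c : chart R n M) (x : M) (u : E) : tvec :=
  fun f => if `[< smooth_fun f x >] then 'D_u (f \o cinv c) (c x) else 0.

Definition field := M -> tvec.

Definition smooth_field (X : field) :=
  forall x, tangent x (X x) /\
    forall f, smooth_fun f x -> smooth_fun (fun y => X y f) x.

Definition addf (X Y : field) : field := fun x f => X x f + Y x f.
Definition scalef (g : M -> R) (X : field) : field := fun x f => g x * X x f.

(* Fields need only be defined and smooth near the point x. *)
Definition bracket (X Y : field) : field := fun x f =>
  if `[< smooth_fun f x >]
  then X x (fun y => Y y f) - Y x (fun y => X y f) else 0.

Definition affine_connection (nabla : field -> field -> field) :=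
  [/\ forall X Y, smooth_field X -> smooth_field Y -> smooth_field (nabla X Y),
      forall X X' Y, smooth_field X -> smooth_field X' -> smooth_field Y ->
        nabla (addf X X') Y = addf (nabla X Y) (nabla X' Y),
      forall X Y Y', smooth_field X -> smooth_field Y -> smooth_field Y' ->
        nabla X (addf Y Y') = addf (nabla X Y) (nabla X Y'),
      forall g X Y, (forall x, smooth_fun g x) ->
        smooth_field X -> smooth_field Y ->
        nabla (scalef g X) Y = scalef g (nabla X Y)
    & forall g X Y, (forall x, smooth_fun g x) ->
        smooth_field X -> smooth_field Y ->
        nabla X (scalef g Y) =
        addf (scalef (fun x => X x g) Y) (scalef g (nabla X Y))].

Definition torsionless_connection (nabla : field -> field -> field) :=
  affine_connection nabla /\
  forall X Y, smooth_field X -> smooth_field Y ->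
    (fun x f => nabla X Y x f - nabla Y X x f) = bracket X Y.

(* Local diffeomorphisms are represented by total maps, of which only the germ
   at the base point is meaningful. *)
Definition local_inverse (x : M) (s t : M -> M) :=
  exists U V : set M, [/\ open U, open V, U x,
    forall y, U y -> [/\ V (s y), t (s y) = y & smooth_map s y]
  & forall z, V z -> [/\ U (t z), s (t z) = z & smooth_map t z]].

Definition local_diffeo (x : M) (s : M -> M) := exists t, local_inverse x s t.

Definition linv (x : M) (s : M -> M) : M -> M := choose_in id (local_inverse x s).

(* The local field s_* Y near s x, for s a local diffeomorphism at x. *)
Definition push_field (x : M) (s : M -> M) (Y : field) : field :=
  fun z f => Y (linv x s z) (f \o s).

Definition symmetry_at (x : M) (s : M -> M) :=
  [/\ local_diffeo x s, s x = x
    & forall v, tangent x v -> (fun f => v (f \o s)) = (fun f => - v f)].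

Definition in_charts (c d : chart R n M) (s : M -> M) (k : 'I_n) : E -> R :=
  fun u => d (s (cinv c u)) ord0 k.

Definition eq_jet2 (x : M) (s s' : M -> M) :=
  s x = s' x /\
  forall c d, chart_at x c -> chart_at (s x) d -> forall (k : 'I_n) (v w : E),
    'D_v (in_charts c d s k) (c x) = 'D_v (in_charts c d s' k) (c x) /\
    'D_v ('D_w (in_charts c d s k)) (c x) =
    'D_v ('D_w (in_charts c d s' k)) (c x).

(* The 2-jet at x of a local diffeomorphism, as an equivalence class. *)
Definition jet2 (x : M) (s : M -> M) : set (M -> M) :=
  [set s' | local_diffeo x s' /\ eq_jet2 x s s'].

(* Smoothness is that of the coordinates (values, first and second derivatives)
   of the jets; the representatives sigma x need not depend smoothly on x. *)
Definition holonomic_symmetry_jet (j : M -> set (M -> M)) :=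
  exists2 sigma : M -> M -> M,
    forall x, symmetry_at x (sigma x) /\ j x = jet2 x (sigma x)
  & forall c x, chart_at x c -> forall (k : 'I_n) (v w : E),
      let F u := in_charts c c (sigma (cinv c u)) k in
      [/\ smooth_at (fun u => F u u) (c x),
          smooth_at (fun u => 'D_v (F u) u) (c x)
        & smooth_at (fun u => 'D_v ('D_w (F u)) u) (c x)].

Definition symmetry_formula (s : M -> M -> M) (X Y : field) : field :=
  fun x f => 2^-1 * bracket X (addf Y (push_field x (s x) Y)) x f.

(* The connection of a holonomic symmetry jet, computed with chosen
   representatives; the result only depends on the jets. *)
Definition jet_connection (j : M -> set (M -> M)) : field -> field -> field :=
  symmetry_formula (fun x => choose_in id (j x)).

(* Vanishing of the covariant derivative of g' along g, computed with fields B i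
   extending the coordinate fields of a chart c. *)
Definition geodesic_at (nabla : field -> field -> field) (g : R -> M) (t : R) :=
  exists c (B : 'I_n -> field),
    [/\ chart_at (g t) c,
        forall i, smooth_field (B i),
        \forall y \near g t, forall i, B i y = coord_tvec c y (delta_mx ord0 i)
      & let q k : R -> R := fun r => c (g r) ord0 k in
        forall f,
        \sum_k 'D_1 ('D_1 (q k)) t * B k (g t) f +
        \sum_i \sum_l 'D_1 (q i) t * 'D_1 (q l) t * nabla (B i) (B l) (g t) f
        = 0].

Definition exp_at (nabla : field -> field -> field) (x : M) (v : tvec) (y : M) :=
  exists g : R -> M, [/\ exists2 e : R, 0 < e &
      forall t, - e < t < 1 + e -> smooth_curve g t /\ geodesic_at nabla g t,
    g 0 = x, velocity g 0 = v & g 1 = y].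

Definition expm (nabla : field -> field -> field) (x : M) (v : tvec) : M :=
  choose_in x (exp_at nabla x v).

(* l is the inverse of the restriction of exp_x to some neighbourhood of 0 in
   T_x M on which exp_x is a diffeomorphism onto a neighbourhood N of x; the
   linear structure T_x M = R^n is read through a chart. *)
Definition is_log (nabla : field -> field -> field) (x : M) (l : M -> tvec) :=
  exists c (W : set E) (N : set M) (L : M -> E),
    let e u := expm nabla x (coord_tvec c x u) in
    [/\ chart_at x c, open W /\ W 0, open N /\ N x,
        forall u, W u -> [/\ exists y, exp_at nabla x (coord_tvec c x u) y,
                             N (e u), L (e u) = u & smooth_param e u]
      & forall y, N y -> [/\ W (L y), e (L y) = y, l y = coord_tvec c x (L y)
                           & forall k, smooth_fun (fun z => L z ord0 k) y]].

Definition logm (nabla : field -> field -> field) (x : M) : M -> tvec :=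
  choose_in (fun _ _ => 0) (is_log nabla x).

Definition geodesic_symmetry (nabla : field -> field -> field) (x : M) : M -> M :=
  fun y => expm nabla x (fun f => - logm nabla x y f).

Definition geodesic_jet (nabla : field -> field -> field) (x : M) :
    set (M -> M) :=
  jet2 x (geodesic_symmetry nabla x).

End Manifold.

(* Main.v *)
(* In a chart, write x + u -> x - u + Q_x(u) + o(u^2) for a symmetry jet at x.
   The brackets defining nabla^s then give, in the coordinate frame,
   Gamma^k_ij(x) = - 1/2 D_i D_j (s_x)^k, so a symmetry jet and its connection
   determine each other; smoothness and freedom from torsion are read off this
   formula.  Conversely, along a geodesic g through x one has
   a_x (g t) = g (- t).  Comparing the first derivatives at t = 0 gives the
   differential -id, and comparing the second ones by means of the geodesic
   equation gives D_i D_j (a_x)^k = - 2 Gamma^k_ij after polarization.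

   That a_x is defined and smooth rests on the geodesic flow (Picard iteration,
   and smooth dependence on the initial condition through the tangent flow) and
   on the inverse function theorem applied to exp_x. *)

From HB Require Import structures.
Require Import Defs.
From mathcomp Require Import all_boot all_order all_algebra.
From mathcomp Require Import all_classical all_reals all_analysis.
From mathcomp Require Import ring lra.
Import Defs.
Set Implicit Arguments.
Unset Strict Implicit.
Unset Printing Implicit Defensive.
Import Order.TTheory GRing.Theory Num.Theory.
Import numFieldNormedType.Exports.
Local Open Scope classical_set_scope.
Local Open Scope ring_scope.

(** * Calculus of smooth functions *)

Section RowVectors.
Context {R : realType}.

(** A geodesic sees only the quadratic form of the Christoffel symbols, while the Hessian of a
    symmetry is a symmetric bilinear form; the absence of torsion is what lets one determine the
    other.

    The obstacle is that the objects are given through choices: jets are sets of maps, connections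
    act on global fields. Every formula is therefore proved in coordinates, where it visibly depends
    on the 2-jet or the germ alone, and bump functions extend frames and localize connections. The
    Hausdorff property enters twice, in extending by zero out of a chart and in the uniqueness of
    geodesics.

    The curve [exp_x (t u)] is compared with a geodesic for [t] in [0, 1] only, whereas the reversal
    of time needs both signs. Both curves are smooth at 0, so agreement on one side fixes their
    derivatives there.

    Zero velocities are equilibria of the geodesic spray, so trajectories starting nearby live
    beyond time 1 and give the exponential map directly. Flows are treated in all dimensions at
    once, because doubling the dimension gains one order of smoothness. *)

Lemma rV_norm_lt n (v : 'rV[R]_n) e :
  0 < e -> (forall i, `|v 0 i| < e) -> `|v| < e.
Proof.
move=> e0 H; rewrite /Num.Def.normr/= mx_normrE.
by apply/bigmax_ltP; split => // -[i j] _ /=; rewrite (ord1 i).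
Qed.

Lemma rV_norm_le n (v : 'rV[R]_n) e :
  0 <= e -> (forall i, `|v 0 i| <= e) -> `|v| <= e.
Proof.
move=> e0 H; rewrite /Num.Def.normr/= mx_normrE.
by apply: bigmax_le => // -[i j] _ /=; rewrite (ord1 i).
Qed.

Lemma rV_coord_le n (v : 'rV[R]_n) i : `|v 0 i| <= `|v|.
Proof.
rewrite [leRHS]/Num.Def.normr/= mx_normrE.
exact: (le_bigmax _ (fun ij : 'I_1 * 'I_n => `|v ij.1 ij.2|) (0, i)).
Qed.

Lemma cvg_rV {T : Type} {F : set_system T} {FF : Filter F} n
    (g : T -> 'rV[R]_n) (l : 'rV[R]_n) :
  (forall i, (fun t => g t 0 i) @ F --> l 0 i) -> g @ F --> l.
Proof.
move=> H; apply/cvgrPdist_lt => e e0.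
have : \forall t \near F, forall i, `|l 0 i - g t 0 i| < e.
  apply: filter_forall => i; move/cvgrPdist_lt: (H i); exact.
apply: filterS => t Ht; apply: rV_norm_lt => // i.
by rewrite !mxE.
Qed.

Lemma rV_continuous {T : topologicalType} n (g : T -> 'rV[R]_n) x :
  (forall i, {for x, continuous (fun t => g t 0 i)}) -> {for x, continuous g}.
Proof. by move=> H; apply: cvg_rV => i; exact: H. Qed.

Lemma rV_continuous_coord {T : topologicalType} n (g : T -> 'rV[R]_n) x :
  {for x, continuous g} -> forall i, {for x, continuous (fun t => g t 0 i)}.
Proof.
move=> H i; apply: (continuous_comp (f := g) (g := fun M : 'rV[R]_n => M 0 i)) => //.
exact: coord_continuous.
Qed.

Lemma rV_sum_delta n (v : 'rV[R]_n) : v = \sum_j v 0 j *: delta_mx 0 j.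
Proof. exact: row_sum_delta. Qed.

Lemma is_derive_rV {V : normedModType R} n (g : V -> 'rV[R]_n) (d : 'rV[R]_n) x v :
  (forall i, is_derive x v (fun t => g t 0 i) (d 0 i)) -> is_derive x v g d.
Proof.
move=> H; have dg : derivable g x v.
  apply: (derivable_mxP g x v).2 => i j; rewrite (ord1 i); exact: (@ex_derive _ _ _ _ _ _ _ (H j)).
split => //; rewrite derive_mx //; apply/rowP => j; rewrite !mxE.
exact: (@derive_val _ _ _ _ _ _ _ (H j)).
Qed.

Lemma is_derive_coord {V : normedModType R} n (g : V -> 'rV[R]_n) (d : 'rV[R]_n) x v :
  is_derive x v g d -> forall i, is_derive x v (fun t => g t 0 i) (d 0 i).
Proof.
move=> [dg gd] i; split; first exact: (derivable_mxP g x v).1 dg 0 i.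
by rewrite -gd derive_mx // !mxE.
Qed.

End RowVectors.

(** * Closure properties of C^k functions *)

Section Ck.
Context {R : realType} {V : normedModType R}.
Implicit Types (U W : set V) (f g : V -> R).

Lemma CkC k U f u : Ck k U f -> U u -> {for u, continuous f}.
Proof. by case: k => [|k] [H _]; exact: H. Qed.

Lemma Ck_derivable k U f u v : Ck k.+1 U f -> U u -> derivable f u v.
Proof. by move=> [_ H] Uu; have [+ _] := H v; exact. Qed.

Lemma Ck_derive k U f v : Ck k.+1 U f -> Ck k U ('D_v f).
Proof. by move=> [_ H]; have [_] := H v. Qed.

Lemma CkS k U f : Ck k.+1 U f -> Ck k U f.
Proof.
elim: k f => [|k IH] f [H1 H2]; first by split.
by split => // v; have [H3 H4] := H2 v; split => //; exact: IH.
Qed.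

Lemma Ck_subset k U W f : W `<=` U -> Ck k U f -> Ck k W f.
Proof.
move=> WU; elim: k f => [|k IH] f [H1 H2]; split => //; try by move=> u /WU /H1.
by move=> v; have [H3 H4] := H2 v; split; [move=> u /WU /H3|exact: IH].
Qed.

Lemma open_near_eq U f g u : open U -> U u ->
  (forall x, U x -> f x = g x) -> \near u, f u = g u.
Proof.
move=> oU Uu fg; near=> x; apply: fg; near: x; exact: open_nbhs_nbhs.
Unshelve. all: by end_near. Qed.

Lemma Ck_ext k U f g : open U -> (forall u, U u -> f u = g u) ->
  Ck k U f -> Ck k U g.
Proof.
move=> oU; elim: k f g => [|k IH] f g fg [H1 H2].
  split => // u Uu; have fgu := open_near_eq oU Uu fg.
  rewrite /prop_for /continuous_at -fg //.
  exact: cvg_trans (near_eq_cvg fgu) (H1 u Uu).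
split.
  move=> u Uu; have fgu := open_near_eq oU Uu fg.
  rewrite /prop_for /continuous_at -fg //.
  exact: cvg_trans (near_eq_cvg fgu) (H1 u Uu).
move=> v; have [H3 H4] := H2 v; split.
  move=> u Uu; have fgu := open_near_eq oU Uu fg.
  exact: (near_eq_derivable fgu (H3 u Uu)).
apply: IH H4 => u Uu; apply: near_eq_derive; exact: open_near_eq oU Uu fg.
Qed.

Lemma Ck_cst k U (a : R) : Ck k U (cst a).
Proof.
elim: k a => [|k IH] a; split => //; try by move=> u _; exact: cvg_cst.
move=> v; split => //.
rewrite (_ : 'D_v (cst a) = cst 0); first exact: IH.
by apply/funext => u; rewrite derive_cst.
Qed.

Lemma CkD k U f g : open U -> Ck k U f -> Ck k U g -> Ck k U (fun u => f u + g u).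
Proof.
move=> oU; elim: k f g => [|k IH] f g [H1 H2] [G1 G2]; split => //.
- by move=> u Uu; apply: cvgD; [exact: H1|exact: G1].
- by move=> u Uu; apply: cvgD; [exact: H1|exact: G1].
move=> v; have [H3 H4] := H2 v; have [G3 G4] := G2 v; split.
  by move=> u Uu; apply: derivableD; [exact: H3|exact: G3].
apply: Ck_ext (IH _ _ H4 G4) => // u Uu.
by rewrite deriveD //; [exact: H3|exact: G3].
Qed.

Lemma CkM k U f g : open U -> Ck k U f -> Ck k U g -> Ck k U (fun u => f u * g u).
Proof.
move=> oU; elim: k f g => [|k IH] f g Hf Hg.
  by split => // u Uu; apply: cvgM; [exact: CkC Hf Uu|exact: CkC Hg Uu].
split; first by move=> u Uu; apply: cvgM; [exact: CkC Hf Uu|exact: CkC Hg Uu].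
move=> v; split.
  by move=> u Uu; apply: derivableM; [exact: Ck_derivable Hf Uu|exact: Ck_derivable Hg Uu].
apply: (@Ck_ext _ _ (fun u => f u * 'D_v g u + g u * 'D_v f u)) => //.
  move=> u Uu; rewrite deriveM //; first exact: Ck_derivable Hf Uu.
  exact: Ck_derivable Hg Uu.
by apply: CkD => //; apply: IH; try exact: CkS; exact: Ck_derive.
Qed.

Lemma Ck_sum k U (I : Type) (r : seq I) (F : I -> V -> R) : open U ->
  (forall i, Ck k U (F i)) -> Ck k U (fun u => \sum_(i <- r) F i u).
Proof.
move=> oU H; elim: r => [|i r IH].
  by apply: Ck_ext (Ck_cst k U 0) => // u _; rewrite big_nil.
by apply: Ck_ext (CkD oU (H i) IH) => // u _; rewrite big_cons.
Qed.

Lemma CkV k U f : open U -> (forall u, U u -> f u != 0) -> Ck k U f ->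
  Ck k U (fun u => (f u)^-1).
Proof.
move=> oU f0; elim: k => [|k IH] Hf.
  by split => // u Uu; apply: cvgV; [exact: f0|exact: CkC Hf Uu].
split; first by move=> u Uu; apply: cvgV; [exact: f0|exact: CkC Hf Uu].
move=> v; split.
  by move=> u Uu; apply: derivableV; [exact: f0|exact: Ck_derivable Hf Uu].
apply: (@Ck_ext _ _ (fun u => -1 * ((f u)^-1 * (f u)^-1) * 'D_v f u)) => //.
  move=> u Uu; rewrite deriveV ?f0 //; last exact: Ck_derivable Hf Uu.
  by rewrite -exprVn expr2 /GRing.scale/= mulN1r.
by apply: CkM => //; [apply: CkM => //; [exact: Ck_cst|apply: CkM => //; apply: IH; exact: CkS]
  |exact: Ck_derive].
Qed.

Lemma Ck_linear k U (f : {linear V -> R^o}) : continuous f -> Ck k U f.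
Proof.
move=> cf; case: k => [|k]; first by split=> [u _|]; [exact: cf|].
split=> [u _|v]; first exact: cf.
have D u : is_derive u v f (f v).
  have df := @linear_differentiable _ _ _ f u cf.
  by split; [exact: diff_derivable|rewrite deriveE // diff_lin].
split; first by move=> u _; exact: ex_derive.
rewrite (_ : 'D_v f = cst (f v)); first exact: Ck_cst.
by apply/funext => u; rewrite derive_val.
Qed.

End Ck.

(** * Total differentiability from continuous directional derivatives *)

Section Differentiability.
Context {R : realType}.

Lemma near_normP {V : normedModType R} (x : V) (P : V -> Prop) :
  (\forall y \near x, P y) <-> exists2 r : R, 0 < r & forall y, `|y - x| < r -> P y.
Proof.
split=> [/nbhs_ballP[r /= r0 Hr]|[r r0 Hr]].
  by exists r => // y xy; apply: Hr; rewrite -ball_normE/= distrC.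
by apply/nbhs_ballP; exists r => // y; rewrite -ball_normE/= distrC; exact: Hr.
Qed.

Lemma continuous_normP {V W : normedModType R} (f : V -> W) (x : V) :
  {for x, continuous f} <-> forall e : R, 0 < e ->
    exists2 r : R, 0 < r & forall y, `|y - x| < r -> `|f y - f x| < e.
Proof.
split=> [/cvgrPdist_lt H e e0|H].
  by have /near_normP[r r0 Hr] := H e e0; exists r => // y /Hr; rewrite distrC.
apply/cvgrPdist_lt => e e0; apply/near_normP; have [r r0 Hr] := H e e0.
by exists r => // y /Hr; rewrite distrC.
Qed.

Lemma cvg_bigsum {T : Type} {F : set_system T} {FF : Filter F} (I : Type)
    (r : seq I) (f : I -> T -> R) (l : I -> R) :
  (forall i, f i @ F --> l i) ->
  (fun t => \sum_(i <- r) f i t) @ F --> \sum_(i <- r) l i.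
Proof.
move=> H; elim: r => [|i r IH].
  by under eq_fun do rewrite big_nil; rewrite big_nil; exact: cvg_cst.
by under eq_fun do rewrite big_cons; rewrite big_cons; exact: cvgD.
Qed.

Lemma near_forall_ord {T : topologicalType} (x : T) (I : finType) (P : I -> T -> Prop) :
  (forall i, \near x, P i x) -> \near x, forall i, P i x.
Proof. exact: filter_forall. Qed.

Lemma is_derive_line {V W : normedModType R} (f : V -> W) (u v : V) (t : R) (d : W) :
  is_derive (u + t *: v) v f d -> is_derive t 1 (fun s : R => f (u + s *: v)) d.
Proof.
move=> [dv dd]; have E : (fun h : R => h^-1 *: (((fun s : R => f (u + s *: v)) \o shift t) (h *: 1) - f (u + t *: v))) =
  (fun h : R => h^-1 *: ((f \o shift (u + t *: v)) (h *: v) - f (u + t *: v))).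
  apply/funext => h /=; congr (_ *: (f _ - _)).
  by rewrite [_%:A]mulr1 scalerDl addrCA.
by split; [rewrite /derivable E|rewrite /derive E].
Qed.

Lemma MVT_line {V : normedModType R} (f df : V -> R) (u v : V) :
  (forall t : R, 0 <= t <= 1 -> is_derive (u + t *: v) v f (df (u + t *: v))) ->
  exists2 t : R, 0 < t < 1 & f (u + v) - f u = df (u + t *: v).
Proof.
move=> H; pose g (s : R) := f (u + s *: v).
have dg (t : R) : 0 <= t <= 1 -> is_derive t 1 g (df (u + t *: v)).
  by move=> /H; exact: is_derive_line.
have [] := @MVT R g (fun t => df (u + t *: v)) 0 1 ltr01.
- by move=> t; rewrite in_itv/= => /andP[t0 t1]; apply: dg; rewrite !ltW.
- apply: derivable_within_continuous => t; rewrite in_itv/= => t01.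
  exact: (@ex_derive _ _ _ _ _ _ _ (dg t t01)).
move=> c; rewrite in_itv/= => c01 E; exists c => //.
by move: E; rewrite /g scale1r scale0r addr0 subr0 mulr1.
Qed.

(** Homogeneity in the direction needs no total differentiability: along a line [f] is a function of
    one real variable, for which derivable and differentiable agree. *)
Lemma is_derive_scale {V : normedModType R} (f : V -> R) (x v : V) (c d : R) :
  is_derive x v f d -> is_derive x (c *: v) f (c * d).
Proof.
move=> Dx; pose g (s : R) := f (x + s *: v).
have Dg : is_derive (0 : R) (1 : R) g d by apply: is_derive_line; rewrite scale0r addr0.
have dg := (derivable1_diffP _ _).1 (@ex_derive _ _ _ _ _ _ _ Dg).
have [dv dd] : is_derive (0 : R) c g (c * d).
  split; first exact: diff_derivable.
  rewrite deriveE // -[c in LHS]mulr1 -[c * 1]/(c *: (1 : R^o)) linearZ.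
  by rewrite -deriveE // (@derive_val _ _ _ _ _ _ _ Dg).
have E : (fun h : R => h^-1 *: ((f \o shift x) (h *: (c *: v)) - f x)) =
     (fun h : R => h^-1 *: ((g \o shift 0) (h *: c) - g 0)).
  by apply/funext => h1; rewrite /g /= scale0r !addr0 scalerA [_ + x]addrC.
by split; [rewrite /derivable E|rewrite /derive E].
Qed.

Lemma differentiable_lin n (f : 'rV[R]_n -> R) (a : 'I_n -> R) u :
  (forall e : R, 0 < e -> \forall h \near (0 : 'rV[R]_n),
     `|f (u + h) - f u - \sum_j h 0 j * a j| <= e * `|h|) ->
  differentiable f u.
Proof.
move=> H; pose L (h : 'rV[R]_n) : R := \sum_j h 0 j * a j.
have linL : linear L.
  move=> c x y; rewrite /L scaler_sumr -big_split/=; apply: eq_bigr => i _.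
  by rewrite !mxE mulrDl /GRing.scale/= mulrA.
pose LM := GRing.isLinear.Build _ _ _ _ L linL.
pose LL : {linear 'rV[R]_n -> R^o} := HB.pack L LM.
have cL : continuous (LL : 'rV[R]_n -> R^o).
  move=> x; rewrite /continuous_at/= /L.
  apply: (@cvg_bigsum _ (nbhs (x : 'rV[R]_n))) => i; apply: cvgMl; exact: coord_continuous.
have E : f \o shift u = cst (f u) + LL +o_ (0 : 'rV[R]_n) id.
  apply/eqaddoP => e /= e0; have := H e e0.
  apply: filterS => h.
  have -> : (f \o shift u - (cst (f u) + LL)) h = f (h + u) - (f u + L h) by [].
  by rewrite opprD addrA [h + u]addrC.
apply/diff_locallyP; rewrite (diff_unique cL E); split => //.
Qed.

(** [Ck] only speaks of directional derivatives; the differential is recovered by moving from [u] to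
    [u + h] one coordinate at a time and using the mean value theorem on each leg. *)
Lemma C1_differentiable n (U : set 'rV[R]_n) (f : 'rV[R]_n -> R) u :
  open U -> Ck 1 U f -> U u -> differentiable f u.
Proof.
move=> oU Hf Uu.
apply: (@differentiable_lin _ _ (fun j => 'D_(delta_mx 0 j) f u)) => e e0.
have /near_normP[r r0 Hr] : \forall x \near u, U x /\
    forall j : 'I_n, `|'D_(delta_mx 0 j) f u - 'D_(delta_mx 0 j) f x| <= e / n.+1%:R.
  apply: filterI; first exact: open_nbhs_nbhs.
  suff Hj (j : 'I_n) : \forall x \near u,
      `|'D_(delta_mx 0 j) f u - 'D_(delta_mx 0 j) f x| <= e / n.+1%:R.
    exact: (@near_forall_ord 'rV[R]_n u 'I_n _ Hj).
  have := CkC (Ck_derive (delta_mx 0 j) Hf) Uu.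
  move/cvgrPdist_le; apply; exact: divr_gt0.
apply/near_normP; exists r => // h; rewrite subr0 => hr.
(* [p k] keeps the first [k] coordinates of [h], so the increment of [f] telescopes over legs
   parallel to the axes. *)
pose p (k : nat) : 'rV[R]_n := \row_j (if (j < k)%N then h 0 j else 0).
have p0 : p 0 = 0 by apply/rowP => j; rewrite !mxE.
have pn : p n = h by apply/rowP => j; rewrite !mxE ltn_ord.
have pS (k : 'I_n) : p k.+1 = p k + h 0 k *: delta_mx 0 k.
  apply/rowP => j; rewrite !mxE eqxx /= ltnS leq_eqVlt.
  have [->|jk] := eqVneq j k; first by rewrite eqxx ltnn /= add0r mulr1.
  by rewrite /= -val_eqE/= in jk *; rewrite (negbTE jk) /= mulr0 addr0.
(* In the sup norm no point of a leg is farther from [u] than [u + h]. *)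
have pin (k : 'I_n) (t : R) : 0 <= t <= 1 -> `|u + p k + t *: (h 0 k *: delta_mx 0 k) - u| < r.
  move=> /andP[t0 t1]; rewrite addrAC [u + p k]addrC addrK.
  apply: le_lt_trans hr; apply: rV_norm_le => // j; rewrite !mxE eqxx /=.
  case: ltnP => jk.
    have -> : (j == k) = false by rewrite -val_eqE/= ltn_eqF.
    by rewrite !mulr0 addr0 rV_coord_le.
  rewrite add0r; have [_|_] := eqVneq j k; last by rewrite !mulr0 normr0.
  rewrite mulr1 normrM (ger0_norm t0).
  by apply: le_trans (rV_coord_le h k); rewrite ler_piMl.
have -> : f (u + h) - f u = \sum_(k < n) (f (u + p k.+1) - f (u + p k)).
  rewrite -(big_mkord xpredT (fun k => f (u + p k.+1) - f (u + p k))).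
  by rewrite telescope_sumr // pn p0 addr0.
(* Each of the [n] legs contributes at most [e / n.+1] times the norm of [h]; [n.+1] keeps the
   quotient meaningful for [n = 0]. *)
rewrite -sumrB; apply: (@le_trans _ _ (\sum_(k < n) (e / n.+1%:R * `|h|))); last first.
  rewrite sumr_const card_ord -[leLHS]mulr_natr mulrAC ler_wpM2r //.
  by rewrite -mulrA ler_piMr ?(ltW e0) // mulrC ler_pdivrMr // mul1r ler_nat.
apply: le_trans (ler_norm_sum _ _ _) _; apply: ler_sum => k _.
have D x : U x -> is_derive x (h 0 k *: delta_mx 0 k) f (h 0 k * 'D_(delta_mx 0 k) f x).
  move=> Ux.
  by apply: is_derive_scale; apply: derivableP; exact: Ck_derivable Hf Ux.
have [t t01 E] := @MVT_line _ f (fun x => h 0 k * 'D_(delta_mx 0 k) f x) (u + p k) (h 0 k *: delta_mx 0 k)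
   (fun t Ht => D _ (Hr _ (pin k t Ht)).1).
rewrite pS addrA E -mulrBr normrM mulrC.
apply: ler_pM => //; last exact: rV_coord_le.
rewrite distrC; apply: (Hr _ (pin k t _)).2; by case/andP: t01 => /ltW -> /ltW ->.
Qed.

End Differentiability.

(** * Chain rule and symmetry of second derivatives *)

Section ChainRule.
Context {R : realType}.

Lemma is_derive_line0 {V W : normedModType R} (f : V -> W) (u v : V) (d : W) :
  is_derive (0 : R) (1 : R) (fun s : R => f (u + s *: v)) d -> is_derive u v f d.
Proof.
move=> [dv dd].
have E : (fun h : R => h^-1 *: ((f \o shift u) (h *: v) - f u)) =
  (fun h : R => h^-1 *: (((fun s : R => f (u + s *: v)) \o shift 0) (h *: 1) - f (u + 0 *: v))).
  by apply/funext => h /=; rewrite [_%:A]mulr1 addr0 scale0r addr0 [_ + u]addrC.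
by split; [rewrite /derivable E|rewrite /derive E].
Qed.

(** Only the outer map has to be differentiable: restricting [g] to the line [u + s *: v] turns its
    directional derivative into the derivative of a curve. *)
Lemma is_derive_comp {V U W : normedModType R} (f : U -> W) (g : V -> U) u v d :
  differentiable f (g u) -> is_derive u v g d ->
  is_derive u v (f \o g) ('D_d f (g u)).
Proof.
move=> df dg; apply: is_derive_line0.
pose h (s : R) := g (u + s *: v).
have Dh : is_derive (0 : R) (1 : R) h d by apply: is_derive_line; rewrite scale0r addr0.
have h0 : h 0 = g u by rewrite /h scale0r addr0.
have dh := (derivable1_diffP _ _).1 (@ex_derive _ _ _ _ _ _ _ Dh).
have dfh : differentiable f (h 0) by rewrite h0.
change (is_derive (0 : R) (1 : R) (f \o h) ('D_d f (g u))).
split; first by apply/derivable1_diffP; exact: differentiable_comp.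
rewrite (deriveE _ (differentiable_comp dh dfh)) diff_comp //= -(deriveE _ dh).
by rewrite (@derive_val _ _ _ _ _ _ _ Dh) h0 deriveE.
Qed.

Lemma derive_lin {V W : normedModType R} (f : V -> W) u (a : R) v w :
  differentiable f u -> 'D_(a *: v + w) f u = a *: 'D_v f u + 'D_w f u.
Proof. by move=> df; rewrite !deriveE // linearP. Qed.

Lemma derive_coord n (W : normedModType R) (f : 'rV[R]_n -> W) u v :
  differentiable f u -> 'D_v f u = \sum_j v 0 j *: 'D_(delta_mx 0 j) f u.
Proof.
move=> df; rewrite deriveE // {1}[v]rV_sum_delta linear_sum.
by apply: eq_bigr => j _; rewrite linearZ deriveE.
Qed.

Context {V : normedModType R}.

(** By the chain rule a derivative of [f \o g] is a sum of products of a derivative of [g] with a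
    partial derivative of [f] composed with [g], to which the induction on [k] applies. *)
Lemma Ck_comp m k (U : set V) (W : set 'rV[R]_m) (f : 'rV[R]_m -> R) (g : V -> 'rV[R]_m) :
  open U -> open W -> (forall i, Ck k U (fun x => g x 0 i)) -> Ck k W f ->
  (forall u, U u -> W (g u)) -> Ck k U (f \o g).
Proof.
move=> oU oW; elim: k f => [|k IH] f Hg Hf UW.
  split => // u Uu; apply: continuous_comp; last exact: CkC Hf (UW _ Uu).
  by apply: rV_continuous => i; exact: CkC (Hg i) Uu.
have Cg u : U u -> {for u, continuous g}.
  by move=> Uu; apply: rV_continuous => i; exact: CkC (Hg i) Uu.
split.
  move=> u Uu; apply: continuous_comp; first exact: Cg.
  exact: CkC Hf (UW _ Uu).
have W1 : Ck 1 W f by elim: k {IH Hg} Hf => // k IH /CkS.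
move=> v; have D u : U u -> is_derive u v (f \o g)
    (\sum_j 'D_v (fun x => g x 0 j) u * 'D_(delta_mx 0 j) f (g u)).
  move=> Uu; have df := C1_differentiable oW W1 (UW _ Uu).
  have dg : is_derive u v g (\row_j 'D_v (fun x => g x 0 j) u).
    apply: is_derive_rV => i; rewrite mxE; apply: derivableP.
    exact: Ck_derivable (Hg i) Uu.
  have := is_derive_comp df dg; rewrite derive_coord //.
  by under eq_bigr do rewrite mxE.
split; first by move=> u /D[].
apply: (@Ck_ext _ _ _ _ (fun u => \sum_j 'D_v (fun x => g x 0 j) u * 'D_(delta_mx 0 j) f (g u))) => //.
  by move=> u /D => Du; rewrite derive_val.
apply: Ck_sum => // j; apply: CkM => //; first exact: Ck_derive.
by apply: (IH ('D_(delta_mx 0 j) f)) => //; [move=> i; exact: CkS|exact: Ck_derive].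
Qed.

(** The reals are not the type ['rV[R]_1], so outer functions of one real variable have their own
    version. *)
Lemma Ck_comp1 k (U : set V) (W : set R) (f : R -> R) (g : V -> R) :
  open U -> Ck k U g -> Ck k W f ->
  (forall u, U u -> W (g u)) -> Ck k U (f \o g).
Proof.
move=> oU; elim: k f => [|k IH] f Hg Hf UW.
  split => // u Uu; apply: continuous_comp; last exact: CkC Hf (UW _ Uu).
  exact: CkC Hg Uu.
split.
  move=> u Uu; apply: continuous_comp; last exact: CkC Hf (UW _ Uu).
  exact: CkC Hg Uu.
move=> v; have D u : U u -> is_derive u v (f \o g) ('D_v g u * 'D_1 f (g u)).
  move=> Uu; have df : differentiable f (g u).
    by apply/derivable1_diffP; exact: Ck_derivable Hf (UW _ Uu).
  have dg : is_derive u v g ('D_v g u) by apply: derivableP; exact: Ck_derivable Hg Uu.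
  have := is_derive_scale ('D_v g u) (derivableP (Ck_derivable (v := (1 : R)) Hf (UW _ Uu))).
  rewrite [_ *: _]mulr1 => E.
  have := is_derive_comp df dg.
  by rewrite (@derive_val _ _ _ _ _ _ _ E).
split; first by move=> u /D[].
apply: (@Ck_ext _ _ _ _ (fun u => 'D_v g u * 'D_1 f (g u))) => //.
  by move=> u /D => Du; rewrite derive_val.
apply: CkM => //; first exact: Ck_derive.
by apply: (IH ('D_1 f)) => //; [exact: CkS|exact: Ck_derive].
Qed.

(** Two applications of the mean value theorem: to [x -> f (x + w) - f x] in the direction [v], then
    to ['D_v f] in the direction [w]. *)
Lemma second_difference (U : set V) (f : V -> R) (u v w : V) :
  Ck 2 U f ->
  (forall s t : R, 0 <= s <= 1 -> 0 <= t <= 1 -> U (u + s *: v + t *: w)) ->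
  exists s t : R, [/\ 0 <= s <= 1, 0 <= t <= 1 &
    f (u + v + w) - f (u + v) - (f (u + w) - f u) =
    'D_w ('D_v f) (u + s *: v + t *: w)].
Proof.
move=> Hf Uuvw.
have I0 : 0 <= (0 : R) <= 1 by rewrite lexx ler01.
have I1 : 0 <= (1 : R) <= 1 by rewrite lexx ler01.
pose g x := f (x + w) - f x.
have [|s s01 E] := @MVT_line _ _ g (fun x => 'D_v f (x + w) - 'D_v f x) u v.
  move=> s s01; apply: is_deriveB.
    apply: is_derive_line0.
    have Uu := Uuvw s 1 s01 I1; rewrite scale1r in Uu.
    have := derivableP (Ck_derivable (v := v) Hf Uu) => H.
    have -> : (fun s0 : R => f (u + s *: v + s0 *: v + w)) = (fun s0 : R => f (u + s *: v + w + s0 *: v)).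
      by apply/funext => t; rewrite addrAC.
    by apply: is_derive_line; rewrite scale0r addr0.
  apply: derivableP; have Uu := Uuvw s 0 s01 I0; rewrite scale0r addr0 in Uu.
  exact: Ck_derivable Hf Uu.
have {}s01 : 0 <= s <= 1 by case/andP: s01 => /ltW -> /ltW ->.
have [|t t01 E'] := @MVT_line _ _ ('D_v f) ('D_w ('D_v f)) (u + s *: v) w.
  move=> t t01; apply: derivableP; exact: Ck_derivable (Ck_derive v Hf) (Uuvw _ _ s01 t01).
exists s, t; split => //; first by case/andP: t01 => /ltW -> /ltW ->.
by rewrite -E' -E /g.
Qed.

Lemma Ck_derivable_scale (U : set V) (f : V -> R) (c : R) v x : Ck 1 U f -> U x ->
  'D_(c *: v) f x = c * 'D_v f x.
Proof.
move=> Hf Ux; have := is_derive_scale c (derivableP (Ck_derivable (v := v) Hf Ux)) => H.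
by rewrite derive_val.
Qed.

Lemma dist_half_le (a b x y e : R) :
  x = y -> `|x - a| < e / 2 -> `|y - b| < e / 2 -> `|a - b| <= e.
Proof.
move=> -> H1 H2; rewrite (splitr e) -(subrKA y) (le_trans (ler_normD _ _)) //.
by rewrite lerD // ltW // distrC.
Qed.

(** The second difference over a parallelogram is symmetric in its sides, and it equals each of the
    mixed derivatives at some point of a small parallelogram; continuity brings both points back to
    [u]. *)
Lemma derive_sym (U : set V) (f : V -> R) (u v w : V) :
  open U -> Ck 2 U f -> U u -> 'D_v ('D_w f) u = 'D_w ('D_v f) u.
Proof.
move=> oU Hf Uu; apply/eqP; rewrite -subr_eq0 -normr_le0; apply/ler_addgt0Pl => e e0.
rewrite addr0.
have c1 := CkC (Ck_derive v (Ck_derive w Hf)) Uu.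
have c2 := CkC (Ck_derive w (Ck_derive v Hf)) Uu.
have e2 : 0 < e / 2 by rewrite divr_gt0.
have [r1 r10 H1] := (continuous_normP _ _).1 c1 _ e2.
have [r2 r20 H2] := (continuous_normP _ _).1 c2 _ e2.
have /near_normP[r3 r30 H3] := open_nbhs_nbhs (conj oU Uu).
pose r := Num.min r1 (Num.min r2 r3).
have r0 : 0 < r by rewrite /r !lt_min r10 r20 r30.
(* Shrinking both sides by [c] keeps the parallelogram within distance [r] of [u]; the added 1
   guards against [v = w = 0]. *)
pose c : R := r / (`|v| + `|w| + 1).
have c0 : 0 < c by rewrite divr_gt0 // ltr_wpDl // addr_ge0.
have cc0 : c * c != 0 by rewrite mulf_neq0 // gt_eqF.
have cr : c * (`|v| + `|w|) < r.
  have N0 : 0 < `|v| + `|w| + 1 by rewrite ltr_wpDl // addr_ge0.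
  by rewrite /c mulrAC ltr_pdivrMr // ltr_pM2l // ltrDl.
clearbody c.
have Hc (s t : R) : 0 <= s <= 1 -> 0 <= t <= 1 ->
    `|u + s *: (c *: v) + t *: (c *: w) - u| < r.
  move=> /andP[s0 s1] /andP[t0 t1].
  rewrite addrAC [u + _]addrC addrK.
  apply: le_lt_trans (ler_normD _ _) _.
  rewrite !normrZ (ger0_norm s0) (ger0_norm t0) (gtr0_norm c0).
  apply: (@le_lt_trans _ _ (c * (`|v| + `|w|))).
    have cv : 0 <= c * `|v| by rewrite mulr_ge0 // ltW.
    have cw : 0 <= c * `|w| by rewrite mulr_ge0 // ltW.
    by rewrite mulrDr lerD // ler_piMl.
  exact: cr.
have Hc1 x : `|x - u| < r -> `|x - u| < r1 by move/lt_le_trans; apply; rewrite /r ge_min lexx.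
have Hc2 x : `|x - u| < r -> `|x - u| < r2.
  by move/lt_le_trans; apply; rewrite /r !ge_min lexx orbT.
have Hc3 x : `|x - u| < r -> U x.
  by move=> H; apply: H3; apply: lt_le_trans H _; rewrite /r !ge_min lexx !orbT.
have [s [t [s01 t01 E]]] := second_difference Hf (fun s t Hs Ht => Hc3 _ (Hc s t Hs Ht)).
have swap a b : u + a *: (c *: w) + b *: (c *: v) = u + b *: (c *: v) + a *: (c *: w).
  by rewrite addrAC.
have [s' [t' [s'01 t'01 E']]] := @second_difference U f u (c *: w) (c *: v) Hf
  (fun s t Hs Ht => eq_rect_r U (Hc3 _ (Hc t s Ht Hs)) (swap s t)).
have cE x a b : U x -> 'D_(c *: a) ('D_(c *: b) f) x = c * c * 'D_a ('D_b f) x.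
  move=> Ux; have -> : 'D_(c *: a) ('D_(c *: b) f) x = 'D_(c *: a) (fun y => c * 'D_b f y) x.
    apply: near_eq_derive; apply: (@open_near_eq _ _ U) => // y Uy.
    exact: Ck_derivable_scale (CkS Hf) Uy.
  have Cc : Ck 1 U (fun y => c * 'D_b f y) := CkM oU (Ck_cst 1 U c) (Ck_derive b Hf).
  rewrite (Ck_derivable_scale c a Cc Ux).
  have dD : derivable ('D_b f) x a by exact: Ck_derivable (Ck_derive b Hf) Ux.
  by rewrite -mulrA; congr (_ * _); have := deriveZ c dD.
rewrite swap in E'.
have EE : c * c * 'D_w ('D_v f) (u + s *: (c *: v) + t *: (c *: w)) =
          c * c * 'D_v ('D_w f) (u + t' *: (c *: v) + s' *: (c *: w)).
  have U1 := Hc3 _ (Hc s t s01 t01); have U2 := Hc3 _ (Hc t' s' t'01 s'01).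
  rewrite -(cE _ w v U1) -(cE _ v w U2) -E -E' [u + c *: w + _]addrAC.
  by rewrite !opprB addrACA [X in _ + X]addrC -addrACA.
have {}EE := mulfI cc0 EE.
have A1 := H1 _ (Hc1 _ (Hc t' s' t'01 s'01)).
have A2 := H2 _ (Hc2 _ (Hc s t s01 t01)).
exact: (dist_half_le (esym EE) A1 A2).
Qed.

End ChainRule.

(** * Functions smooth near a point *)

Section SmoothAt.
Context {R : realType} {V : normedModType R}.
Implicit Types (f g : V -> R) (u v w : V).

Lemma smooth_at_near f u : smooth_at f u -> \forall x \near u, smooth_at f x.
Proof.
move=> [U [oU Uu] H]; near=> x; exists U => //; split => //.
by near: x; exact: open_nbhs_nbhs.
Unshelve. all: by end_near. Qed.

Lemma smooth_at_ext f g u : (\near u, f u = g u) -> smooth_at f u -> smooth_at g u.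
Proof.
rewrite -nbhs_nearE nbhsE => -[W [oW Wu] fg] [U [oU Uu] H].
exists (U `&` W); first by split; [exact: openI|].
move=> k; apply: (@Ck_ext _ _ k (U `&` W) f); first exact: openI.
  by move=> x [_ /fg].
by apply: Ck_subset (H k) => x [].
Qed.

Lemma smooth_at_cst (a : R) u : smooth_at (cst a) u.
Proof. by exists setT; [split; [exact: openT|]|move=> k; exact: Ck_cst]. Qed.

Let smooth_at2 (op : (V -> R) -> (V -> R) -> V -> R) :
  (forall k U f g, open U -> Ck k U f -> Ck k U g -> Ck k U (op f g)) ->
  forall f g u, smooth_at f u -> smooth_at g u -> smooth_at (op f g) u.
Proof.
move=> H f g u [U [oU Uu] Hf] [W [oW Wu] Hg].
exists (U `&` W); first by split; [exact: openI|].
move=> k; apply: H; first exact: openI.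
  by apply: Ck_subset (Hf k) => x [].
by apply: Ck_subset (Hg k) => x [].
Qed.

Lemma smooth_atD f g u : smooth_at f u -> smooth_at g u -> smooth_at (fun x => f x + g x) u.
Proof. by apply: (smooth_at2 (op := fun f g x => f x + g x)) => *; exact: CkD. Qed.

Lemma smooth_atM f g u : smooth_at f u -> smooth_at g u -> smooth_at (fun x => f x * g x) u.
Proof. by apply: (smooth_at2 (op := fun f g x => f x * g x)) => *; exact: CkM. Qed.

Lemma smooth_atN f u : smooth_at f u -> smooth_at (fun x => - f x) u.
Proof.
move=> Hf; apply: (@smooth_at_ext (fun x => cst (-1) x * f x)).
  by near=> x; rewrite /= mulN1r.
by apply: smooth_atM => //; exact: smooth_at_cst.
Unshelve. all: by end_near. Qed.

Lemma smooth_atB f g u : smooth_at f u -> smooth_at g u -> smooth_at (fun x => f x - g x) u.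
Proof. by move=> Hf /smooth_atN; exact: smooth_atD. Qed.

Lemma smooth_at_sum (I : Type) (r : seq I) (F : I -> V -> R) u :
  (forall i, smooth_at (F i) u) -> smooth_at (fun x => \sum_(i <- r) F i x) u.
Proof.
move=> H; elim: r => [|i r IH].
  by under eq_fun do rewrite big_nil; exact: smooth_at_cst.
by under eq_fun do rewrite big_cons; exact: smooth_atD.
Qed.

Lemma smooth_at_prod (I : Type) (r : seq I) (F : I -> V -> R) u :
  (forall i, smooth_at (F i) u) -> smooth_at (fun x => \prod_(i <- r) F i x) u.
Proof.
move=> H; elim: r => [|i r IH].
  by under eq_fun do rewrite big_nil; exact: smooth_at_cst.
by under eq_fun do rewrite big_cons; exact: smooth_atM.
Qed.

Lemma smooth_at_linear (f : {linear V -> R^o}) u : continuous f -> smooth_at f u.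
Proof.
by move=> cf; exists setT; [split; [exact: openT|]|move=> k; exact: Ck_linear].
Qed.

Lemma smooth_at_derive f u v : smooth_at f u -> smooth_at ('D_v f) u.
Proof. by move=> [U UU H]; exists U => // k; exact: Ck_derive. Qed.

Lemma smooth_at_continuous f u : smooth_at f u -> {for u, continuous f}.
Proof. by move=> [U [oU Uu] H]; exact: CkC (H 0) Uu. Qed.

Lemma smooth_at_derivable f u v : smooth_at f u -> derivable f u v.
Proof. by move=> [U [oU Uu] H]; exact: Ck_derivable (H 1) Uu. Qed.

Lemma smooth_at_is_derive f u v : smooth_at f u -> is_derive u v f ('D_v f u).
Proof. by move=> /smooth_at_derivable H; exact: derivableP. Qed.

Lemma smooth_at_sym f u v w : smooth_at f u -> 'D_v ('D_w f) u = 'D_w ('D_v f) u.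
Proof. by move=> [U [oU Uu] H]; exact: derive_sym oU (H 2) Uu. Qed.

Lemma derive_add f g u v : smooth_at f u -> smooth_at g u ->
  'D_v (fun x => f x + g x) u = 'D_v f u + 'D_v g u.
Proof. by move=> Hf Hg; apply: deriveD; exact: smooth_at_derivable. Qed.

Lemma derive_mul f g u v : smooth_at f u -> smooth_at g u ->
  'D_v (fun x => f x * g x) u = f u * 'D_v g u + g u * 'D_v f u.
Proof. by move=> Hf Hg; apply: deriveM; exact: smooth_at_derivable. Qed.

Lemma derive_opp f u v : smooth_at f u -> 'D_v (fun x => - f x) u = - 'D_v f u.
Proof. by move=> Hf; apply: deriveN; exact: smooth_at_derivable. Qed.

Lemma derive_scl (c : R) f u v : smooth_at f u ->
  'D_v (fun x => c * f x) u = c * 'D_v f u.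
Proof.
move=> Hf; rewrite (derive_mul v (smooth_at_cst c u) Hf).
by rewrite (derive_cst c u v) mulr0 addr0.
Qed.

Lemma derive_bigsum (I : Type) (r : seq I) (F : I -> V -> R) u v :
  (forall i, smooth_at (F i) u) ->
  'D_v (fun x => \sum_(i <- r) F i x) u = \sum_(i <- r) 'D_v (F i) u.
Proof.
move=> H; elim: r => [|i r IH].
  by under eq_fun do rewrite big_nil; rewrite big_nil derive_cst.
under eq_fun do rewrite big_cons; rewrite big_cons.
by rewrite derive_add ?IH //; exact: smooth_at_sum.
Qed.

Lemma derive_scale_dir (c : R) f u v : smooth_at f u -> 'D_(c *: v) f u = c * 'D_v f u.
Proof. by move=> [U [oU Uu] H]; exact: Ck_derivable_scale (H 1) Uu. Qed.

Definition vsmooth_at m (g : V -> 'rV[R]_m) u := forall i, smooth_at (fun x => g x 0 i) u.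

(** Each component comes with its own neighbourhood, but smoothness at a point persists nearby, so
    one ball serves all of them; on it [Ck] holds for every [k] because it is a pointwise
    condition. *)
Lemma vsmooth_at_common m (g : V -> 'rV[R]_m) u : vsmooth_at g u ->
  exists2 U : set V, open U /\ U u & forall k i, Ck k U (fun x => g x 0 i).
Proof.
move=> H; have /near_normP[r r0 Hr] : \forall x \near u, forall i : 'I_m,
    smooth_at (fun x => g x 0 i) x.
  suff Hi (i : 'I_m) : \forall x \near u, smooth_at (fun x => g x 0 i) x.
    exact: (@near_forall_ord V u 'I_m _ Hi).
  exact: smooth_at_near.
exists [set x | `|x - u| < r].
  split; last by rewrite /= subrr normr0.
  have -> : [set x | `|x - u| < r] = ball u r.
    by apply/seteqP; split => x /=; rewrite -ball_normE/= distrC.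
  exact: ball_open.
move=> k i.
have -> : [set x | `|x - u| < r] = \bigcup_(x in [set x | `|x - u| < r]) [set y | `|y - u| < r /\ y = x].
  apply/seteqP; split => x /=; first by move=> xr; exists x.
  by move=> [y yr [xr ->]].
elim: k (fun x => g x 0 i) (fun x xr => Hr x xr i) => [|k IH] h Hh.
  by split => // x [y yr [xr _]]; exact: smooth_at_continuous (Hh _ xr).
split; first by move=> x [y yr [xr _]]; exact: smooth_at_continuous (Hh _ xr).
move=> v; split; first by move=> x [y yr [xr _]]; exact: smooth_at_derivable (Hh _ xr).
by apply: IH => x xr; apply: smooth_at_derive; exact: Hh.
Qed.

Lemma vsmooth_at_continuous m (g : V -> 'rV[R]_m) u :
  vsmooth_at g u -> {for u, continuous g}.
Proof. by move=> H; apply: rV_continuous => i; exact: smooth_at_continuous. Qed.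

Lemma vsmooth_at_near m (g : V -> 'rV[R]_m) u :
  vsmooth_at g u -> \forall x \near u, vsmooth_at g x.
Proof.
move=> /vsmooth_at_common[U [oU Uu] H]; near=> x => i; exists U.
  by split => //; near: x; exact: open_nbhs_nbhs.
by move=> k; exact: H.
Unshelve. all: by end_near. Qed.

Lemma open_preimage {S T : topologicalType} (U : set S) (W : set T) (g : S -> T) :
  open U -> open W -> (forall x, U x -> {for x, continuous g}) -> open (U `&` g @^-1` W).
Proof.
move=> oU oW H; rewrite openE => x [Ux Wx] /=.
apply: filterI; first exact: open_nbhs_nbhs.
by apply: (H x Ux); exact: open_nbhs_nbhs.
Qed.

Lemma smooth_at_comp m (f : 'rV[R]_m -> R) (g : V -> 'rV[R]_m) u :
  smooth_at f (g u) -> vsmooth_at g u -> smooth_at (fun x => f (g x)) u.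
Proof.
move=> [W [oW Wu] Hf] /vsmooth_at_common[U [oU Uu] Hg].
have Cg x : U x -> {for x, continuous g}.
  by move=> Ux; apply: rV_continuous => i; exact: CkC (Hg 0 i) Ux.
have oUW := open_preimage oU oW Cg.
exists (U `&` g @^-1` W) => // k.
apply: (@Ck_comp _ _ _ k _ W f g) => //; last by move=> x [].
by move=> i; apply: Ck_subset (Hg k i) => x [].
Qed.

Lemma smooth_at_comp1 (f : R -> R) (g : V -> R) u :
  smooth_at f (g u) -> smooth_at g u -> smooth_at (fun x => f (g x)) u.
Proof.
move=> [W [oW Wu] Hf] [U [oU Uu] Hg].
have oUW := open_preimage oU oW (fun x Ux => CkC (Hg 0) Ux).
exists (U `&` g @^-1` W) => // k.
apply: (@Ck_comp1 _ _ k _ W f g) => //; last by move=> x [].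
by apply: Ck_subset (Hg k) => x [].
Qed.

Lemma smooth_atV f u : f u != 0 -> smooth_at f u -> smooth_at (fun x => (f x)^-1) u.
Proof.
move=> fu [U [oU Uu] Hf].
have o0 : open [set y : R | y != 0] by exact: open_neq.
have oUW := open_preimage oU o0 (fun x Ux => CkC (Hf 0) Ux).
exists (U `&` f @^-1` [set y : R | y != 0]) => // k.
by apply: CkV => //; [move=> x []|apply: Ck_subset (Hf k) => x []].
Qed.

End SmoothAt.

(** * Coordinates and derivatives of functions on row vectors *)

Section SmoothAtRV.
Context {R : realType}.

Lemma smooth_at_differentiable n (f : 'rV[R]_n -> R) u :
  smooth_at f u -> differentiable f u.
Proof. by move=> [U [oU Uu] H]; exact: C1_differentiable oU (H 1) Uu. Qed.

Lemma smooth_at_id (u : R) : smooth_at (fun x : R => x) u.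
Proof. by apply: (@smooth_at_linear R R^o idfun) => x; exact: cvg_id. Qed.

Lemma smooth_at_coord n (u : 'rV[R]_n) i : smooth_at (fun x : 'rV[R]_n => x 0 i) u.
Proof.
pose L (h : 'rV[R]_n) : R := h 0 i.
have linL : linear L by move=> c x y; rewrite /L !mxE.
pose LM := GRing.isLinear.Build _ _ _ _ L linL.
pose LL : {linear 'rV[R]_n -> R^o} := HB.pack L LM.
exact: (@smooth_at_linear R _ LL u (@coord_continuous _ _ _ _ _)).
Qed.

Lemma vsmooth_at_id n (u : 'rV[R]_n) : vsmooth_at (fun x : 'rV[R]_n => x) u.
Proof. by move=> i; exact: smooth_at_coord. Qed.

Lemma derive_coord_proj n (u v : 'rV[R]_n) i : 'D_v (fun x : 'rV[R]_n => x 0 i) u = v 0 i.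
Proof.
by have /is_derive_coord/(_ i) H := is_derive_id u v; rewrite derive_val.
Qed.

Lemma is_derive_comp_sum (V : normedModType R) m (f : 'rV[R]_m -> R) (g : V -> 'rV[R]_m) u v :
  smooth_at f (g u) -> vsmooth_at g u -> is_derive u v (fun x => f (g x))
  (\sum_j 'D_v (fun x => g x 0 j) u * 'D_(delta_mx 0 j) f (g u)).
Proof.
move=> Hf Hg; have df := smooth_at_differentiable Hf.
have dg : is_derive u v g (\row_j 'D_v (fun x => g x 0 j) u).
  apply: is_derive_rV => i; rewrite mxE; exact: smooth_at_is_derive.
have := is_derive_comp df dg; rewrite derive_coord //.
by under eq_bigr do rewrite mxE.
Qed.

Lemma derive_comp_sum (V : normedModType R) m (f : 'rV[R]_m -> R) (g : V -> 'rV[R]_m) u v :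
  smooth_at f (g u) -> vsmooth_at g u -> 'D_v (fun x => f (g x)) u =
  \sum_j 'D_v (fun x => g x 0 j) u * 'D_(delta_mx 0 j) f (g u).
Proof. by move=> Hf Hg; have H := is_derive_comp_sum v Hf Hg; rewrite derive_val. Qed.

Lemma derive_coords n (f : 'rV[R]_n -> R) u v : smooth_at f u ->
  'D_v f u = \sum_j v 0 j * 'D_(delta_mx 0 j) f u.
Proof. by move=> /smooth_at_differentiable H; rewrite derive_coord. Qed.

Lemma derive_dirD n (f : 'rV[R]_n -> R) u v w : smooth_at f u ->
  'D_(v + w) f u = 'D_v f u + 'D_w f u.
Proof.
by move=> /smooth_at_differentiable H; rewrite -[v]scale1r derive_lin // !scale1r.
Qed.

End SmoothAtRV.

(** * Bump functions *)

Section Bump.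
Context {R : realType}.

(** The exponent is a parameter because differentiation maps this family of functions into its own
    span, so that one induction proves all of them smooth. *)
Definition flat (m : nat) (x : R) : R :=
  if 0 < x then x^-1 ^+ m * expR (- x^-1) else 0.

(** With y = 1/x, one term of the exponential series bounds [expR y] below by y^(m+1)/(m+1)!, one
    power more than [flat m] contains. *)
Lemma flat_le m x : `|flat m x| <= (m.+1)`!%:R * `|x|.
Proof.
rewrite /flat; case: ltP => [x0|_]; last by rewrite normr0 mulr_ge0.
have y0 : 0 < x^-1 by rewrite invr_gt0.
rewrite ger0_norm ?mulr_ge0 ?expR_ge0 ?exprn_ge0 ?(ltW y0) // (gtr0_norm x0).
rewrite expRN ler_pdivrMr ?expR_gt0 //.
apply: (@le_trans _ _ (m.+1`!%:R * x * (x^-1 ^+ m.+1 / m.+1`!%:R))); last first.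
  rewrite ler_pM2l ?mulr_gt0 ?ltr0n ?fact_gt0 //.
  by apply: le_trans (expR_ge1Dxn m (ltW y0)); rewrite lerDr ler01.
rewrite le_eqVlt; apply/orP; left; apply/eqP.
have f0 : m.+1`!%:R != 0 :> R by rewrite pnatr_eq0 -lt0n fact_gt0.
by rewrite exprS; field; rewrite f0 gt_eqF.
Qed.

Lemma is_derive_flat m x :
  is_derive x (1 : R) (flat m) (- m%:R * flat m.+1 x + flat m.+2 x).
Proof.
have [x0|x0|x0] := ltgtP 0 x; last first.
- have -> : - m%:R * flat m.+1 x + flat m.+2 x = 0.
    by rewrite -x0 /flat ltxx mulr0 addr0.
  rewrite -x0.
  have lim : (fun h : R => h^-1 *: ((flat m \o shift 0) (h *: 1) - flat m 0)) @ 0^' --> (0 : R).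
    apply/cvgrPdist_lt => e e0; rewrite near_withinE.
    have k0 : 0 < (m.+2)`!%:R :> R by rewrite ltr0n fact_gt0.
    apply: (near_normP (0 : R) _).2.
    exists (e / (m.+2)`!%:R) => [|h]; first by rewrite divr_gt0.
    rewrite subr0 => he h0; rewrite sub0r normrN /= [_%:A]mulr1 addr0.
    rewrite [flat m 0]/flat ltxx subr0.
    (* The difference quotient at 0 is the next member of the family, which tends to 0 by
       [flat_le]. *)
    have -> : h^-1 *: flat m h = flat m.+1 h.
      by rewrite /flat; case: ifP => _; rewrite ?scaler0 // exprS -mulrA.
    by apply: le_lt_trans (flat_le _ _) _; rewrite mulrC -ltr_pdivlMr.
  by split; [apply: cvgP lim|apply: cvg_lim lim].
- have fx : \near x, 0 = flat m x.
    near=> y; rewrite /flat ltNge ltW //=; near: y; exact: lt_nbhsl.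
  have -> : - m%:R * flat m.+1 x + flat m.+2 x = 0.
    by rewrite /flat ltNge (ltW x0) /= mulr0 addr0.
  by apply: (near_eq_is_derive fx); exact: is_derive_cst.
- have fx : \near x, x^-1 ^+ m * expR (- x^-1) = flat m x.
    near=> y; rewrite /flat ifT //; near: y; exact: lt_nbhsr.
  apply: (near_eq_is_derive fx).
  have xn0 : x != 0 by rewrite gt_eqF.
  have dinv : is_derive x (1 : R) (fun y : R => y^-1) (- x^-1 ^+ 2).
    split; first exact: derivableV.
    by rewrite deriveV // derive_id [_ *: 1]mulr1 exprVn.
  have dexp : is_derive x (1 : R) (fun y : R => expR (- y^-1)) (x^-1 ^+ 2 * expR (- x^-1)).
    have dN : is_derive x (1 : R) (fun y : R => - y^-1) (x^-1 ^+ 2).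
      by rewrite -[X in is_derive _ _ _ X]opprK; apply: is_deriveN.
    have df : differentiable (expR : R -> R) (- x^-1) by apply/derivable1_diffP; exact: derivable_expR.
    have := @is_derive_comp _ _ _ _ (expR : R -> R) (fun y : R => - y^-1) _ _ _ df dN.
    have := is_derive_scale (x^-1 ^+ 2) (is_derive_expR (- x^-1)) => E.
    rewrite [_ *: 1]mulr1 in E.
    by rewrite (@derive_val _ _ _ _ _ _ _ E).
  have dpow : is_derive x (1 : R) (fun y : R => y^-1 ^+ m) (- m%:R * x^-1 ^+ m.+1).
    elim: m {fx} => [|m IH].
      have -> : (fun y : R => y^-1 ^+ 0) = cst 1 by apply/funext => y; rewrite expr0.
      by rewrite oppr0 mul0r; exact: is_derive_cst.
    have -> : (fun y : R => y^-1 ^+ m.+1) = (fun y : R => y^-1 * y^-1 ^+ m).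
      by apply/funext => y; rewrite exprS.
    have -> : - m.+1%:R * x^-1 ^+ m.+2 =
        x^-1 *: (- m%:R * x^-1 ^+ m.+1) + x^-1 ^+ m *: (- x^-1 ^+ 2).
      by rewrite /GRing.scale/= !exprS -natr1; ring.
    exact: is_deriveM.
  have -> : - m%:R * flat m.+1 x + flat m.+2 x =
     x^-1 ^+ m *: (x^-1 ^+ 2 * expR (- x^-1)) + expR (- x^-1) *: (- m%:R * x^-1 ^+ m.+1).
    by rewrite /flat x0 /GRing.scale/= !exprS; ring.
  exact: is_deriveM.
Unshelve. all: by end_near. Qed.

Lemma Ck_flat k m : Ck k setT (flat m).
Proof.
have cf m' (u : R) : {for u, continuous (flat m')}.
  apply: differentiable_continuous; apply/derivable1_diffP.
  by have [] := is_derive_flat m' u.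
elim: k m => [|k IH] m; first by split => // u _; exact: cf.
split=> [u _|v]; first exact: cf.
have D u : is_derive u v (flat m) (v * (- m%:R * flat m.+1 u + flat m.+2 u)).
  by have := is_derive_scale v (is_derive_flat m u); rewrite [_ *: _]mulr1.
split; first by move=> u _; have [] := D u.
apply: (@Ck_ext _ _ _ _ (fun u => cst v u * (cst (- m%:R) u * flat m.+1 u + flat m.+2 u))).
- exact: openT.
- by move=> u _ /=; have Du := D u; rewrite derive_val.
apply: CkM; [exact: openT|exact: Ck_cst|].
apply: CkD; [exact: openT| |exact: IH].
by apply: CkM; [exact: openT|exact: Ck_cst|exact: IH].
Qed.

Lemma smooth_at_flat m x : smooth_at (flat m) x.
Proof. by exists setT => [|k]; [split; [exact: openT|]|exact: Ck_flat]. Qed.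

Lemma flat0_ge0 x : 0 <= flat 0 x.
Proof. by rewrite /flat; case: ifP => // _; rewrite mulr_ge0 ?expR_ge0 ?expr0. Qed.

Lemma flat0_gt0 x : 0 < x -> 0 < flat 0 x.
Proof. by move=> x0; rewrite /flat x0 expr0 mul1r expR_gt0. Qed.

Lemma flat_le0 m x : x <= 0 -> flat m x = 0.
Proof. by move=> x0; rewrite /flat ltNge x0. Qed.

Definition step (x : R) : R := flat 0 x / (flat 0 x + flat 0 (1 - x)).

Lemma step_den_gt0 x : 0 < flat 0 x + flat 0 (1 - x).
Proof.
have [x0|x0] := ltP 0 x; first by rewrite ltr_pwDl ?flat0_gt0 ?flat0_ge0.
by rewrite ltr_wpDl ?flat0_ge0 ?flat0_gt0 // subr_gt0 (le_lt_trans x0).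
Qed.

Lemma step_le0 x : x <= 0 -> step x = 0.
Proof. by move=> x0; rewrite /step flat_le0 // mul0r. Qed.

Lemma step_ge1 x : 1 <= x -> step x = 1.
Proof.
move=> x1; rewrite /step (flat_le0 0 (x := 1 - x)) ?subr_le0 // addr0 divff //.
by rewrite gt_eqF ?flat0_gt0 // (lt_le_trans _ x1).
Qed.

Lemma smooth_at_affine (a b x : R) : smooth_at (fun x => a + b * x) x.
Proof.
apply: (@smooth_atD _ _ (cst a)); first exact: smooth_at_cst.
by apply: (@smooth_atM _ _ (cst b)); [exact: smooth_at_cst|exact: smooth_at_id].
Qed.

Lemma smooth_at_step x : smooth_at step x.
Proof.
apply: smooth_atM; first exact: smooth_at_flat.
apply: smooth_atV; first by rewrite gt_eqF // step_den_gt0.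
apply: smooth_atD; first exact: smooth_at_flat.
apply: (@smooth_at_comp1 _ _ (flat 0)); first exact: smooth_at_flat.
have := smooth_at_affine 1 (-1) x; apply: smooth_at_ext.
by near=> y; rewrite mulN1r.
Unshelve. all: by end_near. Qed.

(** The norm of ['rV] is the sup norm, so balls are cubes and a product of one-variable bumps over
    the coordinates has the right support. *)
Lemma bump_exists n (c : 'rV[R]_n) (r : R) : 0 < r ->
  exists b : 'rV[R]_n -> R, [/\ forall u, smooth_at b u,
    forall u, `|u - c| <= r / 2 -> b u = 1 & forall u, r <= `|u - c| -> b u = 0].
Proof.
move=> r0; pose g (i : 'I_n) (u : 'rV[R]_n) : R := (u 0 i - c 0 i) / r.
(* [h] is 1 on [-1/2, 1/2] and 0 outside ]-1, 1[. *)
pose h (x : R) := step (2 + (-2) * x) * step (2 + 2 * x).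
exists (fun u => \prod_i h (g i u)); split.
- move=> u; apply: smooth_at_prod => i; apply: (@smooth_at_comp1 _ _ h).
    apply: smooth_atM; apply: (@smooth_at_comp1 _ _ step);
    by [exact: smooth_at_step|exact: smooth_at_affine].
  apply: (@smooth_atM _ _ _ (cst r^-1)); last exact: smooth_at_cst.
  apply: (@smooth_atB _ _ _ (cst (c 0 i))); last exact: smooth_at_cst.
  exact: smooth_at_coord.
- move=> u uc; apply: big1 => i _.
  have : `|g i u| <= 2^-1.
    rewrite /g normrM normfV (gtr0_norm r0) ler_pdivrMr // mulrC.
    by apply: le_trans uc; have := rV_coord_le (u - c) i; rewrite !mxE.
  rewrite ler_norml => /andP[g1 g2]; rewrite /h !step_ge1 ?mulr1 //; lra.
- move=> u; rewrite leNgt => uc.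
  have [i Hi] : exists i, r <= `|u 0 i - c 0 i|.
    apply: contrapT => /forallNP H; move/negP: uc; apply; apply: rV_norm_lt => // i.
    by rewrite !mxE ltNge; apply/negP; exact: H.
  rewrite (bigD1 i) //= [X in X * _](_ : _ = 0) ?mul0r //.
  have : 1 <= `|g i u| by rewrite /g normrM normfV (gtr0_norm r0) ler_pdivlMr // mul1r.
  rewrite ler_normr => /orP[g1|g1].
    by rewrite /h step_le0 ?mul0r //; lra.
  by rewrite /h [X in _ * X]step_le0 ?mulr0 //; lra.
Qed.

End Bump.

Section ZeroExtension.
Context {R : realType} {V : normedModType R}.

(** Nothing is asked of [f] where [b] vanishes: this is how functions smooth on an open set only are
    cut off to functions smooth everywhere. *)
Lemma smooth_atM0 (b f : V -> R) (u : V) :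
  smooth_at b u -> (smooth_at f u \/ \near u, b u = 0) -> smooth_at (fun x => b x * f x) u.
Proof.
move=> Hb [Hf|b0]; first exact: smooth_atM.
apply: smooth_at_ext (smooth_at_cst 0 u); apply: filterS b0 => x /= ->.
by rewrite mul0r.
Qed.

End ZeroExtension.

(** * Ordinary differential equations *)

Section RealInduction.
Context {R : realType}.

(** Take the supremum of the [t] such that [P] holds on [0, t]: the first hypothesis lets it belong
    to this set, the second forbids it to be less than [b]. *)
Lemma real_induction (b : R) (P : R -> Prop) :
  (forall t, 0 <= t <= b -> (forall s, 0 <= s < t -> P s) -> P t) ->
  (forall t, 0 <= t < b -> (forall s, 0 <= s <= t -> P s) ->
     exists2 d, 0 < d & forall s, t < s < t + d -> s <= b -> P s) ->
  forall t, 0 <= t <= b -> P t.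
Proof.
move=> H1 H2 t0 /andP[t00 t0b].
have b0 : 0 <= b by exact: le_trans t0b.
pose S := [set t : R | 0 <= t <= b /\ forall s, 0 <= s <= t -> P s].
have S0 : S 0.
  split; first by rewrite lexx.
  move=> s s0; have -> : s = 0 by lra.
  by apply: H1 => [|r r0]; [rewrite lexx|exfalso; lra].
have ubS : ubound S b by move=> t [/andP[]].
have hS : has_sup S by split; [exists 0|exists b].
pose c := sup S.
have c0 : 0 <= c by exact: (sup_upper_bound hS S0).
have cb : c <= b by apply: ge_sup => //; exists 0.
have Pc s : 0 <= s < c -> P s.
  move=> /andP[s0 sc]; have cs : 0 < c - s by rewrite subr_gt0.
  have [t [_ Pt] st] := sup_adherent cs hS.
  by apply: Pt; rewrite s0 /= ltW //; move: st; rewrite opprB addrC subrK.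
have PC s : 0 <= s <= c -> P s.
  move=> /andP[s0]; rewrite le_eqVlt => /orP[/eqP ->|sc]; last by apply: Pc; rewrite s0.
  by apply: H1; rewrite ?c0.
have [cb'|bc] := ltP c b; last by apply: PC; rewrite t00 (le_trans t0b).
have [d d0 Hd] := H2 c (introT andP (conj c0 cb')) PC.
pose e := Num.min (d / 2) (b - c).
have e0 : 0 < e by rewrite lt_min divr_gt0 //= subr_gt0.
have ed : e <= d / 2 by rewrite ge_min lexx.
have eb : e <= b - c by rewrite ge_min lexx orbT.
have Sc : S (c + e).
  split; first by apply/andP; split; lra.
  move=> s /andP[s0 se]; have [sc|cs] := leP s c; first by apply: PC; rewrite s0.
  by apply: Hd; [apply/andP; split; lra|lra].
have := sup_upper_bound hS Sc; rewrite -/c => ?; exfalso; lra.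
Qed.

Lemma MVT_le (f df g dg : R -> R) (a b : R) : a <= b ->
  {within `[a, b], continuous f} -> {within `[a, b], continuous g} ->
  (forall t, a < t < b -> is_derive t (1 : R) f (df t)) ->
  (forall t, a < t < b -> is_derive t (1 : R) g (dg t)) ->
  (forall t, a < t < b -> df t <= dg t) -> f b - f a <= g b - g a.
Proof.
move=> ab cf cg Df Dg fg.
move: ab; rewrite le_eqVlt => /predU1P[ab|ab].
  by rewrite ab !subrr.
have [] := @MVT R (fun t => g t - f t) (fun t => dg t - df t) a b ab.
- move=> t; rewrite in_itv/= => tab; apply: is_deriveB; [exact: Dg|exact: Df].
- by move=> x; apply: cvgB; [exact: cg|exact: cf].
move=> c; rewrite in_itv/= => cab E.
have : 0 <= (dg c - df c) * (b - a).
  by rewrite mulr_ge0 ?subr_ge0 ?fg // ltW.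
by rewrite -E; lra.
Qed.

Lemma derivable_continuous (W : normedModType R) (f : R -> W) t d : is_derive t (1 : R) f d -> {for t, continuous f}.
Proof. by move=> [H _]; apply: differentiable_continuous; exact/derivable1_diffP. Qed.

Lemma is_derive_expRM (c t : R) : is_derive t (1 : R) (fun s => expR (c * s)) (c * expR (c * t)).
Proof.
have df : differentiable (expR : R -> R) (c * t) by apply/derivable1_diffP; exact: derivable_expR.
have dN : is_derive t (1 : R) (fun y : R => c * y) c.
  by rewrite -[X in is_derive _ _ _ X]mulr1; apply: is_deriveZ.
have := @is_derive_comp _ _ _ _ (expR : R -> R) (fun y : R => c * y) _ _ _ df dN.
have := is_derive_scale c (is_derive_expR (c * t)) => E.
rewrite [_ *: 1]mulr1 in E.
by rewrite (@derive_val _ _ _ _ _ _ _ E).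
Qed.

(* The bound on the derivative is only required where the comparison already
   holds. *)
Lemma gronwall N (z dz : R -> 'rV[R]_N) (T A K : R) :
  (forall t, 0 <= t <= T -> is_derive t (1 : R) z (dz t)) ->
  `|z 0| < A ->
  (forall t, 0 <= t <= T -> `|z t| < A * expR (K * t) -> `|dz t| <= K * A * expR (K * t)) ->
  forall t, 0 <= t <= T -> `|z t| < A * expR (K * t).
Proof.
move=> Dz z0 Hz; have A0 : 0 < A by apply: le_lt_trans z0.
have Dg t : is_derive t (1 : R) (fun s => A * expR (K * s)) (K * A * expR (K * t)).
  have := @is_deriveZ _ _ _ _ A _ _ _ (is_derive_expRM K t).
  by rewrite /GRing.scale/= mulrCA mulrA.
have cz t : 0 <= t <= T -> {for t, continuous z} by move=> /Dz/derivable_continuous.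
apply: real_induction => t t0T.
- move=> Hs; apply: rV_norm_lt; first by rewrite mulr_gt0 ?expR_gt0.
  have Dzi i s : 0 <= s <= T -> is_derive s (1 : R) (fun s => z s 0 i) (dz s 0 i).
    by move=> /Dz/is_derive_coord.
  have t0 : 0 <= t by case/andP: t0T.
  have sT s : 0 < s < t -> 0 <= s <= T by move=> ?; apply/andP; split; lra.
  have cg : {within `[0, t], continuous (fun s => A * expR (K * s))}.
    apply: derivable_within_continuous => s _; exact: (@ex_derive _ _ _ _ _ _ _ (Dg s)).
  have cf i : {within `[0, t], continuous (fun s => z s 0 i)}.
    apply: derivable_within_continuous => s; rewrite in_itv/= => s0t.
    by apply: (@ex_derive _ _ _ _ _ _ _ (Dzi i s _)); apply/andP; split; lra.
  have bd s : 0 < s < t -> `|dz s| <= K * A * expR (K * s).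
    by move=> s0t; apply: Hz; [exact: sT|apply: Hs; apply/andP; split; lra].
  (* Comparison with [A * expR (K * t)] only bounds the growth of a coordinate, so strictness at [t]
     is inherited from strictness at 0. *)
  move=> i; have z0i : `|z 0 0 i| < A by apply: le_lt_trans (rV_coord_le _ _) z0.
  have := @MVT_le (fun s => z s 0 i) (fun s => dz s 0 i) _ _ 0 t t0 (cf i) cg
    (fun s H => Dzi i s (sT s H)) (fun s _ => Dg s).
  move=> /(_ (fun s H => le_trans (ler_norm _) (le_trans (rV_coord_le _ _) (bd s H)))).
  have cfN : {within `[0, t], continuous (fun s => - z s 0 i)}.
    apply: derivable_within_continuous => s; rewrite in_itv/= => s0t; apply: derivableN.
    by apply: (@ex_derive _ _ _ _ _ _ _ (Dzi i s _)); apply/andP; split; lra.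
  have bd' s : 0 < s < t -> - dz s 0 i <= K * A * expR (K * s).
    move=> H; rewrite (le_trans _ (bd s H)) // (le_trans _ (rV_coord_le _ i)) //.
    by rewrite -normrN ler_norm.
  have := MVT_le t0 cfN cg (fun s H => is_deriveN (Dzi i s (sT s H))) (fun s _ => Dg s) bd'.
  rewrite mulr0 expR0 mulr1; move: z0i; rewrite !ltr_norml => /andP[].
  move: (A * expR (K * t)) (z t 0 i) (z 0 0 i) => a b c *.
  by apply/andP; split; lra.
- move=> Hs; have zt : `|z t| < A * expR (K * t).
    by apply: Hs; case/andP: t0T => -> _; rewrite lexx.
  have t0T' : 0 <= t <= T by case/andP: t0T => -> /ltW ->.
  have cd : {for t, continuous (fun s => A * expR (K * s) - `|z s|)}.
    apply: cvgB; first exact: (derivable_continuous (Dg t)).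
    by apply: cvg_norm; exact: cz.
  have d0 : 0 < A * expR (K * t) - `|z t| by rewrite subr_gt0.
  have [r r0 Hr] := (continuous_normP _ _).1 cd _ d0.
  exists r => // s /andP[ts sr] _.
  have st : `|s - t| < r by rewrite gtr0_norm ?subr_gt0 //; lra.
  have := Hr s st; rewrite ltr_norml => /andP[+ _].
  by move: (A * expR (K * t)) (A * expR (K * s)) (`|z t|) (`|z s|) => a b c d; lra.
Qed.

End RealInduction.

(** * Antiderivatives frozen outside an interval *)

Section Antiderivative.
Context {R : realType}.

Definition clip (T t : R) : R := Num.max (- T) (Num.min t T).

Lemma clip_dist T s t : `|clip T s - clip T t| <= `|s - t|.
Proof.
have := ler_norm (s - t); have := ler_norm (- (s - t)); rewrite normrN.
move: (`|s - t|) => e; rewrite ler_norml /clip.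
by case: (leP s T) => ?; case: (leP t T) => ?; rewrite !maxEle;
  case: (leP (- T) T) => ?; case: (leP (- T) s) => ?; case: (leP (- T) t) => ?;
  move=> ? ?; apply/andP; split; lra.
Qed.

Lemma clip_id T t : `|t| <= T -> clip T t = t.
Proof. by rewrite ler_norml => /andP[? ?]; rewrite /clip min_l // max_r. Qed.

Lemma clip_norm T t : 0 <= T -> `|clip T t| <= T.
Proof.
move=> T0; rewrite ler_norml /clip.
by case: (leP t T) => ?; rewrite !maxEle; case: (leP (- T) T) => ?;
  case: (leP (- T) t) => ?; apply/andP; split; lra.
Qed.

Lemma clip_norm_le T t : 0 <= T -> `|clip T t| <= `|t|.
Proof. by move=> T0; have := clip_dist T t 0; rewrite (clip_id (t := 0)) ?normr0 ?subr0. Qed.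

Lemma clip_continuous T : continuous (clip T).
Proof.
move=> t; apply/continuous_normP => e e0; exists e => // y.
exact: le_lt_trans (clip_dist _ _ _).
Qed.

Lemma antiderivative_itv (T : R) (f : R -> R) : 0 < T -> continuous f ->
  exists F : R -> R, forall t, - T < t < T -> is_derive t (1 : R) F (f t).
Proof.
move=> T0 cf; pose F x := parameterized_integral (@lebesgue_measure R) (- T) x f.
exists F => t /andP[Tt tT].
have itf : (@lebesgue_measure R).-integrable `[- T, T] (EFin \o f).
  apply: continuous_compact_integrable; first exact: segment_compact.
  exact: continuous_subspaceT.
have [dF F'] := @continuous_FTC1_closed R f (- T) t T tT itf Tt (cf t).
by split; [exact: dF|rewrite -derive1E; exact: F'].
Qed.

(** Freezing the antiderivative beyond [T] makes it continuous on the whole line and reduces global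
    bounds to bounds on [-T, T]. Integrating over a slightly longer interval gives continuity at the
    ends. *)
Lemma antiderivative (T : R) (f : R -> R) : 0 < T -> continuous f ->
  exists F : R -> R, [/\ F 0 = 0, continuous F, forall t, F t = F (clip T t) &
    forall t, `|t| < T -> is_derive t (1 : R) F (f t)].
Proof.
move=> T0 cf; have T1 : 0 < T + 1 by lra.
have [F HF] := antiderivative_itv T1 cf.
have DF t : `|t| <= T -> is_derive t (1 : R) F (f t).
  by rewrite ler_norml => /andP[? ?]; apply: HF; apply/andP; split; lra.
exists (fun t => F (clip T t) - F 0); split.
- by rewrite clip_id ?subrr // normr0 ltW.
- move=> t; apply: cvgB; last exact: cvg_cst.
  apply: (@continuous_comp _ _ _ (clip T) F t); first exact: clip_continuous.
  exact: derivable_continuous (DF _ (clip_norm t (ltW T0))).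
- by move=> t; rewrite (clip_id (t := clip T t)) // clip_norm // ltW.
move=> t tT; apply: (@near_eq_is_derive _ _ _ (fun t => F t - cst (F 0) t)).
  apply: (near_normP t _).2; exists (T - `|t|); first by rewrite subr_gt0.
  move=> y yt; rewrite clip_id //; apply: ltW.
  rewrite -(subrK t y); apply: le_lt_trans (ler_normD _ _) _; lra.
rewrite -[f t]subr0; apply: is_deriveB; exact: DF (ltW tT).
Qed.

End Antiderivative.

(** * Exponential bounds and geometric convergence *)

Section GrowthBound.
Context {R : realType}.

Lemma is_derive_flip (W : normedModType R) (f : R -> W) (t : R) (d : W) :
  is_derive (- t) (1 : R) f d -> is_derive t (1 : R) (fun s => f (- s)) (- d).
Proof.
move=> [df fd]; have dN : is_derive t (1 : R) (fun s : R => - s) (-1 : R).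
  by apply: is_deriveN.
have dif : differentiable f (- t) by apply/derivable1_diffP.
have := @is_derive_comp _ _ _ _ f (fun s : R => - s) _ _ _ dif dN.
have -> : 'D_(-1 : R) f (- t) = - d; last by [].
rewrite -fd -[-1 : R]addr0 -[X in 'D_(X + _) f _]mulN1r.
rewrite (_ : -1 * 1 + 0 = (-1 : R) *: (1 : R) + (0 : R)) //.
by rewrite derive_lin // derive0 addr0 scaleN1r.
Qed.

(** Integration of [expR (l * t)] divides it by [l]. This gain makes the Picard operator a
    contraction for an exponentially weighted norm, whatever the Lipschitz constant. *)
Lemma exp_bound_nneg (T B l : R) (f df : R -> R) : 0 <= T -> 0 <= B -> continuous f -> f 0 = 0 ->
  (forall t, 0 < t < T -> is_derive t (1 : R) f (df t)) ->
  (forall t, 0 < t < T -> `|df t| <= l * B * expR (l * t)) ->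
  forall t, 0 <= t <= T -> `|f t| <= B * expR (l * t).
Proof.
move=> T0 B0 cf f0 Df Hd t /andP[t0 tT].
have Dg s : is_derive s (1 : R) (fun s => B * expR (l * s)) (l * B * expR (l * s)).
  have := @is_deriveZ _ _ _ _ B _ _ _ (is_derive_expRM l s).
  by rewrite /GRing.scale/= mulrCA mulrA.
have cg : {within `[0, t], continuous (fun s => B * expR (l * s))}.
  apply: derivable_within_continuous => s _; exact: (@ex_derive _ _ _ _ _ _ _ (Dg s)).
have sT s : 0 < s < t -> 0 < s < T by move=> ?; apply/andP; split; lra.
have cf' : {within `[0, t], continuous f} by exact: continuous_subspaceT.
have cfN : {within `[0, t], continuous (fun s => - f s)}.
  by apply: continuous_subspaceT => s; apply: cvgN; exact: cf.
have b1 s : 0 < s < t -> df s <= l * B * expR (l * s).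
  by move=> H; rewrite (le_trans _ (Hd s (sT s H))) // ler_norm.
have b2 s : 0 < s < t -> - df s <= l * B * expR (l * s).
  by move=> H; rewrite (le_trans _ (Hd s (sT s H))) // -normrN ler_norm.
have := MVT_le t0 cf' cg (fun s H => Df s (sT s H)) (fun s _ => Dg s) b1.
have := MVT_le t0 cfN cg (fun s H => is_deriveN (Df s (sT s H))) (fun s _ => Dg s) b2.
rewrite f0 mulr0 expR0 mulr1 ler_norml; move: (B * expR (l * t)) (f t) => a b ? ?.
by apply/andP; split; lra.
Qed.

Lemma exp_bound (T B l : R) (f df : R -> R) : 0 <= T -> 0 <= B -> continuous f -> f 0 = 0 ->
  (forall t, `|t| < T -> is_derive t (1 : R) f (df t)) ->
  (forall t, `|t| < T -> `|df t| <= l * B * expR (l * `|t|)) ->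
  forall t, `|t| <= T -> `|f t| <= B * expR (l * `|t|).
Proof.
move=> T0 B0 cf f0 Df Hd t tT.
have nT s : 0 < s < T -> `|s| < T by move=> /andP[s0]; rewrite gtr0_norm.
have nT' s : 0 < s < T -> `|- s| < T by rewrite normrN; exact: nT.
have [t0|t0] := leP 0 t.
  rewrite ger0_norm // in tT *.
  apply: (@exp_bound_nneg T B l f df) => //; last by rewrite t0.
    by move=> s /nT; exact: Df.
  move=> s sT; have := Hd s (nT s sT).
  by rewrite (@gtr0_norm _ s) //; case/andP: sT.
rewrite ltr0_norm // in tT *; rewrite -[t in f t]opprK.
apply: (@exp_bound_nneg T B l (fun s => f (- s)) (fun s => - df (- s))) => //.
- move=> s; apply: (@continuous_comp _ _ _ (fun s : R => - s) f s); first exact: opp_continuous.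
  exact: cf.
- by rewrite oppr0.
- by move=> s sT; apply: is_derive_flip; apply: Df; exact: nT'.
- move=> s sT; rewrite normrN; have := Hd (- s) (nT' s sT).
  by rewrite normrN (@gtr0_norm _ s) //; case/andP: sT.
- by rewrite oppr_ge0 ltW.
Qed.

(** The interval of radius [2 * c / 2 ^+ m] around [u m] contains the next one, so these intervals
    are nested; the supremum of their left ends lies in all of them. *)
Lemma geometric_limit (u : nat -> R) (c : R) :
  (forall m, `|u m.+1 - u m| <= c / 2 ^+ m) ->
  exists l, forall m, `|l - u m| <= 2 * c / 2 ^+ m.
Proof.
move=> H; pose d m := 2 * c / 2 ^+ m : R.
have dS m : d m - d m.+1 = c / 2 ^+ m.
  by rewrite /d exprS; field; rewrite expf_neq0 // pnatr_eq0.
have S1 m : u m - d m <= u m.+1 - d m.+1.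
  by have := H m; rewrite -dS ler_norml => /andP[? ?]; lra.
have S2 m : u m.+1 + d m.+1 <= u m + d m.
  by have := H m; rewrite -dS ler_norml => /andP[? ?]; lra.
have c0 : 0 <= c by have := H 0; rewrite expr0 divr1; exact: le_trans.
have d0 m : 0 <= d m by rewrite /d divr_ge0 ?exprn_ge0 // mulr_ge0.
have M1 m p : u m - d m <= u (p + m)%N - d (p + m)%N.
  by elim: p => // p IH; rewrite addSn (le_trans IH).
have M2 m p : u (p + m)%N + d (p + m)%N <= u m + d m.
  by elim: p => // p IH; rewrite addSn (le_trans _ IH).
have cross m p : u m - d m <= u p + d p.
  have := M1 m p; have := M2 p m; rewrite [(m + p)%N]addnC.
  by have := d0 (p + m)%N; lra.
pose S := [set u m - d m | m in [set: nat]].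
have hS : has_sup S.
  split; first by exists (u 0 - d 0), 0.
  by exists (u 0 + d 0) => _ [m _ <-]; exact: cross.
exists (sup S) => m; rewrite -/(d m) ler_norml; apply/andP; split.
  have : u m - d m <= sup S by apply: (sup_upper_bound hS); exists m.
  by lra.
have : sup S <= u m + d m.
  by apply: ge_sup; [case: hS|move=> _ [p _ <-]; exact: cross].
by lra.
Qed.

End GrowthBound.

(** * Picard iteration *)

Section Picard.
Context {R : realType} (N : nat).
Local Notation E := 'rV[R]_N.
Variables (f : R -> E -> E) (L T : R).
Hypotheses (L0 : 0 <= L) (T0 : 0 < T).
Hypothesis f_lip : forall t x y, `|f t x - f t y| <= L * `|x - y|.
Hypothesis f_cont : forall X : R -> E, continuous X -> continuous (fun t => f t (X t)).

Lemma vector_antiderivative (g : R -> E) : continuous g ->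
  exists P : R -> E, [/\ P 0 = 0, continuous P, forall t, P t = P (clip T t) &
    forall t, `|t| < T -> is_derive t (1 : R) P (g t)].
Proof.
move=> cg; have /choice[F HF] : forall i : 'I_N, exists F : R -> R,
    [/\ F 0 = 0, continuous F, forall t, F t = F (clip T t) &
    forall t, `|t| < T -> is_derive t (1 : R) F (g t 0 i)].
  move=> i; apply: antiderivative => // t.
  exact: (rV_continuous_coord (cg t)).
exists (fun t => \row_i F i t); split.
- by apply/rowP => i; rewrite !mxE; have [] := HF i.
- move=> t; apply: rV_continuous => i.
  have -> : (fun t => (\row_i F i t) 0 i) = F i by apply/funext => s; rewrite mxE.
  by have [_ + _ _] := HF i; apply.
- by move=> t; apply/rowP => i; rewrite !mxE; have [_ _ + _] := HF i; apply.
- move=> t tT; apply: is_derive_rV => i.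
  have -> : (fun t => (\row_i F i t) 0 i) = F i by apply/funext => s; rewrite mxE.
  by have [_ _ _] := HF i; apply.
Qed.

(** Exceeding [2 * L] makes one integration halve the weighted distance; being positive allows
    division by it. *)
Let lam := 2 * L + 1.

Lemma vector_exp_bound (B : R) (D d : R -> E) : 0 <= B -> D 0 = 0 -> continuous D ->
  (forall t, D t = D (clip T t)) ->
  (forall t, `|t| < T -> is_derive t (1 : R) D (d t)) ->
  (forall t, `|t| < T -> `|d t| <= lam * B * expR (lam * `|t|)) ->
  forall t, `|D t| <= B * expR (lam * `|t|).
Proof.
move=> B0 D00 cD clD HD Hd t.
have l0 : 0 <= lam by rewrite addr_ge0 // mulr_ge0.
have H s : `|s| <= T -> `|D s| <= B * expR (lam * `|s|).
  move=> sT; apply: rV_norm_le; first by rewrite mulr_ge0 ?expR_ge0.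
  move=> i; apply: (@exp_bound _ T B lam (fun s => D s 0 i) (fun s => d s 0 i)) => //.
  - exact: ltW.
  - by move=> r; exact: rV_continuous_coord (cD r) i.
  - by rewrite D00 mxE.
  - by move=> r /HD/is_derive_coord.
  - by move=> r /Hd; exact: le_trans (rV_coord_le _ _).
rewrite clD; apply: le_trans (H _ (clip_norm t (ltW T0))) _.
by rewrite ler_wpM2l // ler_expR ler_wpM2l // clip_norm_le // ltW.
Qed.

(** [f] is globally Lipschitz, so in the norm weighted by [expR (lam * |t|)] the iteration converges
    on all of ]-T, T[ without shortening the time. *)
Theorem picard (x0 : E) : exists X : R -> E,
  X 0 = x0 /\ forall t, `|t| < T -> is_derive t (1 : R) X (f t (X t)).
Proof.
have l0 : 0 < lam by rewrite ltr_wpDl // mulr_ge0.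
(* [P g] is an antiderivative of [g] vanishing at 0; its value on a discontinuous [g] is a dummy. *)
have /choice[P HP] : forall g : R -> E, exists P : R -> E, continuous g ->
   [/\ P 0 = 0, continuous P, forall t, P t = P (clip T t) &
    forall t, `|t| < T -> is_derive t (1 : R) P (g t)].
  move=> g; have [cg|ncg] := pselect (continuous g); last by exists g.
  by have [P HP] := vector_antiderivative cg; exists P.
pose Phi (X : R -> E) t := x0 + P (fun s => f s (X s)) t.
have cPhi X : continuous X -> continuous (Phi X).
  move=> /f_cont/HP[_ cP _ _] t; apply: cvgD; [exact: cvg_cst|exact: cP].
have Phi_diff X Y B : 0 <= B -> continuous X -> continuous Y ->
    (forall t, `|X t - Y t| <= 2 * B * expR (lam * `|t|)) ->
    forall t, `|Phi X t - Phi Y t| <= B * expR (lam * `|t|).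
  move=> B0 cX cY XY t.
  have [PX0 cPX clX DX] := HP _ (f_cont cX).
  have [PY0 cPY clY DY] := HP _ (f_cont cY).
  rewrite /Phi opprD addrACA subrr add0r.
  apply: (@vector_exp_bound B (fun t => P (fun s => f s (X s)) t - P (fun s => f s (Y s)) t)
    (fun t => f t (X t) - f t (Y t))) => //.
  - by rewrite PX0 PY0 subrr.
  - by move=> s; apply: cvgB; [exact: cPX|exact: cPY].
  - by move=> s; rewrite {1}clX {1}clY.
  - by move=> s sT; apply: is_deriveB; [exact: DX|exact: DY].
  - move=> s sT; apply: le_trans (f_lip _ _ _) _.
    apply: (@le_trans _ _ (L * (2 * B * expR (lam * `|s|)))); first by rewrite ler_wpM2l.
    rewrite !mulrA; apply: ler_wpM2r; first exact: expR_ge0.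
    by apply: ler_wpM2r => //; rewrite mulrC lerDl.
pose X m := iter m Phi (cst x0).
have cX m : continuous (X m).
  by elim: m => [|m IH]; [move=> t; exact: cvg_cst|exact: cPhi].
(* The first step of the iteration is bounded through the maximum of the norm of [f t x0] on
   [-T, T]. *)
have [C C0 HC] : exists2 C, 0 <= C & forall t, `|X 1%N t - X 0%N t| <= C * expR (lam * `|t|).
  have [P0 cP clP DP] := HP _ (f_cont (cX 0%N)).
  have cn : continuous (fun t => `|f t x0|).
    by move=> t; apply: cvg_norm; exact: (f_cont (cX 0%N)).
  have TT : - T <= T by rewrite (@le_trans _ _ 0) ?oppr_le0 // ltW.
  have [c cT Hc] := EVT_max TT (continuous_subspaceT cn).
  exists (`|f c x0| / lam); first by rewrite divr_ge0 // ltW.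
  move=> t; rewrite /X /= /Phi addrAC subrr add0r.
  apply: (vector_exp_bound (d := fun t => f t x0)) => //; first by rewrite divr_ge0 // ltW.
  move=> s sT; rewrite mulrCA divff ?gt_eqF // mulr1.
  apply: (@le_trans _ _ `|f c x0|).
    by apply: Hc; rewrite in_itv/= -ler_norml ltW.
  rewrite ler_peMr // -expR0 ler_expR mulr_ge0 // ltW //.
have XS m t : `|X m.+1 t - X m t| <= C * expR (lam * `|t|) / 2 ^+ m.
  elim: m t => [|m IH] t; first by rewrite expr0 divr1.
  rewrite mulrAC; apply: (@Phi_diff (X m.+1) (X m) (C / 2 ^+ m.+1)) => //.
    by rewrite divr_ge0 // exprn_ge0.
  move=> s; apply: le_trans (IH s) _; rewrite le_eqVlt; apply/orP; left; apply/eqP.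
  by rewrite exprS; field; rewrite expf_neq0 // pnatr_eq0.
have /choice[Z HZ] : forall t, exists z : E, forall m, `|z - X m t| <= 2 * (C * expR (lam * `|t|)) / 2 ^+ m.
  move=> t; have /choice[l Hl] : forall i : 'I_N, exists l, forall m,
      `|l - X m t 0 i| <= 2 * (C * expR (lam * `|t|)) / 2 ^+ m.
    move=> i; apply: geometric_limit => m; apply: le_trans (XS m t).
    by have := rV_coord_le (X m.+1 t - X m t) i; rewrite !mxE.
  exists (\row_i l i) => m; apply: rV_norm_le => [|i]; last by rewrite !mxE.
  by rewrite divr_ge0 ?exprn_ge0 // !mulr_ge0 ?expR_ge0.
have small (c e : R) : 0 < e -> exists m, c / 2 ^+ m < e.
  move=> e0; have [m Hm] : exists m : nat, c / e < m%:R.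
    by exists (Num.truncn `|c / e|).+1; apply: le_lt_trans (ler_norm _) _; exact: truncnS_gt.
  exists m; rewrite ltr_pdivrMr ?exprn_gt0 // mulrC -ltr_pdivrMr //.
  by apply: lt_trans Hm _; rewrite -natrX ltr_nat ltn_expl.
have cZ : continuous Z.
  move=> t; apply/continuous_normP => e e0.
  have e3 : 0 < e / 3 by rewrite divr_gt0.
  (* [K] dominates the weighted error for all times within 1 of [t], so the convergence is uniform
     there. *)
  pose K := 2 * (C * expR (lam * (`|t| + 1))).
  have [m Hm] := small K _ e3.
  have [r r0 Hr] := (continuous_normP _ _).1 (cX m t) _ e3.
  have near_t s : `|s - t| < 1 -> `|Z s - X m s| < e / 3.
    move=> st; apply: le_lt_trans (HZ s m) _; apply: le_lt_trans Hm.
    rewrite ler_pM2r ?invr_gt0 ?exprn_gt0 // ler_wpM2l // ler_wpM2l // ler_expR ler_pM2l //.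
    rewrite -(subrK t s) addrC; apply: le_trans (ler_normD _ _) _; rewrite lerD2l; exact: ltW.
  exists (Num.min r 1); first by rewrite lt_min r0 ltr01.
  move=> s; rewrite lt_min => /andP[sr s1].
  have E1 := near_t s s1; have E2 := Hr s sr.
  have E3 : `|Z t - X m t| < e / 3 by apply: near_t; rewrite subrr normr0.
  have -> : Z s - Z t = (Z s - X m s) + (X m s - X m t) + (X m t - Z t).
    by rewrite subrKA addrA subrK.
  apply: le_lt_trans (ler_normD _ _) _; rewrite [`|X m t - _|]distrC.
  apply: le_lt_trans (lerD (ler_normD _ _) (lexx _)) _.
  by move: E1 E2 E3; move: `|_| `|_| `|_| => a b c; lra.
have ZPhi t : Z t = Phi Z t.
  apply/eqP; rewrite -subr_eq0 -normr_le0; apply/ler_addgt0Pl => e e0; rewrite addr0.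
  have [m Hm] := small (4 * (C * expR (lam * `|t|))) _ e0.
  apply: le_trans (ltW Hm).
  rewrite -(subrKA (X m.+1 t)); apply: le_trans (ler_normD _ _) _.
  have H1 := HZ t m.+1.
  have H2 : `|X m.+1 t - Phi Z t| <= C / 2 ^+ m * expR (lam * `|t|).
    apply: (@Phi_diff (X m) Z (C / 2 ^+ m)) => //; first by rewrite divr_ge0 // exprn_ge0.
    by move=> s; rewrite distrC; apply: le_trans (HZ s m) _; rewrite !mulrA [_ / _ * _]mulrAC.
  apply: le_trans (lerD H1 H2) _.
  rewrite [X in _ <= X](_ : _ = 2 * (C * expR (lam * `|t|)) / 2 ^+ m.+1 + 3 * (C / 2 ^+ m * expR (lam * `|t|))); last first.
    by rewrite exprS; field; rewrite expf_neq0 // pnatr_eq0.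
  rewrite lerD2l ler_peMl //; last by rewrite ler1n.
  by rewrite mulr_ge0 ?expR_ge0 // divr_ge0 // exprn_ge0.
exists Z; split.
  by have [P0 _ _ _] := HP _ (f_cont cZ); rewrite ZPhi /Phi P0 addr0.
move=> t tT; have [_ _ _ DP] := HP _ (f_cont cZ).
have -> : Z = (fun t => cst x0 t + P (fun s => f s (Z s)) t) by apply/funext => s; exact: ZPhi.
rewrite -[X in is_derive _ _ _ X]add0r; apply: is_deriveD.
by rewrite -/(Phi Z t) -ZPhi; exact: DP.
Qed.

End Picard.

(** * Lipschitz and Taylor bounds on balls *)

Section LocalBounds.
Context {R : realType} {n : nat}.
Local Notation E := 'rV[R]_n.

Lemma smooth_on_Ck {V : normedModType R} (U : set V) (f : V -> R) k :
  (forall u, U u -> smooth_at f u) -> Ck k U f.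
Proof.
elim: k f => [|k IH] f H; first by split => // u Uu; exact: smooth_at_continuous (H _ Uu).
split=> [u Uu|v]; first exact: smooth_at_continuous (H _ Uu).
split=> [u Uu|]; first exact: smooth_at_derivable (H _ Uu).
by apply: IH => u Uu; apply: smooth_at_derive; exact: H.
Qed.

Lemma dist_continuous {V : normedModType R} (c : V) : continuous (fun x : V => `|x - c|).
Proof.
move=> x; apply/continuous_normP => e e0; exists e => // y.
apply: le_lt_trans; apply: le_trans (ler_dist_dist _ _) _.
by rewrite opprB addrA subrK.
Qed.

Lemma closed_ball_compact (c : E) (r : R) : compact [set x : E | `|x - c| <= r].
Proof.
apply: bounded_closed_compact.
  exists (r + `|c|); split; first exact: num_real.
  move=> M rM x /= xc; apply: le_trans (ltW rM).
  by rewrite -[x](subrK c) (le_trans (ler_normD _ _)) // lerD2r.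
apply: (@closed_comp _ _ (fun x : E => `|x - c|) [set t : R | t <= r]) => [x _|].
  exact: dist_continuous.
exact: closed_le.
Qed.

Lemma ball_bounded (f : E -> R) (c : E) (r : R) : 0 <= r -> continuous f ->
  exists2 M, 0 <= M & forall x, `|x - c| <= r -> `|f x| <= M.
Proof.
move=> r0 cf; have cn : continuous (fun x => `|f x|) by move=> x; exact: cvg_norm (cf x).
have n0 : [set x : E | `|x - c| <= r] !=set0 by exists c; rewrite /= subrr normr0.
have [x _ Hx] := EVT_max_rV n0 (@closed_ball_compact c r) (continuous_subspaceT cn).
by exists `|f x| => // y yc; apply: Hx; rewrite inE.
Qed.

Lemma segment_ball (c x y : E) (r t : R) : 0 <= t <= 1 -> `|x - c| <= r -> `|y - c| <= r ->
  `|y + t *: (x - y) - c| <= r.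
Proof.
move=> /andP[t0 t1] xc yc.
have -> : y + t *: (x - y) - c = t *: (x - c) + (1 - t) *: (y - c).
  apply/rowP => i; rewrite !mxE; ring.
apply: le_trans (ler_normD _ _) _; rewrite !normrZ (ger0_norm t0) ger0_norm ?subr_ge0 //.
have -> : r = t * r + (1 - t) * r by ring.
by rewrite lerD // ler_wpM2l // subr_ge0.
Qed.

Variables (f : E -> R) (c : E) (r : R).
Hypotheses (r0 : 0 <= r) (sf : forall u, smooth_at f u).

Lemma derive_ball : exists2 L, 0 <= L &
  forall x y, `|x - c| <= r -> `|'D_y f x| <= L * `|y|.
Proof.
have /choice[M HM] : forall j : 'I_n, exists M, 0 <= M /\
    forall x, `|x - c| <= r -> `|'D_(delta_mx 0 j) f x| <= M.
  move=> j; have [x|M M0 HM] := @ball_bounded ('D_(delta_mx 0 j) f) c r r0.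
    by apply: smooth_at_continuous; exact: smooth_at_derive.
  by exists M.
exists (\sum_j M j); first by apply: sumr_ge0 => j _; case: (HM j).
move=> x y xc; rewrite (derive_coords _ (sf x)) mulr_suml.
apply: le_trans (ler_norm_sum _ _ _) _; apply: ler_sum => j _.
rewrite normrM mulrC ler_pM // ?rV_coord_le //.
by have [_] := HM j; apply.
Qed.

Lemma lipschitz_ball : exists2 L, 0 <= L &
  forall x y, `|x - c| <= r -> `|y - c| <= r -> `|f x - f y| <= L * `|x - y|.
Proof.
have [L L0 HL] := derive_ball; exists L => // x y xc yc.
have [t t01 E] := @MVT_line _ _ f ('D_(x - y) f) y (x - y) (fun t _ => smooth_at_is_derive _ (sf _)).
rewrite [y + (x - y)]addrC subrK in E; rewrite E; apply: HL.
by apply: segment_ball => //; case/andP: t01 => /ltW -> /ltW ->.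
Qed.

End LocalBounds.

Section TaylorBound.
Context {R : realType} {n : nat}.
Local Notation E := 'rV[R]_n.
Variables (f : E -> R) (c : E) (r : R).
Hypotheses (r0 : 0 <= r) (sf : forall u, smooth_at f u).

(** The mean value theorem replaces [f x - f y] by a derivative at an intermediate point, and the
    partial derivatives are Lipschitz on the ball. *)
Lemma taylor_ball : exists2 C, 0 <= C & forall x y, `|x - c| <= r -> `|y - c| <= r ->
  `|f x - f y - 'D_(x - y) f y| <= C * `|x - y| ^+ 2.
Proof.
have /choice[M HM] : forall j : 'I_n, exists M, 0 <= M /\
    forall x y, `|x - c| <= r -> `|y - c| <= r ->
      `|'D_(delta_mx 0 j) f x - 'D_(delta_mx 0 j) f y| <= M * `|x - y|.
  move=> j; have [M M0 HM] := lipschitz_ball c r0 (fun u => smooth_at_derive (delta_mx 0 j) (sf u)).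
  by exists M.
have sM : 0 <= \sum_j M j by apply: sumr_ge0 => j _; case: (HM j).
exists (\sum_j M j) => // x y xc yc.
have [t t01 E] := @MVT_line _ _ f ('D_(x - y) f) y (x - y) (fun t _ => smooth_at_is_derive _ (sf _)).
rewrite [y + (x - y)]addrC subrK in E; rewrite E !(derive_coords _ (sf _)) -sumrB mulr_suml.
have {}t01 : 0 <= t <= 1 by case/andP: t01 => /ltW -> /ltW ->.
apply: le_trans (ler_norm_sum _ _ _) _; apply: ler_sum => j _.
rewrite -mulrBr normrM expr2 mulrA mulrC; apply: ler_pM => //; last exact: rV_coord_le.
have [M0 Hj] := HM j; apply: le_trans (Hj _ _ (segment_ball t01 xc yc) yc) _.
rewrite ler_wpM2l // addrAC subrr add0r normrZ ger0_norm; last by case/andP: t01.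
by rewrite ler_piMl //; case/andP: t01.
Qed.

End TaylorBound.

Section VectorBounds.
Context {R : realType} {n m : nat}.
Variables (F : 'rV[R]_n -> 'rV[R]_m) (c : 'rV[R]_n) (r : R).
Hypotheses (r0 : 0 <= r) (sF : forall u, vsmooth_at F u).

(** The value of the differential at [x] on the vector [y]; the matrix itself is [jacmx]. *)
Definition jac (x y : 'rV[R]_n) : 'rV[R]_m := \row_i 'D_y (fun u => F u 0 i) x.

Lemma le_bigsum_ord (M : 'I_m -> R) i : (forall j, 0 <= M j) -> M i <= \sum_j M j.
Proof. by move=> M0; rewrite (bigD1 i) //= lerDl sumr_ge0. Qed.

Lemma vlipschitz_ball : exists2 L, 0 <= L &
  forall x y, `|x - c| <= r -> `|y - c| <= r -> `|F x - F y| <= L * `|x - y|.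
Proof.
have /choice[M HM] : forall i : 'I_m, exists M, 0 <= M /\
    forall x y, `|x - c| <= r -> `|y - c| <= r -> `|F x 0 i - F y 0 i| <= M * `|x - y|.
  by move=> i; have [M M0 HM] := lipschitz_ball c r0 (fun u => sF u i); exists M.
have M0 i : 0 <= M i by case: (HM i).
exists (\sum_i M i); first exact: sumr_ge0.
move=> x y xc yc; apply: rV_norm_le => [|i]; first by rewrite mulr_ge0 ?sumr_ge0.
rewrite !mxE; apply: le_trans ((HM i).2 x y xc yc) _.
by rewrite ler_wpM2r // le_bigsum_ord.
Qed.

Lemma jac_ball : exists2 L, 0 <= L &
  forall x y, `|x - c| <= r -> `|jac x y| <= L * `|y|.
Proof.
have /choice[M HM] : forall i : 'I_m, exists M, 0 <= M /\
    forall x y, `|x - c| <= r -> `|'D_y (fun u => F u 0 i) x| <= M * `|y|.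
  by move=> i; have [M M0 HM] := derive_ball c r0 (fun u => sF u i); exists M.
have M0 i : 0 <= M i by case: (HM i).
exists (\sum_i M i); first exact: sumr_ge0.
move=> x y xc; apply: rV_norm_le => [|i]; first by rewrite mulr_ge0 ?sumr_ge0.
rewrite !mxE; apply: le_trans ((HM i).2 x y xc) _.
by rewrite ler_wpM2r // le_bigsum_ord.
Qed.

Lemma vtaylor_ball : exists2 C, 0 <= C & forall x y, `|x - c| <= r -> `|y - c| <= r ->
  `|F x - F y - jac y (x - y)| <= C * `|x - y| ^+ 2.
Proof.
have /choice[M HM] : forall i : 'I_m, exists M, 0 <= M /\
    forall x y, `|x - c| <= r -> `|y - c| <= r ->
    `|F x 0 i - F y 0 i - 'D_(x - y) (fun u => F u 0 i) y| <= M * `|x - y| ^+ 2.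
  by move=> i; have [M M0 HM] := taylor_ball c r0 (fun u => sF u i); exists M.
have M0 i : 0 <= M i by case: (HM i).
exists (\sum_i M i); first exact: sumr_ge0.
move=> x y xc yc; apply: rV_norm_le => [|i].
  by rewrite mulr_ge0 ?sumr_ge0 // exprn_ge0.
rewrite !mxE; apply: le_trans ((HM i).2 x y xc yc) _.
by rewrite ler_wpM2r ?exprn_ge0 // le_bigsum_ord.
Qed.

Lemma jacB x y z : jac x (y - z) = jac x y - jac x z.
Proof.
apply/rowP => i; rewrite !mxE [y - z]addrC -scaleN1r derive_lin; last exact: smooth_at_differentiable (sF x i).
by rewrite scaleN1r addrC.
Qed.

Lemma jacZ x (a : R) y : jac x (a *: y) = a *: jac x y.
Proof. by apply/rowP => i; rewrite !mxE (derive_scale_dir _ _ (sF x i)). Qed.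

End VectorBounds.

(** * Smooth dependence on the initial condition *)

Section SmoothDependence.
Context {R : realType}.

(** Time is restricted to [0, 1] because the exponential map is a time-one map. *)
Definition flow_family N (F : 'rV[R]_N -> 'rV[R]_N) (U : set 'rV[R]_N)
    (phi : 'rV[R]_N -> R -> 'rV[R]_N) :=
  forall z, U z -> phi z 0 = z /\
    forall t : R, 0 <= t <= 1 -> is_derive t (1 : R) (phi z) (F (phi z t)).

(** Used for maps known only implicitly, the flow and the inverse function, whose increments are
    controlled by a Taylor bound with quadratic error. *)
Lemma is_derive_quadratic {V W : normedModType R} (g : V -> W) x v d (c r : R) : 0 < r ->
  (forall h, h != 0 -> `|h| < r -> `|g (x + h *: v) - g x - h *: d| <= c * h ^+ 2) ->
  is_derive x v g d.
Proof.
move=> r0 H.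
have lim : (fun h : R => h^-1 *: ((g \o shift x) (h *: v) - g x)) @ 0^' --> d.
  apply/cvgrPdist_lt => e e0; rewrite near_withinE.
  apply: (near_normP (0 : R) _).2.
  have c0 : 0 < `|c| + 1 by rewrite ltr_wpDl.
  exists (Num.min r (e / (`|c| + 1))); first by rewrite lt_min r0 divr_gt0.
  move=> h; rewrite subr0 lt_min => /andP[hr he] h0.
  rewrite distrC /= [h *: v + x]addrC.
  have -> : h^-1 *: (g (x + h *: v) - g x) - d = h^-1 *: (g (x + h *: v) - g x - h *: d).
    by rewrite [in RHS]scalerBr scalerA mulVf // scale1r.
  rewrite normrZ normfV ltr_pdivrMl ?normr_gt0 //; apply: le_lt_trans (H h h0 hr) _.
  rewrite -real_normK ?num_real // expr2 mulrA mulrC ltr_pM2l ?normr_gt0 //.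
  apply: le_lt_trans (_ : (`|c| + 1) * `|h| < _).
    rewrite ler_wpM2r // (le_trans (ler_norm _)) // lerDl ler01 //.
  by rewrite mulrC -ltr_pdivlMr.
by split; [exact: cvgP lim|exact: cvg_lim lim].
Qed.

(** Nothing is known of a trajectory outside [0, 1]; reparametrized by [clip01] it is continuous on
    the whole line, as [picard] demands. *)
Definition clip01 (t : R) := clip 2^-1 (t - 2^-1) + 2^-1.

Lemma clip01_itv t : 0 <= clip01 t <= 1.
Proof.
have h0 : 0 <= 2^-1 :> R by rewrite invr_ge0.
have := clip_norm (t - 2^-1) h0; rewrite ler_norml /clip01; move: (clip _ _) => a /andP[? ?].
by apply/andP; split; lra.
Qed.

Lemma clip01_id t : 0 <= t <= 1 -> clip01 t = t.
Proof.
move=> /andP[? ?]; rewrite /clip01 clip_id ?subrK //.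
by rewrite ler_norml; apply/andP; split; lra.
Qed.

Lemma clip01_continuous : continuous clip01.
Proof.
move=> t; apply: cvgD; last exact: cvg_cst.
apply: (@continuous_comp _ _ _ (fun t : R => t - 2^-1) (clip 2^-1)); last exact: clip_continuous.
by apply: cvgB; [exact: cvg_id|exact: cvg_cst].
Qed.

Section Flow.
Variables (N : nat) (F : 'rV[R]_N -> 'rV[R]_N) (U : set 'rV[R]_N).
Variable phi : 'rV[R]_N -> R -> 'rV[R]_N.
Hypotheses (sF : forall u, vsmooth_at F u) (oU : open U) (flowU : flow_family F U phi).

Lemma flow_continuous z t : U z -> 0 <= t <= 1 -> {for t, continuous (phi z)}.
Proof. by move=> /flowU[_ H] /H/derivable_continuous. Qed.

Lemma flow_clip_continuous z : U z -> continuous (fun t => phi z (clip01 t)).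
Proof.
move=> Uz t; apply: (@continuous_comp _ _ _ clip01 (phi z)); first exact: clip01_continuous.
by apply: flow_continuous => //; exact: clip01_itv.
Qed.

Lemma flow_bounded z (c : 'rV[R]_N) : U z ->
  exists2 r, 0 <= r & forall t, 0 <= t <= 1 -> `|phi z t - c| <= r.
Proof.
move=> Uz; have cn : continuous (fun t => `|phi z (clip01 t) - c|).
  move=> t; apply: (@continuous_comp _ _ _ (fun t => phi z (clip01 t)) (fun x => `|x - c|)).
    exact: flow_clip_continuous.
  exact: dist_continuous.
have [t0 _ Ht] := EVT_max (@ler01 R) (continuous_subspaceT cn).
exists `|phi z (clip01 t0) - c| => // t t01.
by have := Ht t; rewrite in_itv/= t01 (clip01_id t01); exact.
Qed.

(** [F] is only locally Lipschitz, so the perturbed trajectory must be confined before its distance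
    can be estimated; [gronwall] does both, because it needs the derivative bound only while the
    estimate holds. *)
Lemma flow_dist z0 : U z0 -> exists r L d, [/\ 0 <= r, 0 <= L, 0 < d &
  forall z A, U z -> `|z - z0| < A -> A <= d -> forall t, 0 <= t <= 1 ->
    [/\ `|phi z t - phi z0 t| < A * expR L, `|phi z0 t - z0| <= r
      & `|phi z t - z0| <= r]].
Proof.
move=> Uz0; have [r r0 Hr] := flow_bounded z0 Uz0.
have r10 : 0 <= r + 1 by rewrite addr_ge0.
have [L L0 HL] := vlipschitz_ball z0 r10 sF.
(* The reference trajectory stays within [r] of [z0]; with [d] equal to [expR (- L)] the gap never
   exceeds 1, hence the radius [r + 1]. *)
exists (r + 1), L, (expR (- L)); split => //; first exact: expR_gt0.
move=> z A Uz zA AL.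
have A0 : 0 < A by apply: le_lt_trans zA.
have AeL t : 0 <= t <= 1 -> A * expR (L * t) <= A * expR L.
  by move=> /andP[_ t1]; rewrite ler_pM2l // ler_expR ler_piMr.
have A1 : A * expR L <= 1.
  by rewrite -(expRxMexpNx_1 L) mulrC ler_pM2l ?expR_gt0.
have stay t : 0 <= t <= 1 -> `|phi z t - phi z0 t| < A * expR (L * t) -> `|phi z t - z0| <= r + 1.
  move=> t01 H; rewrite -(subrKA (phi z0 t)) (le_trans (ler_normD _ _)) // addrC.
  rewrite lerD ?Hr //; apply: ltW; apply: lt_le_trans H _.
  by apply: le_trans A1; exact: AeL.
have r1 t : 0 <= t <= 1 -> `|phi z0 t - z0| <= r + 1.
  by move=> t01; apply: le_trans (Hr t t01) _; rewrite lerDl.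
have G t : 0 <= t <= 1 -> `|phi z t - phi z0 t| < A * expR (L * t).
  apply: (@gronwall _ _ (fun t => phi z t - phi z0 t) (fun t => F (phi z t) - F (phi z0 t)) 1 A L).
  - by move=> s s01; apply: is_deriveB; [exact: (flowU Uz).2|exact: (flowU Uz0).2].
  - by rewrite (flowU Uz).1 (flowU Uz0).1.
  - move=> s s01 H; apply: le_trans (HL _ _ (stay s s01 H) (r1 s s01)) _.
    by rewrite -mulrA ler_wpM2l // ltW.
move=> t t01; split; [|exact: r1|by apply: stay => //; exact: G].
by apply: lt_le_trans (G t t01) _; exact: AeL.
Qed.

(** The variational equation is linear with coefficients bounded along the trajectory, hence
    globally Lipschitz as [picard] requires. *)
Lemma linear_flow z v : U z -> exists Y : R -> 'rV[R]_N, Y 0 = v /\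
  forall t : R, 0 <= t <= 1 -> is_derive t (1 : R) Y (jac F (phi z t) (Y t)).
Proof.
move=> Uz; have [r r0 Hr] := flow_bounded z Uz.
have [L L0 HL] := jac_ball z r0 sF.
pose f t y := jac F (phi z (clip01 t)) y.
have f_lip t x y : `|f t x - f t y| <= L * `|x - y|.
  by rewrite /f -jacB //; apply: HL; apply: Hr; exact: clip01_itv.
have f_cont (X : R -> 'rV[R]_N) : continuous X -> continuous (fun t => f t (X t)).
  move=> cX t; apply: rV_continuous => i.
  have -> : (fun t => f t (X t) 0 i) = (fun t => \sum_j X t 0 j * 'D_(delta_mx 0 j) (fun u => F u 0 i) (phi z (clip01 t))).
    by apply/funext => s; rewrite /f mxE (derive_coords _ (sF _ i)).
  apply: cvg_bigsum => j; apply: cvgM; first exact: rV_continuous_coord (cX t) j.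
  apply: (@continuous_comp _ _ _ (fun t => phi z (clip01 t)) ('D_(delta_mx 0 j) (fun u => F u 0 i))).
    exact: flow_clip_continuous.
  by apply: smooth_at_continuous; apply: smooth_at_derive; exact: sF.
(* Solving up to time 2 gives the derivative at time 1 as well. *)
have [Y [Y0 DY]] := picard L0 (ltr0Sn _ 1) f_lip f_cont v.
exists Y; split => // t t01; have := DY t; rewrite /f (clip01_id t01); apply.
by case/andP: t01 => t0 t1; rewrite ger0_norm // (le_lt_trans t1) // ltr1n.
Qed.

(** The remainder [phi (z + h *: v) - phi z - h *: Y] starts at 0 and satisfies the variational
    equation up to the Taylor error of [F], of order h^2; [gronwall] keeps it of order h^2. *)
Lemma flow_derivative z v (Y : R -> 'rV[R]_N) : U z -> Y 0 = v ->
  (forall t : R, 0 <= t <= 1 -> is_derive t (1 : R) Y (jac F (phi z t) (Y t))) ->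
  forall t : R, 0 <= t <= 1 -> is_derive z v (fun x => phi x t) (Y t).
Proof.
move=> Uz Y0 DY t t01.
have [r [L [d [r0 L0 d0 Hd]]]] := flow_dist Uz.
have [M M0 HM] := jac_ball z r0 sF.
have [C C0 HC] := vtaylor_ball z r0 sF.
have /near_normP[d' d'0 Hd'] := open_nbhs_nbhs (conj oU Uz).
pose a := `|v| + 1.
have a0 : 0 < a by rewrite ltr_wpDl.
(* [C * (a * expR L) ^+ 2] bounds the Taylor error; the added 1 provides the strict inequality that
   [gronwall] needs at time 0. *)
pose c := C * (a * expR L) ^+ 2 + 1.
have c0 : 0 < c by rewrite ltr_wpDl // mulr_ge0 // exprn_ge0 // mulr_ge0 ?expR_ge0 // ltW.
pose rho := Num.min d d' / a.
have rho0 : 0 < rho by rewrite divr_gt0 // lt_min d0.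
apply: (@is_derive_quadratic _ _ _ _ _ _ (c * expR (M + 1)) rho) => // h h0.
rewrite /rho ltr_pdivlMr // lt_min => /andP[hd hd'].
have hv : `|h *: v| < `|h| * a by rewrite normrZ ltr_pM2l ?normr_gt0 // ltrDl.
have Uh : U (z + h *: v).
  by apply: Hd'; rewrite [z + _]addrC addrK; apply: lt_trans hd'.
have near_flow s : 0 <= s <= 1 -> [/\ `|phi (z + h *: v) s - phi z s| < `|h| * a * expR L,
    `|phi z s - z| <= r & `|phi (z + h *: v) s - z| <= r].
  by apply: Hd => //; [rewrite [z + _]addrC addrK|exact: ltW].
pose w s := phi (z + h *: v) s - phi z s - h *: Y s.
pose dw s := F (phi (z + h *: v) s) - F (phi z s) - h *: jac F (phi z s) (Y s).
have h2 : 0 < h ^+ 2 by rewrite exprn_even_gt0.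
have G s : 0 <= s <= 1 -> `|w s| < c * h ^+ 2 * expR ((M + 1) * s).
  apply: (@gronwall _ _ w dw 1) => {s}.
  - move=> s s01; apply: is_deriveB; last by apply: is_deriveZ; exact: DY.
    by apply: is_deriveB; [exact: (flowU Uh).2|exact: (flowU Uz).2].
  - rewrite /w (flowU Uh).1 (flowU Uz).1 Y0 [z + _]addrC addrK subrr normr0.
    by rewrite mulr_gt0.
  - move=> s s01 ws; have [n1 n2 n3] := near_flow s s01.
    have -> : dw s = (F (phi (z + h *: v) s) - F (phi z s)
        - jac F (phi z s) (phi (z + h *: v) s - phi z s)) + jac F (phi z s) (w s).
      by rewrite /dw /w (jacB sF _ _ (h *: Y s)) (jacZ sF) addrA subrK.
    apply: le_trans (ler_normD _ _) _.
    have b1 : `|F (phi (z + h *: v) s) - F (phi z s)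
        - jac F (phi z s) (phi (z + h *: v) s - phi z s)| <= c * h ^+ 2.
      apply: le_trans (HC _ _ n3 n2) _.
      rewrite /c mulrDl mul1r; apply: ler_wpDr; first exact: ltW.
      rewrite -mulrA ler_wpM2l // -[h ^+ 2]real_normK ?num_real // -exprMn.
      have q0 : 0 <= a * expR L * `|h| by rewrite !mulr_ge0 ?expR_ge0 // ltW.
      by rewrite (ler_pXn2r (ltn0Sn 1)) ?nnegrE ?q0 // [leRHS]mulrC mulrA ltW.
    have b2 : `|jac F (phi z s) (w s)| <= M * (c * h ^+ 2 * expR ((M + 1) * s)).
      by apply: le_trans (HM _ _ n2) _; rewrite ler_wpM2l // ltW.
    (* In the rate [M + 1], [M] pays for the linear term and 1 for the Taylor error. *)
    apply: le_trans (lerD b1 b2) _.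
    have : 1 <= expR ((M + 1) * s).
      rewrite -expR0 ler_expR mulr_ge0 //; first by rewrite addr_ge0.
      by case/andP: s01.
    have : 0 < c * h ^+ 2 by rewrite mulr_gt0.
    move: (expR _) (c * h ^+ 2) => e q q0 e1.
    have -> : (M + 1) * q * e = q * e + M * (q * e) by ring.
    by rewrite lerD2r ler_peMr // ltW.
apply: le_trans (ltW (G t t01)) _.
rewrite [leRHS]mulrAC; apply: ler_wpM2l; first exact: ltW (mulr_gt0 c0 h2).
by rewrite ler_expR ler_piMr ?addr_ge0 //; case/andP: t01.
Qed.

End Flow.

Section TangentFlow.
Variables (N : nat) (F : 'rV[R]_N -> 'rV[R]_N).

(** The field on pairs (point, tangent vector) whose second component is the variational equation
    along the first. *)
Definition tangent_field (w : 'rV[R]_(N + N)) : 'rV[R]_(N + N) :=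
  row_mx (F (lsubmx w)) (jac F (lsubmx w) (rsubmx w)).

Lemma vsmooth_lsubmx n1 n2 (w : 'rV[R]_(n1 + n2)) : vsmooth_at lsubmx w.
Proof.
move=> i; under eq_fun do rewrite mxE; exact: smooth_at_coord.
Qed.

Lemma tangent_field_smooth : (forall u, vsmooth_at F u) ->
  forall w, vsmooth_at tangent_field w.
Proof.
move=> sF w i; rewrite /tangent_field; case: (split_ordP i) => j ->.
  under eq_fun do rewrite row_mxEl.
  apply: (@smooth_at_comp _ _ _ (fun u => F u 0 j)); first exact: sF.
  exact: vsmooth_lsubmx.
under eq_fun do rewrite row_mxEr mxE (derive_coords _ (sF _ j)).
apply: smooth_at_sum => l; apply: smooth_atM.
  by under eq_fun do rewrite mxE; exact: smooth_at_coord.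
apply: (@smooth_at_comp _ _ _ ('D_(delta_mx 0 l) (fun u => F u 0 j))).
  by apply: smooth_at_derive; exact: sF.
exact: vsmooth_lsubmx.
Qed.

Lemma is_derive_row_mx (V : normedModType R) n1 n2 (g : V -> 'rV[R]_n1) (h : V -> 'rV[R]_n2) x v a b :
  is_derive x v g a -> is_derive x v h b ->
  is_derive x v (fun t => row_mx (g t) (h t)) (row_mx a b).
Proof.
move=> /is_derive_coord Hg /is_derive_coord Hh; apply: is_derive_rV => i.
case: (split_ordP i) => j ->.
  by rewrite row_mxEl; under eq_fun do rewrite row_mxEl; exact: Hg.
by rewrite row_mxEr; under eq_fun do rewrite row_mxEr; exact: Hh.
Qed.

End TangentFlow.

Lemma flow_C0 N (F : 'rV[R]_N -> 'rV[R]_N) (U : set 'rV[R]_N) phi :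
  (forall u, vsmooth_at F u) -> open U -> flow_family F U phi ->
  forall t i z, 0 <= t <= 1 -> U z -> {for z, continuous (fun z => phi z t 0 i)}.
Proof.
move=> sF oU flowU t i z t01 Uz; apply: (@rV_continuous_coord _ _ _ (fun z => phi z t)).
have [r [L [d [r0 L0 d0 Hd]]]] := flow_dist sF flowU Uz.
have /near_normP[d' d'0 Hd'] := open_nbhs_nbhs (conj oU Uz).
apply/continuous_normP => e e0.
pose A := Num.min d (e / expR L).
have A0 : 0 < A by rewrite lt_min d0 divr_gt0 ?expR_gt0.
exists (Num.min d' A); first by rewrite lt_min d'0.
move=> y; rewrite lt_min => /andP[yd' yA].
have Ad : A <= d by rewrite ge_min lexx.
have [H _ _] := Hd y A (Hd' y yd') yA Ad t t01.
apply: lt_le_trans H _; rewrite -ler_pdivlMr ?expR_gt0 //.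
by rewrite ge_min lexx orbT.
Qed.

(** A directional derivative of the flow of [F] is the second half of the flow of [tangent_field F].
    Hence C^k in dimension [N + N] gives C^(k+1) in dimension [N], and the induction quantifies over
    the dimension and the field. *)
Theorem flow_smooth k N (F : 'rV[R]_N -> 'rV[R]_N) (U : set 'rV[R]_N) phi :
  (forall u, vsmooth_at F u) -> open U -> flow_family F U phi ->
  forall t i, 0 <= t <= 1 -> Ck k U (fun z => phi z t 0 i).
Proof.
elim: k N F U phi => [|k IH] N F U phi sF oU flowU t i t01.
  by split => // z Uz; exact: flow_C0 sF oU flowU t i z t01 Uz.
(* [w] collects an initial point and an initial vector; for points outside [U] the choice is a
   dummy. *)
have /choice[Y HY] : forall w : 'rV[R]_(N + N), exists Y : R -> 'rV[R]_N,
    U (lsubmx w) -> Y 0 = rsubmx w /\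
    forall t : R, 0 <= t <= 1 -> is_derive t (1 : R) Y (jac F (phi (lsubmx w) t) (Y t)).
  move=> w; have [Uw|nU] := pselect (U (lsubmx w)); last by exists (fun=> 0).
  by have [Y HY] := linear_flow sF flowU (rsubmx w) Uw; exists Y.
pose U' : set 'rV[R]_(N + N) := setT `&` lsubmx @^-1` U.
have oU' : open U'.
  exact: (open_preimage openT oU (fun w _ => vsmooth_at_continuous (@vsmooth_lsubmx N N w))).
pose psi (w : 'rV[R]_(N + N)) s := row_mx (phi (lsubmx w) s) (Y w s).
have flow' : flow_family (tangent_field F) U' psi.
  move=> w [_ Uw]; have [Y0 DY] := HY w Uw; split.
    by rewrite /psi (flowU _ Uw).1 Y0 hsubmxK.
  move=> s s01; rewrite /psi /tangent_field row_mxKl row_mxKr; apply: is_derive_row_mx.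
    exact: (flowU _ Uw).2.
  exact: DY.
have IHk := IH _ _ _ _ (tangent_field_smooth sF) oU' flow' t (rshift N i) t01.
have D z v : U z -> is_derive z v (fun z => phi z t 0 i) (Y (row_mx z v) t 0 i).
  move=> Uz; apply: (@is_derive_coord _ _ _ (fun z => phi z t)).
  have Uzv : U (lsubmx (row_mx z v)) by rewrite row_mxKl.
  have [Y0 DY] := HY _ Uzv; rewrite row_mxKl row_mxKr in Y0 DY.
  exact: (flow_derivative sF oU flowU Uz Y0 DY t01).
split; first by move=> z Uz; exact: flow_C0 sF oU flowU t i z t01 Uz.
move=> v; split; first by move=> z Uz; have [] := D z v Uz.
(* The derivative at [z] is read at the pair ([z], [v]), an affine function of [z]. *)
apply: (@Ck_ext _ _ _ _ ((fun w => psi w t 0 (rshift N i)) \o (fun z => row_mx z v))) => //.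
  by move=> z Uz; have Dz := D z v Uz; rewrite derive_val /= /psi row_mxEr.
apply: (@Ck_comp _ _ _ _ _ U') => //.
  move=> j; apply: smooth_on_Ck => u _; case: (split_ordP j) => l ->.
    by under eq_fun do rewrite row_mxEl; exact: smooth_at_coord.
  by under eq_fun do rewrite row_mxEr; exact: smooth_at_cst.
by move=> z Uz; split => //=; rewrite row_mxKl.
Qed.

End SmoothDependence.

(** * The inverse function theorem *)

Section SmoothMatrix.
Context {R : realType} {V : normedModType R}.

Lemma smooth_at_det n (A : V -> 'M[R]_n) u :
  (forall i j, smooth_at (fun x => A x i j) u) -> smooth_at (fun x => \det (A x)) u.
Proof.
move=> H; rewrite /determinant; apply: smooth_at_sum => s.
apply: (@smooth_atM _ _ (cst _)); first exact: smooth_at_cst.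
by apply: smooth_at_prod.
Qed.

(** Cramer's rule exhibits the entries as cofactors divided by the determinant, which stays nonzero
    near [u]. *)
Lemma smooth_at_invmx n (A : V -> 'M[R]_n) u i j :
  (forall i j, smooth_at (fun x => A x i j) u) -> A u \in unitmx ->
  smooth_at (fun x => (invmx (A x)) i j) u.
Proof.
move=> H Au; have detu : \det (A u) != 0 by rewrite unitmxE unitfE in Au.
have sdet := smooth_at_det H.
apply: (@smooth_at_ext _ _ (fun x => (\det (A x))^-1 * (\adj (A x)) i j)).
  have /near_normP[r r0 Hr] : \forall x \near u, \det (A x) != 0.
    have /continuous_normP/(_ `|\det (A u)|)[|r r0 Hr] := smooth_at_continuous sdet.
      by rewrite normr_gt0.
    apply: (near_normP u _).2; exists r => // y /Hr; apply: contraTneq => ->.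
    by rewrite sub0r normrN ltxx.
  apply: (near_normP u _).2; exists r => // y /Hr dy.
  by rewrite /invmx unitmxE unitfE dy [in RHS]mxE.
apply: smooth_atM; first exact: smooth_atV.
under eq_fun do rewrite mxE /cofactor.
apply: (@smooth_atM _ _ (cst _)); first exact: smooth_at_cst.
by apply: smooth_at_det => k l; under eq_fun do rewrite !mxE; exact: H.
Qed.

End SmoothMatrix.

(** * Local inversion of maps smooth everywhere *)

Section InverseFunction.
Context {R : realType} {n : nat}.
Local Notation E := 'rV[R]_n.

Lemma vector_geometric_limit (u : nat -> E) (c : R) :
  (forall m, `|u m.+1 - u m| <= c / 2 ^+ m) ->
  exists l, forall m, `|l - u m| <= 2 * c / 2 ^+ m.
Proof.
move=> H; have c0 : 0 <= c by have := H 0; rewrite expr0 divr1; exact: le_trans.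
have /choice[l Hl] : forall i : 'I_n, exists l, forall m, `|l - u m 0 i| <= 2 * c / 2 ^+ m.
  move=> i; apply: geometric_limit => m; apply: le_trans (H m).
  by have := rV_coord_le (u m.+1 - u m) i; rewrite !mxE.
exists (\row_i l i) => m; apply: rV_norm_le => [|i]; last by rewrite !mxE.
by rewrite divr_ge0 ?exprn_ge0 // mulr_ge0.
Qed.

Lemma small_power (c e : R) : 0 < e -> exists m, c / 2 ^+ m < e.
Proof.
move=> e0; have [m Hm] : exists m : nat, c / e < m%:R.
  by exists (Num.truncn `|c / e|).+1; apply: le_lt_trans (ler_norm _) _; exact: truncnS_gt.
exists m; rewrite ltr_pdivrMr ?exprn_gt0 // mulrC -ltr_pdivrMr //.
by apply: lt_trans Hm _; rewrite -natrX ltr_nat ltn_expl.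
Qed.

(** Ratio 1/2 makes the iterates of [a] converge geometrically, and the closed ball contains their
    limit. *)
Lemma fixed_point (T : E -> E) (a : E) (r : R) : 0 <= r ->
  (forall x, `|x - a| <= r -> `|T x - a| <= r) ->
  (forall x y, `|x - a| <= r -> `|y - a| <= r -> `|T x - T y| <= 2^-1 * `|x - y|) ->
  exists2 x, `|x - a| <= r & T x = x.
Proof.
move=> r0 Tr Tl; pose u m := iter m T a.
have ur m : `|u m - a| <= r by elim: m => [|m IH]; [rewrite subrr normr0|exact: Tr].
have uS m : `|u m.+1 - u m| <= r / 2 ^+ m.
  elim: m => [|m IH]; first by rewrite expr0 divr1; exact: ur 1%N.
  apply: le_trans (Tl _ _ (ur m.+1) (ur m)) _.
  by rewrite exprS invfM mulrCA ler_pM2l // invr_gt0.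
have [x Hx] := vector_geometric_limit uS.
have xr : `|x - a| <= r.
  apply/ler_addgt0Pl => e e0; have [m Hm] := small_power (2 * r) e0.
  rewrite -(subrKA (u m)); apply: le_trans (ler_normD _ _) _.
  by rewrite lerD // (le_trans (Hx m)) // ltW.
exists x => //; apply/eqP; rewrite -subr_eq0 -normr_le0; apply/ler_addgt0Pl => e e0.
rewrite addr0; have [m Hm] := small_power (2 * r) e0; apply: le_trans (ltW Hm).
rewrite -(subrKA (u m.+1)); apply: le_trans (ler_normD _ _) _.
have H1 := le_trans (Tl _ _ xr (ur m)) (ler_wpM2l (ltW (_ : 0 < 2^-1)) (Hx m)).
have H2 := Hx m.+1; rewrite distrC in H2.
rewrite [leRHS](splitr _) lerD //.
  by apply: le_trans (H1 _) _; rewrite ?invr_gt0 // mulrC.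
by apply: le_trans H2 _; rewrite exprS invfM mulrA mulrAC.
Qed.

Variables (e : E -> E) (a : E).
Hypotheses (se : forall u, vsmooth_at e u) (ea : forall v, jac e a v = v).

(** The differential of [e] at [a] is normalized to the identity, so that of [g] vanishes there and
    [g] is a contraction near [a]. *)
Let g u := e u - u.

Lemma smooth_shift u : vsmooth_at g u.
Proof.
by move=> i; under eq_fun do rewrite !mxE; apply: smooth_atB; [exact: se|exact: smooth_at_coord].
Qed.

Lemma jac_shift u v : jac g u v = jac e u v - v.
Proof.
apply/rowP => i; rewrite !mxE.
have -> : (fun u => g u 0 i) = (fun u => e u 0 i + (- (u 0 i))).
  by apply/funext => x; rewrite !mxE.
rewrite derive_add; [|exact: se|by apply: smooth_atN; exact: smooth_at_coord].
by rewrite derive_opp ?derive_coord_proj //; exact: smooth_at_coord.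
Qed.

Lemma contraction_ball : exists2 r, 0 < r & forall x, `|x - a| <= r ->
  forall v, `|jac g x v| <= 2^-1 * `|v|.
Proof.
(* [n] partial derivatives below [eta] add up to at most 1/2; [n.+1] covers [n = 0]. *)
pose eta : R := (2 * n.+1%:R)^-1.
have eta0 : 0 < eta by rewrite invr_gt0 mulr_gt0.
have /near_normP[r r0 Hr] : \forall x \near a, forall i j : 'I_n,
    `|'D_(delta_mx 0 j) (fun u => g u 0 i) x| < eta.
  apply: (@near_forall_ord E a 'I_n (fun i x => forall j : 'I_n, `|'D_(delta_mx 0 j) (fun u => g u 0 i) x| < eta)) => i.
  apply: (@near_forall_ord E a 'I_n (fun j x => `|'D_(delta_mx 0 j) (fun u => g u 0 i) x| < eta)) => j.
  have sD := smooth_at_derive (delta_mx 0 j) (smooth_shift a i).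
  have /continuous_normP/(_ eta eta0)[r r0 Hr] := smooth_at_continuous sD.
  apply: (near_normP a _).2; exists r => // y /Hr.
  have -> : 'D_(delta_mx 0 j) (fun u => g u 0 i) a = 0; last by rewrite subr0.
  by have /rowP/(_ i) := jac_shift a (delta_mx 0 j); rewrite ea subrr !mxE.
exists (r / 2); first by rewrite divr_gt0.
move=> x xa v; have {}xa : `|x - a| < r.
  by apply: le_lt_trans xa _; rewrite ltr_pdivrMr // ltr_pMr // ltr1n.
apply: rV_norm_le => [|i]; first by rewrite mulr_ge0 // invr_ge0.
rewrite mxE (derive_coords _ (smooth_shift x i)).
apply: le_trans (ler_norm_sum _ _ _) _.
apply: (@le_trans _ _ (\sum_(j < n) (eta * `|v|))).
  apply: ler_sum => j _; rewrite normrM mulrC ler_pM // ?rV_coord_le //.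
  by apply: ltW; exact: Hr.
rewrite sumr_const card_ord -[leLHS]mulr_natr mulrAC ler_wpM2r //.
rewrite /eta invfM -mulrA ler_piMr ?invr_ge0 // mulrC ler_pdivrMr // mul1r ler_nat //.
Qed.

Definition jacmx u : 'M[R]_n := \matrix_(j, i) 'D_(delta_mx 0 j) (fun x => e x 0 i) u.

Lemma mul_jacmx u v : v *m jacmx u = jac e u v.
Proof.
apply/rowP => i; rewrite !mxE (derive_coords _ (se u i)).
by apply: eq_bigr => j _; rewrite mxE.
Qed.

(** Solving [e u = y] means finding a fixed point of [u -> y - g u], a contraction with ratio
    1/2. *)
Theorem inverse_function_global (B : set E) : open B -> B a ->
  exists (W N : set E) (L : E -> E), [/\ open W /\ W a, W `<=` B, open N /\ N (e a),
    forall u, W u -> N (e u) /\ L (e u) = u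
  & forall y, N y -> [/\ W (L y), e (L y) = y & vsmooth_at L y]].
Proof.
move=> oB Ba; have [r1 r10 Hr1] := contraction_ball.
have /near_normP[r2 r20 Hr2] := open_nbhs_nbhs (conj oB Ba).
pose r := Num.min r1 r2; have r0 : 0 < r by rewrite lt_min r10.
have rr1 : r <= r1 by rewrite ge_min lexx.
have rr2 : r <= r2 by rewrite ge_min lexx orbT.
have Hr x v : `|x - a| <= r -> `|jac g x v| <= 2^-1 * `|v|.
  by move=> xa; apply: Hr1; exact: le_trans xa rr1.
have gl x y : `|x - a| <= r -> `|y - a| <= r -> `|g x - g y| <= 2^-1 * `|x - y|.
  move=> xa ya; apply: rV_norm_le => [|i]; first by rewrite mulr_ge0 // invr_ge0.
  have [t t01 E1] := @MVT_line _ _ (fun u => g u 0 i) ('D_(x - y) (fun u => g u 0 i)) y (x - y)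
    (fun t _ => smooth_at_is_derive _ (smooth_shift _ i)).
  rewrite [y + (x - y)]addrC subrK in E1; rewrite !mxE in E1 *; rewrite E1.
  have seg : `|y + t *: (x - y) - a| <= r.
    by apply: segment_ball => //; case/andP: t01 => /ltW -> /ltW ->.
  by have := Hr _ (x - y) seg; apply: le_trans; have := rV_coord_le (jac g (y + t *: (x - y)) (x - y)) i; rewrite mxE.
(* [e] differs from the identity by a map of ratio 1/2, so it shrinks distances by at most a factor
   2: this yields injectivity and a Lipschitz inverse. *)
have el x y : `|x - a| <= r -> `|y - a| <= r -> `|x - y| <= 2 * `|e x - e y|.
  move=> xa ya; have := gl x y xa ya.
  have : `|x - y| <= `|e x - e y| + `|g x - g y|.
    have -> : x - y = (e x - e y) - (g x - g y) by rewrite /g opprB addrACA; apply/rowP => i; rewrite !mxE; ring.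
    exact: ler_normB.
  by move: `|x - y| `|e x - e y| `|g x - g y| => p q s; lra.
(* On the ball of radius [r / 2], [g] moves by at most [r / 4]; adding [|y - e a| < r / 4] keeps
   [y - g x] inside. *)
pose N : set E := [set y | `|y - e a| < r / 4].
have ex y : N y -> exists2 u, `|u - a| < r / 2 & e u = y.
  move=> Ny; have r20' : 0 <= r / 2 by rewrite divr_ge0 // ltW.
  have rhalf : r / 2 <= r by rewrite ler_pdivrMr // ler_pMr // ler1n.
  have Tin x : `|x - a| <= r / 2 -> `|(y - g x) - a| < r / 2.
    move=> xa; have -> : y - g x - a = (y - e a) + (g a - g x).
      by rewrite /g; apply/rowP => i; rewrite !mxE; ring.
    have Ny' : `|y - e a| < r / 4 by exact: Ny.
    have := gl a x; rewrite subrr normr0 => /(_ (ltW r0) (le_trans xa rhalf)).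
    rewrite [`|a - x|]distrC => H; apply: le_lt_trans (ler_normD _ _) _.
    by move: H xa Ny'; move: `|_| `|_| `|_| => p q s; lra.
  have [|x y' xa ya|x xa Hx] := @fixed_point (fun x => y - g x) a (r / 2) r20'.
  - by move=> x /Tin/ltW.
  - have -> : y - g x - (y - g y') = g y' - g x.
      by apply/rowP => i; rewrite !mxE; ring.
    by rewrite distrC; exact: gl (le_trans xa rhalf) (le_trans ya rhalf).
  exists x; first by rewrite -Hx; exact: Tin.
  by rewrite -[RHS](subrK (g x)) Hx /g addrC subrK.
have /choice[L HL] : forall y, exists u, N y -> `|u - a| < r / 2 /\ e u = y.
  by move=> y; have [/ex[u]|nN] := pselect (N y); [exists u|exists 0].
have rlt : r / 2 < r by rewrite ltr_pdivrMr // ltr_pMr // ltr1n.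
have oball (c : E) (s : R) : open [set y : E | `|y - c| < s].
  have -> : [set x | `|x - c| < s] = ball c s.
    by apply/seteqP; split => x /=; rewrite -ball_normE/= distrC.
  exact: ball_open.
have oN : open N by exact: oball.
have Ne : N (e a) by rewrite /N /= subrr normr0 divr_gt0.
have Lr y : N y -> `|L y - a| <= r by move=> /HL[H _]; exact: ltW (lt_trans H rlt).
have LL y y' : N y -> N y' -> `|L y - L y'| <= 2 * `|y - y'|.
  move=> Ny Ny'; apply: le_trans (el _ _ (Lr _ Ny) (Lr _ Ny')) _.
  by rewrite (HL _ Ny).2 (HL _ Ny').2.
(* A kernel vector [v] satisfies |v| <= |v| / 2 by the contraction bound. *)
have Junit u : `|u - a| <= r -> jacmx u \in unitmx.
  move=> ua; rewrite -row_free_unit -kermx_eq0; apply/eqP/row_matrixP => i; rewrite row0.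
  have : row i (kermx (jacmx u)) *m jacmx u = 0 by rewrite -row_mul mulmx_ker row0.
  move: (row i _) => v; rewrite mul_jacmx => jv.
  have := Hr u v ua; rewrite jac_shift jv sub0r normrN => H.
  by apply/eqP; rewrite -normr_le0; move: H; move: `|v| => p; lra.
have DL y v : N y -> is_derive y v L (v *m invmx (jacmx (L y))).
  move=> Ny; have [C C0 HC] := vtaylor_ball a (ltW r0) se.
  have /near_normP[d d0 Hd] := open_nbhs_nbhs (conj oN Ny).
  have a0 : 0 < `|v| + 1 by rewrite ltr_wpDl.
  (* 8 is 2 from inverting the differential ([q2]), times 4 from squaring the Lipschitz constant 2
     of [L] ([H2]). *)
  apply: (@is_derive_quadratic _ _ _ _ _ _ _ (8 * C * `|v| ^+ 2) (d / (`|v| + 1))).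
    by rewrite divr_gt0.
  move=> h h0; rewrite ltr_pdivlMr // => hd.
  set w := v *m _.
  have Nh : N (y + h *: v).
    apply: Hd; rewrite [y + _]addrC addrK normrZ; apply: le_lt_trans hd.
    by rewrite ler_wpM2l // lerDl.
  pose q := L (y + h *: v) - L y - h *: w.
  have qJ : jac e (L y) q = - (e (L (y + h *: v)) - e (L y) - jac e (L y) (L (y + h *: v) - L y)).
    have dhv : y + h *: v - y = h *: v by rewrite addrC addKr.
    rewrite (HL _ Nh).2 (HL _ Ny).2 dhv /q (jacB se _ _ (h *: w)) (jacZ se) -(mul_jacmx _ w).
    by rewrite [RHS]opprB /w (mulmxKV (Junit _ (Lr _ Ny))).
  have q2 : `|q| <= 2 * `|jac e (L y) q|.
    have := Hr (L y) q (Lr _ Ny); rewrite jac_shift.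
    have : `|q| <= `|jac e (L y) q| + `|jac e (L y) q - q|.
      rewrite -[X in `|X| <= _](subKr (jac e (L y) q)); exact: ler_normB.
    by move: `|q| `|jac _ _ _| `|_ - _| => p s t; lra.
  apply: le_trans q2 _; rewrite qJ normrN.
  have H1 := HC _ _ (Lr _ Nh) (Lr _ Ny).
  have H2 : `|L (y + h *: v) - L y| ^+ 2 <= 4 * `|v| ^+ 2 * h ^+ 2.
    have -> : 4 * `|v| ^+ 2 * h ^+ 2 = (2 * `|h *: v|) ^+ 2.
      rewrite normrZ !exprMn real_normK ?num_real // -mulrA [_ * h ^+ 2]mulrC; congr (_ * _).
      by rewrite -natrX.
    rewrite ler_pXn2r ?nnegrE // ?mulr_ge0 //.
    by have := LL _ _ Nh Ny; rewrite [y + _]addrC addrK.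
  have {}H1 := le_trans H1 (ler_wpM2l C0 H2).
  rewrite (_ : 8 * C * `|v| ^+ 2 * h ^+ 2 = 2 * (C * (4 * `|v| ^+ 2 * h ^+ 2))) ?ler_pM2l //.
  by move: (`|v| ^+ 2) (h ^+ 2) => p s; ring.
(* Bootstrap: the derivative of [L] is a smooth function of [L], so it is as regular as [L]
   itself. *)
have CL k i : Ck k N (fun y => L y 0 i).
  elim: k i => [|k IH] i.
    split => // y Ny; apply: (rV_continuous_coord (g := L)).
    apply/continuous_normP => s s0.
    have /near_normP[d d0 Hd] := open_nbhs_nbhs (conj oN Ny).
    exists (Num.min d (s / 2)); first by rewrite lt_min d0 divr_gt0.
    move=> y'; rewrite lt_min => /andP[y'd y's].
    apply: le_lt_trans (LL _ _ (Hd _ y'd) Ny) _.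
    by rewrite mulrC -ltr_pdivlMr.
  have DLi y v : N y -> is_derive y v (fun y => L y 0 i) ((v *m invmx (jacmx (L y))) 0 i).
    by move=> Ny; exact: is_derive_coord (DL y v Ny) i.
  split; first by move=> y Ny; exact: CkC (IH i) Ny.
  move=> v; split; first by move=> y Ny; have [] := DLi y v Ny.
  apply: (@Ck_ext _ _ _ _ ((fun u => (v *m invmx (jacmx u)) 0 i) \o L)) => //.
    by move=> y Ny; have D := DLi y v Ny; rewrite derive_val.
  apply: (@Ck_comp _ _ _ _ _ [set u | `|u - a| < r]) => //.
    apply: smooth_on_Ck => u /= ua; under eq_fun do rewrite mxE.
    apply: smooth_at_sum => j; apply: (@smooth_atM _ _ (cst _)); first exact: smooth_at_cst.
    apply: smooth_at_invmx; last by apply: Junit; exact: ltW.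
    move=> k' l; under eq_fun do rewrite mxE.
    by apply: smooth_at_derive; exact: se.
  by move=> y Ny; apply: lt_trans (HL _ Ny).1 rlt.
pose W : set E := [set u | `|u - a| < r / 2] `&` e @^-1` N.
exists W, N, L; split.
- split; last by split => //=; rewrite subrr normr0 divr_gt0.
  exact: (open_preimage (oball a (r / 2)) oN (fun u _ => vsmooth_at_continuous (se u))).
- by move=> u [ua _]; apply: Hr2; apply: lt_le_trans ua (le_trans (ltW rlt) rr2).
- by split.
- move=> u [ua Nu]; split => //; apply/eqP; rewrite -subr_eq0 -normr_le0.
  have := el _ _ (Lr _ Nu) (ltW (lt_trans ua rlt)).
  by rewrite (HL _ Nu).2 subrr normr0 mulr0.
- move=> y Ny; split; [|exact: (HL _ Ny).2|].
    by split; [exact: (HL _ Ny).1|rewrite /= (HL _ Ny).2].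
  by move=> i; exists N => // k; exact: CL.
Qed.

End InverseFunction.

(** * Local inversion of maps smooth on an open set *)

Section InverseFunctionLocal.
Context {R : realType} {n : nat}.
Local Notation E := 'rV[R]_n.

Lemma jac_near m (e f : E -> 'rV[R]_m) (a v : E) : (\near a, e a = f a) -> jac e a v = jac f a v.
Proof.
move=> ef; apply/rowP => i; rewrite !mxE; apply: near_eq_derive.
by apply: filterS ef => x ->.
Qed.

(** A bump function equal to 1 near [a] extends [e] to a map smooth everywhere without changing it
    near [a]. *)
Theorem inverse_function (e : E -> E) (a : E) (B : set E) : open B -> B a ->
  (forall u, B u -> vsmooth_at e u) -> (forall v, jac e a v = v) ->
  exists (W N : set E) (L : E -> E), [/\ open W /\ W a, W `<=` B, open N /\ N (e a),
    forall u, W u -> N (e u) /\ L (e u) = u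
  & forall y, N y -> [/\ W (L y), e (L y) = y & vsmooth_at L y]].
Proof.
move=> oB Ba se ea; have /near_normP[r r0 Hr] := open_nbhs_nbhs (conj oB Ba).
have r2 : 0 < r / 2 by rewrite divr_gt0.
have r4 : 0 < r / 2 / 2 by rewrite divr_gt0.
have r2r : r / 2 < r by rewrite ltr_pdivrMr // ltr_pMr // ltr1n.
have r4r : r / 2 / 2 < r / 2 by rewrite ltr_pdivrMr // ltr_pMr // ltr1n.
have [b [sb b1 b0]] := bump_exists a r2.
pose e' u := b u *: e u.
have e'e u : `|u - a| < r / 2 / 2 -> e u = e' u.
  by move=> ua; rewrite /e' b1 ?scale1r // ltW.
have se' u : vsmooth_at e' u.
  move=> i; under eq_fun do rewrite mxE.
  apply: smooth_atM0 => //; have [Bu|nBu] := pselect (B u); first by left; exact: se.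
  right; have ur : r <= `|u - a| by rewrite leNgt; apply/negP => /Hr.
  apply: (near_normP u _).2; exists (r / 2) => // y yu; apply: b0.
  have : `|u - a| <= `|y - u| + `|y - a|.
    by rewrite [`|y - u|]distrC -[X in `|X| <= _](subrKA y) ler_normD.
  by move: ur yu; move: `|_| `|_| `|_| => p q s; lra.
have ea' v : jac e' a v = v.
  rewrite -[RHS]ea; apply/esym/jac_near; apply: (near_normP a _).2.
  by exists (r / 2 / 2).
pose B' : set E := [set u | `|u - a| < r / 2 / 2].
have oB' : open B'.
  have -> : B' = ball a (r / 2 / 2).
    by apply/seteqP; split => x /=; rewrite -ball_normE/= distrC.
  exact: ball_open.
have B'a : B' a by rewrite /B' /= subrr normr0.
have [W [N [L [[oW Wa] WB [oN Na] H1 H2]]]] := inverse_function_global se' ea' oB' B'a.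
exists W, N, L; split => //.
- by move=> u /WB ua; apply: Hr; apply: lt_trans ua (lt_trans r4r r2r).
- by rewrite (e'e a).
- by move=> u Wu; rewrite (e'e u) //; [exact: H1|exact: WB].
- by move=> y /H2[Wy ey sL]; split => //; rewrite (e'e (L y)) //; exact: WB.
Qed.

End InverseFunctionLocal.

(** * Local flows *)

Section LocalFlows.
Context {R : realType}.

(** A derivative that exists is determined by the difference quotients on one side, selected by the
    sign [sg]. This matters because geodesics are compared on [0, 1] only. *)
Lemma derive_one_sided (f g : R -> R) (a sg d : R) : `|sg| = 1 -> 0 < d ->
  derivable f a 1 -> derivable g a 1 ->
  (forall s, 0 <= s < d -> f (a + sg * s) = g (a + sg * s)) -> 'D_1 f a = 'D_1 g a.
Proof.
move=> sg1 d0 df dg fg; apply/eqP; rewrite -subr_eq0; apply/negP => /negP L0.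
pose L := 'D_1 f a - 'D_1 g a.
have [dh hL] : is_derive a (1 : R) (fun s => f s - g s) L.
  by apply: is_deriveB; exact: derivableP.
have lim : (fun h : R => h^-1 *: (((fun s => f s - g s) \o shift a) (h *: 1) - (f a - g a))) @ 0^' --> L.
  by rewrite -hL.
have L1 : 0 < `|L| by rewrite normr_gt0.
move/cvgrPdist_lt/(_ _ L1) : lim; rewrite near_withinE => /(near_normP (0 : R) _).1[r r0 Hr].
pose s := Num.min r d / 2.
have s0 : 0 < s by rewrite divr_gt0 // lt_min r0.
have sm : s < Num.min r d by rewrite ltr_pdivrMr // ltr_pMr ?ltr1n // lt_min r0.
have [sr sd] : s < r /\ s < d by move: sm; rewrite lt_min => /andP[].
have sg0 : sg != 0 by rewrite -normr_gt0 sg1.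
have hs : `|sg * s - 0| < r by rewrite subr0 normrM sg1 mul1r gtr0_norm.
have sgs0 : sg * s != 0 by rewrite mulf_neq0 // gt_eqF.
have := Hr _ hs sgs0 => /=.
rewrite [(sg * s)%:A]mulr1 [sg * s + a]addrC fg ?sd ?(ltW s0) //.
have := fg 0; rewrite lexx d0 mulr0 addr0 => /(_ isT) ->.
by rewrite !subrr scaler0 subr0 ltxx.
Qed.

(** Bootstrap on the equation: if [X] is C^k, so is its derivative [F (X t)]. *)
Lemma solution_smooth N (F : 'rV[R]_N -> 'rV[R]_N) (X : R -> 'rV[R]_N) (a b : R) :
  (forall u, vsmooth_at F u) ->
  (forall t, a < t < b -> is_derive t (1 : R) X (F (X t))) ->
  forall t, a < t < b -> vsmooth_at X t.
Proof.
move=> sF DX t tab i; pose U : set R := [set t | a < t < b].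
have oU : open U.
  have -> : U = [set` `]a, b[%R] by apply/seteqP; split => s /=; rewrite in_itv.
  exact: interval_open.
exists U => // k; elim: k i => [|k IH] i.
  split => // s sab; apply: (@derivable_continuous _ _ (fun s => X s 0 i)).
  exact: is_derive_coord (DX s sab) i.
have D s v : U s -> is_derive s v (fun s => X s 0 i) (v * F (X s) 0 i).
  move=> sab; have := is_derive_scale v (is_derive_coord (DX s sab) i).
  by rewrite [_ *: 1]mulr1.
split; first by move=> s Us; exact: CkC (IH i) Us.
move=> v; split; first by move=> s Us; have [] := D s v Us.
apply: (@Ck_ext _ _ _ _ (fun s => cst v s * ((fun x => F x 0 i) \o X) s)) => //.
  by move=> s Us; have Ds := D s v Us; rewrite derive_val.
apply: CkM => //; first exact: Ck_cst.
apply: (@Ck_comp _ _ _ _ _ setT) => //; first exact: openT.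
by apply: smooth_on_Ck => u _; exact: sF.
Qed.

Lemma is_derive_translate (W : normedModType R) (X : R -> W) (t s : R) (d : W) :
  is_derive (t + s) (1 : R) X d -> is_derive s (1 : R) (fun s => X (t + s)) d.
Proof.
move=> H; have := @is_derive_line _ _ _ X t 1 s d; rewrite [_ *: 1]mulr1 => /(_ H).
by under eq_fun do rewrite [_ *: 1]mulr1.
Qed.

(** Both solutions stay for a while in a ball on which [F] is Lipschitz; [gronwall] with arbitrarily
    small [A] then forces their difference to vanish. *)
Lemma local_uniqueness N (F : 'rV[R]_N -> 'rV[R]_N) (X Y : R -> 'rV[R]_N) (t d : R) :
  (forall u, vsmooth_at F u) -> 0 < d ->
  (forall s : R, t <= s < t + d -> is_derive s (1 : R) X (F (X s))) ->
  (forall s : R, t <= s < t + d -> is_derive s (1 : R) Y (F (Y s))) ->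
  X t = Y t -> exists2 e, 0 < e & forall s, t <= s < t + e -> X s = Y s.
Proof.
move=> sF d0 DX DY XY; have td : t <= t < t + d by rewrite lexx ltrDl.
have [L L0 HL] := vlipschitz_ball (X t) (@ler01 R) sF.
have [r1 r10 H1] := (continuous_normP _ _).1 (derivable_continuous (DX t td)) 1 ltr01.
have [r2 r20 H2] := (continuous_normP _ _).1 (derivable_continuous (DY t td)) 1 ltr01.
pose e := Num.min d (Num.min r1 r2).
have e0 : 0 < e by rewrite !lt_min d0 r10.
exists (e / 2); first by rewrite divr_gt0.
have ee : e / 2 < e by rewrite ltr_pdivrMr // ltr_pMr // ltr1n.
have Ts s : 0 <= s <= e / 2 -> [/\ t <= t + s < t + d, `|X (t + s) - X t| <= 1 & `|Y (t + s) - X t| <= 1].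
  move=> /andP[s0 se]; have := le_lt_trans se ee; rewrite !lt_min => /and3P[sd sr1 sr2].
  split; first by rewrite lerDl s0 ltrD2l.
    by apply/ltW/H1; rewrite addrC addKr ger0_norm.
  by rewrite XY; apply/ltW/H2; rewrite addrC addKr ger0_norm.
move=> s /andP[ts st]; apply/eqP; rewrite -subr_eq0 -normr_le0; apply/ler_addgt0Pl => eps eps0.
rewrite addr0; pose A := eps / expR (L * (s - t)).
have A0 : 0 < A by rewrite divr_gt0 ?expR_gt0.
have := @gronwall R N (fun r => X (t + r) - Y (t + r)) (fun r => F (X (t + r)) - F (Y (t + r))) (e / 2) A L.
have G1 (r : R) : 0 <= r <= e / 2 -> is_derive r (1 : R) (fun r => X (t + r) - Y (t + r)) (F (X (t + r)) - F (Y (t + r))).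
  by move=> /Ts[rd _ _]; apply: is_deriveB; apply: is_derive_translate; [exact: DX|exact: DY].
have G2 : `|X (t + 0) - Y (t + 0)| < A by rewrite !addr0 XY subrr normr0.
have G3 r : 0 <= r <= e / 2 -> `|X (t + r) - Y (t + r)| < A * expR (L * r) ->
    `|F (X (t + r)) - F (Y (t + r))| <= L * A * expR (L * r).
  move=> /Ts[_ b1 b2] H; apply: le_trans (HL _ _ b1 b2) _.
  by rewrite -mulrA ler_wpM2l // ltW.
move=> /(_ G1 G2 G3 (s - t)); rewrite [t + _]addrC subrK /A divfK ?gt_eqF ?expR_gt0 // => H.
by apply/ltW/H; rewrite subr_ge0 ts /= lerBlDl ltW.
Qed.

Definition vclip N (z0 : 'rV[R]_N) (rho : R) (z : 'rV[R]_N) : 'rV[R]_N :=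
  \row_i (z0 0 i + clip rho (z 0 i - z0 0 i)).

Lemma vclip_dist N (z0 : 'rV[R]_N) rho z w : `|vclip z0 rho z - vclip z0 rho w| <= `|z - w|.
Proof.
apply: rV_norm_le => // i; rewrite !mxE opprD addrACA subrr add0r.
apply: le_trans (clip_dist _ _ _) _; rewrite opprB addrA subrK.
by have := rV_coord_le (z - w) i; rewrite !mxE.
Qed.

Lemma vclip_in N (z0 : 'rV[R]_N) rho z : 0 <= rho -> `|vclip z0 rho z - z0| <= rho.
Proof.
by move=> r0; apply: rV_norm_le => // i; rewrite !mxE addrC addKr clip_norm.
Qed.

Lemma vclip_id N (z0 : 'rV[R]_N) rho z : `|z - z0| <= rho -> vclip z0 rho z = z.
Proof.
move=> H; apply/rowP => i; rewrite mxE clip_id ?[_ + (_ - _)]addrC ?subrK //.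
by apply: le_trans H; have := rV_coord_le (z - z0) i; rewrite !mxE.
Qed.

(* Near an equilibrium the solutions exist up to time 1: clipping the field to a
   box makes it globally Lipschitz, and the solutions do not leave the box. *)
Lemma local_flow N (F : 'rV[R]_N -> 'rV[R]_N) (z0 : 'rV[R]_N) (rho : R) :
  (forall u, vsmooth_at F u) -> F z0 = 0 -> 0 < rho ->
  exists (U : set 'rV[R]_N) (phi : 'rV[R]_N -> R -> 'rV[R]_N),
    [/\ open U, U z0, flow_family F U phi & forall z, U z ->
    exists2 e : R, 0 < e & forall t : R, - e < t < 1 + e ->
      `|phi z t - z0| < rho /\ is_derive t (1 : R) (phi z) (F (phi z t))].
Proof.
move=> sF F0 r0; have r0' := ltW r0; have [L L0 HL] := vlipschitz_ball z0 r0' sF.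
pose f (t : R) z := F (vclip z0 rho z).
have f_lip t x y : `|f t x - f t y| <= L * `|x - y|.
  apply: le_trans (HL _ _ (vclip_in _ _ r0') (vclip_in _ _ r0')) _.
  by rewrite ler_wpM2l // vclip_dist.
have f_cont (X : R -> 'rV[R]_N) : continuous X -> continuous (fun t => f t (X t)).
  move=> cX t; apply/continuous_normP => e e0.
  have L1 : 0 < L + 1 by rewrite ltr_wpDl.
  have [|r r1 Hr] := (continuous_normP _ _).1 (cX t) (e / (L + 1)).
    by rewrite divr_gt0.
  exists r => // s /Hr H; apply: le_lt_trans (f_lip t _ _) _.
  apply: le_lt_trans (_ : (L + 1) * `|X s - X t| < _).
    by rewrite ler_wpM2r // lerDl.
  by rewrite mulrC -ltr_pdivlMr.
have /choice[phi Hphi] := picard L0 (ltr0Sn _ 1) f_lip f_cont.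
(* Distances to the equilibrium grow at most by the factor [expR L] up to time 1, so a start within
   [A] keeps the solution where the clipped field equals [F]. *)
pose A := rho / expR L.
have A0 : 0 < A by rewrite divr_gt0 ?expR_gt0.
have D2 z (t : R) : 0 <= t <= 1 -> is_derive t (1 : R) (phi z) (f t (phi z t)).
  move=> /andP[t0 t1]; apply: (Hphi z).2.
  by rewrite ger0_norm // (le_lt_trans t1) // ltr1n.
pose U : set 'rV[R]_N := [set z | `|z - z0| < A].
have stay z t : U z -> 0 <= t <= 1 -> `|phi z t - z0| < rho.
  move=> Uz t01.
  have := @gronwall R N (fun s => phi z s - z0) (fun s => f s (phi z s)) 1 A L.
  have G1 (s : R) : 0 <= s <= 1 -> is_derive s (1 : R) (fun s => phi z s - z0) (f s (phi z s)).
    move=> s01; rewrite -[f s _]subr0.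
    apply: (@is_deriveB _ _ _ (phi z) (cst z0)); exact: D2.
  have G2 : `|phi z 0 - z0| < A by rewrite (Hphi z).1.
  have fz0 s : f s z0 = 0 by rewrite /f vclip_id // subrr normr0.
  have G3 s : 0 <= s <= 1 -> `|phi z s - z0| < A * expR (L * s) ->
      `|f s (phi z s)| <= L * A * expR (L * s).
    move=> _ H; rewrite -[f s _]subr0 -(fz0 s); apply: le_trans (f_lip _ _ _) _.
    by rewrite -mulrA ler_wpM2l // ltW.
  move=> /(_ G1 G2 G3 t t01) H; apply: lt_le_trans H _.
  rewrite /A mulrAC ler_pdivrMr ?expR_gt0 // ler_pM2l // ler_expR ler_piMr //.
  by case/andP: t01.
have fF z t : U z -> 0 <= t <= 1 -> f t (phi z t) = F (phi z t).
  by move=> Uz t01; rewrite /f vclip_id // ltW // stay.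
exists U, phi; split.
- have -> : U = ball z0 A.
    by apply/seteqP; split => x /=; rewrite -ball_normE/= distrC.
  exact: ball_open.
- by rewrite /U /= subrr normr0.
- move=> z Uz; split; first exact: (Hphi z).1.
  by move=> t t01; rewrite -fF //; exact: D2.
move=> z Uz.
(* Solutions stay in the open box slightly beyond both ends of [0, 1], which supplies the open time
   interval required of a geodesic in [exp_at]. *)
have c t : 0 <= t <= 1 -> exists2 e, 0 < e & forall s, `|s - t| < e -> `|phi z s - z0| < rho.
  move=> t01; have H : 0 < rho - `|phi z t - z0| by rewrite subr_gt0 stay.
  have [r rr0 Hr] := (continuous_normP _ _).1 (derivable_continuous (D2 z t t01)) _ H.
  exists r => // s /Hr; rewrite ltrBrDr; apply: le_lt_trans.
  by rewrite -{1}(subrKA (phi z t)) ler_normD.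
have [e1 e10 H1] : exists2 e, 0 < e & forall s, `|s - 0| < e -> `|phi z s - z0| < rho.
  by apply: c; rewrite lexx ler01.
have [e2 e20 H2] : exists2 e, 0 < e & forall s, `|s - 1| < e -> `|phi z s - z0| < rho.
  by apply: c; rewrite lexx ler01.
pose e := Num.min 1 (Num.min e1 e2).
have e0 : 0 < e by rewrite !lt_min ltr01 e10.
have [le1 [lee1 lee2]] : e <= 1 /\ e <= e1 /\ e <= e2.
  by rewrite !ge_min !lexx !orbT.
exists e => // t /andP[te1 te2].
have tr : `|phi z t - z0| < rho.
  have [t0|t0] := ltP t 0.
    by apply: H1; rewrite subr0 ltr0_norm //; lra.
  have [t1|t1] := leP t 1; first by apply: stay => //; rewrite t0.
  by apply: H2; rewrite gtr0_norm ?subr_gt0 //; lra.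
split => //; have -> : F (phi z t) = f t (phi z t) by rewrite /f vclip_id // ltW.
by apply: (Hphi z).2; rewrite ltr_norml; apply/andP; split; lra.
Qed.

End LocalFlows.

(** * Charts and smooth maps *)

Lemma near_continuous {T U : topologicalType} (phi : T -> U) a (P : U -> Prop) :
  {for a, continuous phi} -> (\forall y \near phi a, P y) -> \forall z \near a, P (phi z).
Proof. by move=> cphi; exact: cphi. Qed.

Section SmoothManifold.
Context {R : realType} {n : nat} {M : manifold R n}.
Local Notation E := 'rV[R]_n.
Implicit Types (c d : chart R n M) (x y : M) (f g : M -> R).

Definition cimg c : set E := cmap c @` cdom c.
Definition ccoord c (k : 'I_n) : M -> R := fun y => c y 0 k.

Lemma cimg_map c x : cdom c x -> cimg c (c x).
Proof. by move=> cx; exists x. Qed.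

Lemma cinvK c u : cimg c u -> cdom c (cinv c u) /\ c (cinv c u) = u.
Proof. by move=> [x cx <-]; rewrite cmapK. Qed.

Lemma near_cdom c x : cdom c x -> \forall y \near x, cdom c y.
Proof. by move=> cx; apply: open_nbhs_nbhs; split => //; exact: cdom_open. Qed.

Lemma near_cimg c x : cdom c x -> \forall u \near c x, cimg c u.
Proof.
move=> cx; apply: open_nbhs_nbhs; split; [exact: cimg_open|exact: cimg_map].
Qed.

Lemma near_chart c x (P : M -> Prop) : cdom c x ->
  (\forall y \near x, P y) -> \forall u \near c x, P (cinv c u).
Proof.
move=> cx Px; have := cinv_continuous (cimg_map cx).
by rewrite /prop_for /continuous_at (cmapK cx); apply.
Qed.

Lemma near_chartV c x (P : E -> Prop) : cdom c x ->
  (\forall u \near c x, P u) -> \forall y \near x, P (c y).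
Proof. by move=> cx Px; apply: (cmap_continuous cx). Qed.

Lemma exists_chart x : exists c, chart_at x c.
Proof. by have [c ac cx] := atlas_cover x; exists c. Qed.

Lemma chart_at_near c x : chart_at x c -> \forall y \near x, chart_at y c.
Proof. by move=> [ac cx]; apply: filterS (near_cdom cx) => y; split. Qed.

Lemma vsmooth_transition c d x : chart_at x c -> chart_at x d ->
  vsmooth_at (fun u => d (cinv c u)) (c x).
Proof. by move=> [ac cx] [ad dx] i; exact: (atlas_compatible ac ad cx dx). Qed.

Lemma smooth_fun_chart c f x : chart_at x c ->
  smooth_fun f x <-> smooth_at (f \o cinv c) (c x).
Proof.
move=> xc; split=> [[d xd sf]|sf]; last by exists c.
apply: (@smooth_at_ext _ _ (fun u => (f \o cinv d) (d (cinv c u)))).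
  have := near_chart xc.2 (near_cdom xd.2); apply: filterS => u du /=.
  by rewrite cmapK.
apply: smooth_at_comp; first by rewrite (cmapK xc.2).
exact: vsmooth_transition.
Qed.

Lemma smooth_fun_ext f g x : (\near x, f x = g x) -> smooth_fun f x -> smooth_fun g x.
Proof.
move=> fg [c xc sf]; exists c => //; apply: smooth_at_ext sf.
exact: near_chart xc.2 fg.
Qed.

Lemma smooth_fun_near f x : smooth_fun f x -> \forall y \near x, smooth_fun f y.
Proof.
move=> [c xc /smooth_at_near/(near_chartV xc.2) H].
by apply: filterS2 H (chart_at_near xc) => y sf yc; exists c.
Qed.

Lemma smooth_fun_continuous f x : smooth_fun f x -> {for x, continuous f}.
Proof.
move=> [c xc /smooth_at_continuous sf].
have H : (fun y => (f \o cinv c) (c y)) @ x --> (f \o cinv c) (c x).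
  by move=> A /sf; exact: (cmap_continuous xc.2).
rewrite /= (cmapK xc.2) in H.
apply: cvg_trans H; apply: near_eq_cvg.
by apply: filterS (near_cdom xc.2) => y cy /=; rewrite cmapK.
Qed.

Lemma smooth_fun_cst (a : R) x : smooth_fun (fun=> a) x.
Proof. by have [c xc] := exists_chart x; exists c => //; exact: smooth_at_cst. Qed.

Lemma smooth_funD f g x : smooth_fun f x -> smooth_fun g x -> smooth_fun (fun y => f y + g y) x.
Proof.
move=> [c xc sf] /(smooth_fun_chart _ xc) sg; exists c => //.
exact: smooth_atD sf sg.
Qed.

Lemma smooth_funM f g x : smooth_fun f x -> smooth_fun g x -> smooth_fun (fun y => f y * g y) x.
Proof.
move=> [c xc sf] /(smooth_fun_chart _ xc) sg; exists c => //.
exact: smooth_atM sf sg.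
Qed.

Lemma smooth_funN f x : smooth_fun f x -> smooth_fun (fun y => - f y) x.
Proof. by move=> [c xc sf]; exists c => //; exact: smooth_atN sf. Qed.

Lemma smooth_funB f g x : smooth_fun f x -> smooth_fun g x -> smooth_fun (fun y => f y - g y) x.
Proof. by move=> sf /smooth_funN; exact: smooth_funD. Qed.

Lemma smooth_fun_sum (I : Type) (r : seq I) (F : I -> M -> R) x :
  (forall i, smooth_fun (F i) x) -> smooth_fun (fun y => \sum_(i <- r) F i y) x.
Proof.
move=> H; elim: r => [|i r IH].
  by under eq_fun do rewrite big_nil; exact: smooth_fun_cst.
by under eq_fun do rewrite big_cons; exact: smooth_funD.
Qed.

Lemma smooth_fun_of_chart c x (h : E -> R) : chart_at x c -> smooth_at h (c x) ->
  smooth_fun (fun y => h (c y)) x.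
Proof.
move=> xc sh; exists c => //; apply: smooth_at_ext sh.
by apply: filterS (near_cimg xc.2) => u /cinvK[_ /= ->].
Qed.

Lemma smooth_fun_coord c x k : chart_at x c -> smooth_fun (ccoord c k) x.
Proof. by move=> xc; apply: (smooth_fun_of_chart (h := fun u => u 0 k) xc); exact: smooth_at_coord. Qed.

Lemma derive_ccoord c x k v : chart_at x c -> 'D_v (ccoord c k \o cinv c) (c x) = v 0 k.
Proof.
move=> xc; rewrite -(derive_coord_proj (c x) v k); apply: near_eq_derive.
by apply: filterS (near_cimg xc.2) => u /cinvK[_ /= eu]; rewrite /ccoord eu.
Qed.

(** * Smooth curves and parametrizations, for a general normed source *)

Section SmoothIntoNormed.
Context {V : normedModType R}.
Implicit Type (phi : V -> M).

Lemma smooth_into_chart phi a c : smooth_into (@smooth_at R V) phi a ->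
  chart_at (phi a) c -> vsmooth_at (fun z => c (phi z)) a.
Proof.
move=> [cphi [d ad sd]] ac i.
apply: (@smooth_at_ext _ _ (fun z => (fun u => c (cinv d u) 0 i) (d (phi z)))).
  apply: filterS (near_continuous cphi (near_cdom ad.2)) => z dz.
  by rewrite cmapK.
apply: (@smooth_at_comp _ _ _ (fun u => c (cinv d u) 0 i) (fun z => d (phi z))).
  exact: vsmooth_transition ad ac i.
exact: sd.
Qed.

Lemma smooth_into_of_chart (h : V -> E) a x c : chart_at x c -> h a = c x -> vsmooth_at h a ->
  smooth_into (@smooth_at R V) (fun z => cinv c (h z)) a.
Proof.
move=> xc ha sh; have ea : cinv c (h a) = x by rewrite ha (cmapK xc.2).
have ch := vsmooth_at_continuous sh; split.
  apply: (continuous_comp ch); apply: cinv_continuous; rewrite ha; exact: cimg_map xc.2.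
exists c; first by rewrite ea.
move=> k; apply: smooth_at_ext (sh k).
have : \forall z \near a, cimg c (h z).
  by apply: ch; rewrite /= ha; exact: near_cimg xc.2.
by apply: filterS => z /cinvK[_ ->].
Qed.

Lemma smooth_into_ext phi psi a : (\near a, phi a = psi a) ->
  smooth_into (@smooth_at R V) phi a -> smooth_into (@smooth_at R V) psi a.
Proof.
move=> e [cphi [c ac sc]]; have ea := nbhs_singleton e; split.
  by rewrite /prop_for /continuous_at -ea; apply: cvg_trans (near_eq_cvg e) cphi.
exists c; first by rewrite -ea.
by move=> k; apply: smooth_at_ext (sc k); apply: filterS e => z ->.
Qed.

Lemma smooth_into_local phi a c : smooth_into (@smooth_at R V) phi a ->
  chart_at (phi a) c -> \near a, phi a = cinv c (c (phi a)).
Proof.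
move=> [cphi _] ac; apply: filterS (near_continuous cphi (near_cdom ac.2)) => z cz.
by rewrite cmapK.
Qed.

Lemma smooth_into_near phi a : smooth_into (@smooth_at R V) phi a ->
  \forall z \near a, smooth_into (@smooth_at R V) phi z.
Proof.
move=> sphi; have [cphi [c ac _]] := sphi.
have loc := near_join (smooth_into_local sphi ac).
have sc := vsmooth_at_near (smooth_into_chart sphi ac).
have dc := near_continuous cphi (near_cdom ac.2).
apply: filterS3 loc sc dc => z lz sz dz.
apply: (@smooth_into_ext (fun z => cinv c (c (phi z)))).
  by apply: filterS lz => w <-.
apply: (@smooth_into_of_chart (fun z => c (phi z)) z (phi z) c) => //.
by split => //; exact: ac.1.
Qed.

End SmoothIntoNormed.

Lemma smooth_map_comp (s : M -> M) x f : smooth_map s x -> smooth_fun f (s x) ->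
  smooth_fun (fun y => f (s y)) x.
Proof.
move=> [cs [d ad sd]] sf; have [c xc] := exists_chart x; exists c => //.
have /(smooth_fun_chart _ ad) sfd := sf.
apply: (@smooth_at_ext _ _ (fun u => (f \o cinv d) (d (s (cinv c u))))).
  apply: (near_chart xc.2 (P := fun y => (f \o cinv d) (d (s y)) = f (s y))).
  apply: filterS (near_continuous cs (near_cdom ad.2)) => y dy /=.
  by rewrite cmapK.
apply: (@smooth_at_comp _ _ _ (f \o cinv d) (fun u => d (s (cinv c u)))).
  by rewrite (cmapK xc.2).
by move=> i; have := sd i; rewrite (smooth_fun_chart _ xc).
Qed.

Lemma smooth_map_chart (s : M -> M) x c d : smooth_map s x -> chart_at x c ->
  chart_at (s x) d -> vsmooth_at (fun u => d (s (cinv c u))) (c x).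
Proof.
move=> ss xc sd i; have := smooth_map_comp ss (smooth_fun_coord i sd).
by rewrite (smooth_fun_chart _ xc).
Qed.

Lemma smooth_map_of_charts (s : M -> M) x d : {for x, continuous s} ->
  chart_at (s x) d -> (forall k, smooth_fun (fun y => d (s y) 0 k) x) -> smooth_map s x.
Proof. by move=> cs sd H; split => //; exists d. Qed.

End SmoothManifold.

(** * Tangent vectors and fields *)

Section TangentVectors.
Context {R : realType} {n : nat} {M : manifold R n}.
Local Notation E := 'rV[R]_n.
Implicit Types (c d : chart R n M) (x y : M) (f g : M -> R) (v w : @tvec R n M).

Definition vco c v : E := \row_k v (ccoord c k).

Lemma coord_tvec_smooth c x u f : smooth_fun f x ->
  coord_tvec c x u f = 'D_u (f \o cinv c) (c x).
Proof. by move=> sf; rewrite /coord_tvec; case: asboolP. Qed.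

Lemma coord_tvec_nsmooth c x u f : ~ smooth_fun f x -> coord_tvec c x u f = 0.
Proof. by move=> sf; rewrite /coord_tvec; case: asboolP. Qed.

Lemma coord_tvec_coord c x u k : chart_at x c -> coord_tvec c x u (ccoord c k) = u 0 k.
Proof.
by move=> xc; rewrite coord_tvec_smooth ?derive_ccoord //; exact: smooth_fun_coord.
Qed.

Lemma vco_coord c x u : chart_at x c -> vco c (coord_tvec c x u) = u.
Proof. by move=> xc; apply/rowP => k; rewrite mxE coord_tvec_coord. Qed.

Lemma coord_tvec_sum c x u f : chart_at x c -> smooth_fun f x ->
  coord_tvec c x u f = \sum_k u 0 k * 'D_(delta_mx 0 k) (f \o cinv c) (c x).
Proof.
move=> xc sf; rewrite coord_tvec_smooth // derive_coords //.
exact/smooth_fun_chart.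
Qed.

Lemma coord_tvecD c x u u' f : chart_at x c ->
  coord_tvec c x (u + u') f = coord_tvec c x u f + coord_tvec c x u' f.
Proof.
move=> xc; have [sf|nf] := pselect (smooth_fun f x); last first.
  by rewrite !coord_tvec_nsmooth // addr0.
by rewrite !coord_tvec_smooth // derive_dirD //; exact/smooth_fun_chart.
Qed.

Lemma coord_tvecZ c x (a : R) u f : chart_at x c ->
  coord_tvec c x (a *: u) f = a * coord_tvec c x u f.
Proof.
move=> xc; have [sf|nf] := pselect (smooth_fun f x); last first.
  by rewrite !coord_tvec_nsmooth // mulr0.
by rewrite !coord_tvec_smooth // derive_scale_dir //; exact/smooth_fun_chart.
Qed.

Lemma coord_tvec0 c x f : chart_at x c -> coord_tvec c x 0 f = 0.
Proof. by move=> xc; rewrite -[0 in LHS](scale0r (0 : E)) coord_tvecZ // mul0r. Qed.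

Lemma velocity_coord (g : R -> M) t c : smooth_curve g t -> chart_at (g t) c ->
  velocity g t = coord_tvec c (g t) (\row_k 'D_1 (fun r => c (g r) 0 k) t).
Proof.
move=> sg xc; apply/funext => f; rewrite /velocity; case: asboolP => sf; last first.
  by rewrite coord_tvec_nsmooth.
have /(smooth_fun_chart _ xc) sfc := sf.
rewrite coord_tvec_sum //; under eq_bigr do rewrite mxE.
rewrite -(derive_comp_sum (g := fun r => c (g r)) 1 sfc (smooth_into_chart sg xc)).
apply: near_eq_derive.
by apply: filterS (smooth_into_local sg xc) => r /= <-.
Qed.

Lemma tangent_coord_tvec c x u : chart_at x c -> tangent x (coord_tvec c x u).
Proof.
move=> xc; pose h (t : R) : E := c x + t *: u.
have h0 : h 0 = c x by rewrite /h scale0r addr0.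
have sh (t : R) : vsmooth_at h t.
  move=> i; apply: (@smooth_at_ext _ _ (fun t : R => c x 0 i + u 0 i * t)).
    by near=> s; rewrite !mxE mulrC.
  exact: smooth_at_affine.
have sg : smooth_curve (fun t => cinv c (h t)) 0.
  exact: (smooth_into_of_chart (V := R) xc h0 (sh 0)).
have g0 : cinv c (h 0) = x by rewrite h0 (cmapK xc.2).
exists (fun t => cinv c (h t)); split => //.
have xc' : chart_at (cinv c (h 0)) c by rewrite g0.
rewrite (velocity_coord sg xc') g0; congr (coord_tvec c x _).
apply/rowP => k; rewrite mxE.
have ch : {for (0 : R), continuous h} := vsmooth_at_continuous (sh 0).
have nh : \forall r \near (0 : R), cimg c (h r).
  by apply: (near_continuous ch); rewrite h0; exact: near_cimg xc.2.
have -> : 'D_1 (fun r => c (cinv c (h r)) 0 k) 0 = 'D_1 (fun r : R => cst (c x 0 k) r + u 0 k * r) 0.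
  by apply: near_eq_derive; apply: filterS nh => r /cinvK[_ ->]; rewrite !mxE mulrC.
rewrite derive_add; [|exact: smooth_at_cst|].
  by rewrite derive_cst add0r derive_scl ?derive_id ?mulr1 //; exact: smooth_at_id.
by apply: (@smooth_atM _ _ (cst _)); [exact: smooth_at_cst|exact: smooth_at_id].
Unshelve. all: by end_near. Qed.

(** By the chain rule a velocity depends only on the derivatives of the coordinates of the curve, so
    its values on the coordinate functions determine it. *)
Lemma tangentE c x v : chart_at x c -> tangent x v -> v = coord_tvec c x (vco c v).
Proof.
move=> xc [g [sg g0 vg]]; have xc' : chart_at (g 0) c by rewrite g0.
have E1 := velocity_coord sg xc'; rewrite vg E1 g0 vco_coord //.
Qed.

Lemma tangent_nsmooth x v f : tangent x v -> ~ smooth_fun f x -> v f = 0.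
Proof.
move=> tv nf; have [c xc] := exists_chart x.
by rewrite (tangentE xc tv) coord_tvec_nsmooth.
Qed.

Lemma tangent_sum c x v f : chart_at x c -> tangent x v -> smooth_fun f x ->
  v f = \sum_k v (ccoord c k) * 'D_(delta_mx 0 k) (f \o cinv c) (c x).
Proof.
move=> xc tv sf; rewrite {1}(tangentE xc tv) coord_tvec_sum //.
by apply: eq_bigr => k _; rewrite mxE.
Qed.

Lemma tangent_eq c x v w : chart_at x c -> tangent x v -> tangent x w ->
  (forall k, v (ccoord c k) = w (ccoord c k)) -> v = w.
Proof.
move=> xc tv tw vw; rewrite (tangentE xc tv) (tangentE xc tw).
by congr (coord_tvec c x _); apply/rowP => k; rewrite !mxE.
Qed.

Lemma tangentD x v w : tangent x v -> tangent x w -> tangent x (fun f => v f + w f).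
Proof.
move=> tv tw; have [c xc] := exists_chart x.
have -> : (fun f => v f + w f) = coord_tvec c x (vco c v + vco c w).
  by apply/funext => f; rewrite coord_tvecD // -!tangentE.
exact: tangent_coord_tvec.
Qed.

Lemma tangentZ x (a : R) v : tangent x v -> tangent x (fun f => a * v f).
Proof.
move=> tv; have [c xc] := exists_chart x.
have -> : (fun f => a * v f) = coord_tvec c x (a *: vco c v).
  by apply/funext => f; rewrite coord_tvecZ // -!tangentE.
exact: tangent_coord_tvec.
Qed.

Lemma tangent0 x : tangent x (fun=> 0).
Proof.
have [c xc] := exists_chart x.
have -> : (fun=> 0) = coord_tvec c x 0 by apply/funext => f; rewrite coord_tvec0.
exact: tangent_coord_tvec.
Qed.

(** Non-smooth functions are included: smoothness at [x] depends on the germ, and tangent vectors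
    vanish on functions that are not smooth. *)
Lemma tangent_near x v f g : tangent x v -> (\near x, f x = g x) -> v f = v g.
Proof.
move=> tv fg; have [c xc] := exists_chart x.
have [sf|nf] := pselect (smooth_fun f x).
  have sg := smooth_fun_ext fg sf.
  rewrite (tangent_sum xc tv sf) (tangent_sum xc tv sg); apply: eq_bigr => k _.
  by congr (_ * _); apply: near_eq_derive; exact: near_chart xc.2 fg.
rewrite (tangent_nsmooth tv nf) (tangent_nsmooth tv) //.
move=> sg; apply: nf; apply: smooth_fun_ext sg.
by apply: filterS fg => y ->.
Qed.

Lemma tangent_D x v f g : tangent x v -> smooth_fun f x -> smooth_fun g x ->
  v (fun y => f y + g y) = v f + v g.
Proof.
move=> tv sf sg; have [c xc] := exists_chart x.
have /(smooth_fun_chart _ xc) sf' := sf; have /(smooth_fun_chart _ xc) sg' := sg.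
rewrite !(tangent_sum xc tv) // -?big_split/=; last exact: smooth_funD.
by apply: eq_bigr => k _; rewrite -mulrDr; congr (_ * _); exact: derive_add.
Qed.

Lemma tangent_M x v f g : tangent x v -> smooth_fun f x -> smooth_fun g x ->
  v (fun y => f y * g y) = f x * v g + g x * v f.
Proof.
move=> tv sf sg; have [c xc] := exists_chart x.
have /(smooth_fun_chart _ xc) sf' := sf; have /(smooth_fun_chart _ xc) sg' := sg.
rewrite !(tangent_sum xc tv) //; last exact: smooth_funM.
rewrite !mulr_sumr -big_split/=; apply: eq_bigr => k _.
have := derive_mul (delta_mx 0 k) sf' sg'; rewrite /= (cmapK xc.2) => H.
rewrite [X in _ * X](_ : _ = 'D_(delta_mx 0 k) (fun u => f (cinv c u) * g (cinv c u)) (c x)) //.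
rewrite H; move: ('D_(delta_mx 0 k) (f \o cinv c) (c x)) ('D_(delta_mx 0 k) (g \o cinv c) (c x)) => p q.
by ring.
Qed.

Lemma tangent_cst x v (a : R) : tangent x v -> v (fun=> a) = 0.
Proof.
move=> tv; have [c xc] := exists_chart x.
rewrite (tangent_sum xc tv); last exact: smooth_fun_cst.
by apply: big1 => k _; rewrite (_ : _ \o _ = cst a) // derive_cst mulr0.
Qed.

Lemma tangent_bigsum x v (I : Type) (r : seq I) (F : I -> M -> R) : tangent x v ->
  (forall i, smooth_fun (F i) x) -> v (fun y => \sum_(i <- r) F i y) = \sum_(i <- r) v (F i).
Proof.
move=> tv sF; elim: r => [|i r IH].
  by under eq_fun do rewrite big_nil; rewrite big_nil; exact: (tangent_cst 0 tv).
under eq_fun do rewrite big_cons; rewrite big_cons -IH.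
exact: (tangent_D tv (sF i) (smooth_fun_sum r sF)).
Qed.

End TangentVectors.

(** * Smooth fields and their extension by bump functions *)

Section SmoothFields.
Context {R : realType} {n : nat} {M : manifold R n}.
Local Notation E := 'rV[R]_n.
Implicit Types (c d : chart R n M) (x y : M) (f g : M -> R) (X Y : @field R n M).

Definition fco X c (k : 'I_n) : M -> R := fun y => X y (ccoord c k).

Lemma field_tangent X x : smooth_field X -> tangent x (X x).
Proof. by move=> /(_ x)[]. Qed.

Lemma field_smooth X x f : smooth_field X -> smooth_fun f x -> smooth_fun (fun y => X y f) x.
Proof. by move=> /(_ x)[_]; exact. Qed.

Lemma smooth_fco X c x k : smooth_field X -> chart_at x c -> smooth_fun (fco X c k) x.
Proof. by move=> sX xc; apply: field_smooth => //; exact: smooth_fun_coord. Qed.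

Lemma field_sum X c x f : smooth_field X -> chart_at x c -> smooth_fun f x ->
  X x f = \sum_k fco X c k x * 'D_(delta_mx 0 k) (f \o cinv c) (c x).
Proof. by move=> sX xc sf; apply: tangent_sum => //; exact: field_tangent. Qed.

Lemma smooth_fun_partial c x f v : chart_at x c -> smooth_fun f x ->
  smooth_fun (fun y => 'D_v (f \o cinv c) (c y)) x.
Proof.
move=> xc sf; apply: (smooth_fun_of_chart (h := 'D_v (f \o cinv c)) xc).
by apply: smooth_at_derive; exact/smooth_fun_chart.
Qed.

Lemma smooth_field_local X : (forall x, exists c (w : M -> E), [/\ chart_at x c,
    forall k, smooth_fun (fun y => w y 0 k) x & \near x, X x = coord_tvec c x (w x)]) ->
  smooth_field X.
Proof.
move=> H x; have [c [w [xc sw Xw]]] := H x; split.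
  by rewrite (nbhs_singleton Xw); exact: tangent_coord_tvec.
move=> f sf; apply: (@smooth_fun_ext _ _ _ (fun y => \sum_k w y 0 k * 'D_(delta_mx 0 k) (f \o cinv c) (c y))).
  apply: filterS3 Xw (chart_at_near xc) (smooth_fun_near sf) => y -> yc sfy.
  by rewrite coord_tvec_sum.
apply: smooth_fun_sum => k; apply: smooth_funM; first exact: sw.
exact: smooth_fun_partial.
Qed.

Lemma smooth_addf X Y : smooth_field X -> smooth_field Y -> smooth_field (addf X Y).
Proof.
move=> sX sY x; split; first by apply: tangentD; exact: field_tangent.
by move=> f sf; apply: smooth_funD; exact: field_smooth.
Qed.

Lemma smooth_scalef g X : (forall x, smooth_fun g x) -> smooth_field X ->
  smooth_field (scalef g X).
Proof.
move=> sg sX x; split; first by apply: tangentZ; exact: field_tangent.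
by move=> f sf; apply: smooth_funM => //; exact: field_smooth.
Qed.

Definition zerof : @field R n M := fun _ _ => 0.

Definition sumf (I : Type) (r : seq I) (F : I -> @field R n M) : @field R n M :=
  fun x f => \sum_(i <- r) F i x f.

Lemma sumf_nil (I : Type) (F : I -> field) : sumf [::] F = zerof.
Proof. by apply/funext => x; apply/funext => f; rewrite /sumf big_nil. Qed.

Lemma sumf_cons (I : Type) (r : seq I) i (F : I -> field) :
  sumf (i :: r) F = addf (F i) (sumf r F).
Proof. by apply/funext => x; apply/funext => f; rewrite /sumf big_cons. Qed.

Lemma smooth_zerof : smooth_field zerof.
Proof. by move=> x; split; [exact: tangent0|move=> f _; exact: smooth_fun_cst]. Qed.

Lemma smooth_sumf (I : Type) (r : seq I) (F : I -> field) :
  (forall i, smooth_field (F i)) -> smooth_field (sumf r F).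
Proof.
move=> sF; elim: r => [|i r IH]; first by rewrite sumf_nil; exact: smooth_zerof.
by rewrite sumf_cons; exact: smooth_addf.
Qed.

(* The second alternative lets one extend by zero functions defined on [O] only. *)
Lemma manifold_bump c x (O : set M) : chart_at x c -> open O -> O x ->
  exists b : M -> R, [/\ forall y, smooth_fun b y, \near x, b x = 1
    & forall y, (O y /\ chart_at y c) \/ (\near y, b y = 0)].
Proof.
move=> xc oO Ox; have nO : \forall y \near x, O y /\ chart_at y c.
  by apply: filterI; [exact: open_nbhs_nbhs|exact: chart_at_near].
have /near_normP[r r0 Hr] : \forall u \near c x, cimg c u /\ O (cinv c u) /\ chart_at (cinv c u) c.
  apply: filterI; first exact: near_cimg xc.2.
  exact: (near_chart xc.2 (P := fun y => O y /\ chart_at y c)).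
have r2 : 0 < r / 2 by rewrite divr_gt0.
have r2r : r / 2 < r by rewrite ltr_pdivrMr // ltr_pMr // ltr1n.
have [b [sb b1 b0]] := bump_exists (c x) r2.
pose beta y := if `[< cdom c y >] then b (c y) else 0.
have betaE y : cdom c y -> beta y = b (c y) by move=> cy; rewrite /beta asboolT.
(* Compactness of [K] and the Hausdorff property make [K] closed in [M], so [beta] vanishes near
   every point off [K], including boundary points of the chart domain. *)
pose K : set M := cinv c @` [set u | `|u - c x| <= r / 2].
have cK : compact K.
  apply: continuous_compact; last exact: closed_ball_compact.
  apply: continuous_in_subspaceT => u; rewrite inE /= => ur.
  apply: cinv_continuous; exact: (Hr u (le_lt_trans ur r2r)).1.
have clK : closed K by apply: compact_closed => //; exact: manifold_hausdorff.
have K0 y : ~ K y -> \near y, beta y = 0.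
  move=> nKy; have : \forall z \near y, ~ K z.
    apply: open_nbhs_nbhs; split => //; exact: closed_openC.
  apply: filterS => z nKz; rewrite /beta; case: asboolP => // cz.
  apply: b0; rewrite leNgt; apply/negP => zr; apply: nKz.
  by exists (c z); rewrite /= ?ltW // cmapK.
have KO y : K y -> O y /\ chart_at y c.
  by move=> [u ur <-]; have [_] := Hr u (le_lt_trans ur r2r).
have betac y : chart_at y c -> smooth_fun beta y.
  move=> yc; apply: (@smooth_fun_ext _ _ _ (fun z => b (c z))).
    by apply: filterS (near_cdom yc.2) => z /betaE.
  exact: smooth_fun_of_chart yc (sb _).
exists beta; split.
- move=> y; have [/KO[_]|/K0 b0y] := pselect (K y); first exact: betac.
  apply: (@smooth_fun_ext _ _ _ (fun=> 0)); last exact: smooth_fun_cst.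
  by apply: filterS b0y => z ->.
- have : \forall u \near c x, `|u - c x| < r / 2 / 2.
    by apply: (near_normP (c x) _).2; exists (r / 2 / 2) => //; rewrite divr_gt0.
  move=> /(near_chartV xc.2); apply: filterS2 (near_cdom xc.2) => y cy H.
  by rewrite betaE // b1 // ltW.
- by move=> y; have [/KO|/K0] := pselect (K y); [left|right].
Qed.

(** Connections act on global fields only, so coordinate fields have to be extended. *)
Lemma coord_field_exists c x u : chart_at x c -> exists2 X : field, smooth_field X &
  \forall y \near x, X y = coord_tvec c y u.
Proof.
move=> xc; have [b [sb b1 bO]] := manifold_bump xc (cdom_open c) xc.2.
exists (scalef b (fun y => coord_tvec c y u)); last first.
  by apply: filterS b1 => y b1; apply/funext => f; rewrite /scalef b1 mul1r.
apply: smooth_field_local => y; have [[_ yc]|b0] := bO y.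
  exists c, (fun z => b z *: u); split => //.
    move=> k; under eq_fun do rewrite mxE; apply: smooth_funM => //.
    exact: smooth_fun_cst.
  by apply: filterS (chart_at_near yc) => z zc; apply/funext => f; rewrite coord_tvecZ.
have [d yd] := exists_chart y; exists d, (fun=> 0); split => //.
  by move=> k; under eq_fun do rewrite mxE; exact: smooth_fun_cst.
apply: filterS2 (chart_at_near yd) b0 => z zd bz; apply/funext => f.
by rewrite coord_tvec0 // /scalef bz mul0r.
Qed.

End SmoothFields.

(** * Connections in coordinates *)

Section Connections.
Context {R : realType} {n : nat} {M : manifold R n}.
Local Notation E := 'rV[R]_n.
Implicit Types (c d : chart R n M) (x y : M) (f g : M -> R) (X Y Z : @field R n M).

Lemma coord_tvec_delta c x u f : chart_at x c ->
  coord_tvec c x u f = \sum_i u 0 i * coord_tvec c x (delta_mx 0 i) f.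
Proof.
move=> xc; have [sf|nf] := pselect (smooth_fun f x); last first.
  by rewrite coord_tvec_nsmooth // big1 // => i _; rewrite coord_tvec_nsmooth // mulr0.
by rewrite coord_tvec_sum //; apply: eq_bigr => i _; rewrite coord_tvec_smooth.
Qed.

Lemma partial_coord c x f v w : chart_at x c -> smooth_fun f x ->
  coord_tvec c x v (fun y => 'D_w (f \o cinv c) (c y)) = 'D_v ('D_w (f \o cinv c)) (c x).
Proof.
move=> xc sf; rewrite coord_tvec_smooth; last exact: smooth_fun_partial.
apply: near_eq_derive; apply: filterS (near_cimg xc.2) => u /cinvK[_ /= eu].
by rewrite eu.
Qed.

Definition frame_at c x (B : 'I_n -> field) := (forall i, smooth_field (B i)) /\
  \forall y \near x, forall i, B i y = coord_tvec c y (delta_mx 0 i).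

Lemma frame_exists c x : chart_at x c -> exists B, frame_at c x B.
Proof.
move=> xc; have /choice[B HB] : forall i : 'I_n, exists X : field, smooth_field X /\
    \forall y \near x, X y = coord_tvec c y (delta_mx 0 i).
  by move=> i; have [X sX HX] := coord_field_exists (delta_mx 0 i) xc; exists X.
exists B; split; first by move=> i; exact: (HB i).1.
by apply: (@near_forall_ord _ x 'I_n (fun i y => B i y = coord_tvec c y (delta_mx 0 i))) => i; exact: (HB i).2.
Qed.

Lemma frame_near c x B : frame_at c x B -> \forall y \near x, frame_at c y B.
Proof. by move=> [sB /near_join HB]; apply: filterS HB => y By; split. Qed.

Lemma frame_self c x B : frame_at c x B -> forall i, B i x = coord_tvec c x (delta_mx 0 i).
Proof. by move=> [_ /nbhs_singleton]. Qed.

Lemma frame_coord c x B i j : chart_at x c -> frame_at c x B ->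
  \forall y \near x, B i y (ccoord c j) = (i == j)%:R.
Proof.
move=> xc [_ HB]; apply: filterS2 HB (chart_at_near xc) => y -> yc.
by rewrite coord_tvec_coord // !mxE eqxx eq_sym.
Qed.

Lemma field_frame X c x B f : chart_at x c -> frame_at c x B -> smooth_field X ->
  X x f = \sum_i fco X c i x * B i x f.
Proof.
move=> xc fB sX; rewrite {1}(tangentE xc (field_tangent x sX)) coord_tvec_delta //.
by apply: eq_bigr => i _; rewrite mxE (frame_self fB).
Qed.

Variable nabla : @field R n M -> @field R n M -> @field R n M.
Hypothesis nablaP : affine_connection nabla.

Lemma nabla_smooth X Y : smooth_field X -> smooth_field Y -> smooth_field (nabla X Y).
Proof. by case: nablaP => H _ _ _ _; exact: H. Qed.

Lemma nabla_scale0 X : scalef (fun=> 0) X = zerof.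
Proof. by apply/funext => x; apply/funext => f; rewrite /scalef mul0r. Qed.

Lemma nabla0l Y : smooth_field Y -> nabla zerof Y = zerof.
Proof.
move=> sY; case: nablaP => _ _ _ H _; rewrite -{1}(nabla_scale0 zerof) H //.
- exact: nabla_scale0.
- by move=> x; exact: smooth_fun_cst.
- exact: smooth_zerof.
Qed.

Lemma nabla0r X : smooth_field X -> nabla X zerof = zerof.
Proof.
move=> sX; case: nablaP => _ _ _ _ H; rewrite -{1}(nabla_scale0 zerof) H //.
- rewrite nabla_scale0; apply/funext => x; apply/funext => f.
  by rewrite /addf /scalef /zerof mulr0 addr0.
- by move=> x; exact: smooth_fun_cst.
- exact: smooth_zerof.
Qed.

Lemma nabla_suml (I : Type) (r : seq I) (F : I -> @field R n M) Y : (forall i, smooth_field (F i)) ->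
  smooth_field Y -> nabla (sumf r F) Y = sumf r (fun i => nabla (F i) Y).
Proof.
move=> sF sY; elim: r => [|i r IH]; first by rewrite !sumf_nil nabla0l.
rewrite !sumf_cons; case: nablaP => _ H _ _ _; rewrite H ?IH //.
exact: smooth_sumf.
Qed.

Lemma nabla_sumr (I : Type) (r : seq I) (F : I -> @field R n M) X : (forall i, smooth_field (F i)) ->
  smooth_field X -> nabla X (sumf r F) = sumf r (fun i => nabla X (F i)).
Proof.
move=> sF sX; elim: r => [|i r IH]; first by rewrite !sumf_nil nabla0r.
rewrite !sumf_cons; case: nablaP => _ _ H _ _; rewrite H ?IH //.
exact: smooth_sumf.
Qed.

Lemma bump_fields X X' x : (\near x, X x = X' x) -> exists b : M -> R,
  [/\ forall y, smooth_fun b y, \near x, b x = 1 & scalef b X = scalef b X'].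
Proof.
rewrite -nbhs_nearE nbhsE => -[W [oW Wx] XX']; have [c xc] := exists_chart x.
have [b [sb b1 bO]] := manifold_bump xc oW Wx; exists b; split => //.
apply/funext => y; apply/funext => f; rewrite /scalef.
by have [[Wy _]|/nbhs_singleton ->] := bO y; [rewrite XX'|rewrite !mul0r].
Qed.

(** With [b = 1] near [x] and supported where the fields agree, [scalef b X = scalef b X'], and
    linearity over functions turns this into equality at [x]. *)
Lemma nabla_locall X X' Y x : smooth_field X -> smooth_field X' -> smooth_field Y ->
  (\near x, X x = X' x) -> nabla X Y x = nabla X' Y x.
Proof.
move=> sX sX' sY /bump_fields[b [sb /nbhs_singleton b1 bX]].
case: nablaP => _ _ _ H _.
have E1 Z : smooth_field Z -> nabla Z Y x = nabla (scalef b Z) Y x.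
  by move=> sZ; rewrite H //; apply/funext => f; rewrite /scalef b1 mul1r.
by rewrite (E1 X) // (E1 X') // bX.
Qed.

(** The same cut-off works: the extra Leibniz term [X x b] vanishes because [b] is constant near
    [x]. *)
Lemma nabla_localr X Y Y' x : smooth_field X -> smooth_field Y -> smooth_field Y' ->
  (\near x, Y x = Y' x) -> nabla X Y x = nabla X Y' x.
Proof.
move=> sX sY sY' /bump_fields[b [sb b1 bY]].
case: nablaP => _ _ _ _ H.
have Xb : X x b = 0.
  by rewrite (tangent_near (field_tangent x sX) b1); exact: tangent_cst (field_tangent x sX).
have E1 Z : smooth_field Z -> nabla X Z x = nabla X (scalef b Z) x.
  move=> sZ; rewrite H //; apply/funext => f.
  by rewrite /addf /scalef Xb mul0r add0r (nbhs_singleton b1) mul1r.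
by rewrite (E1 Y) // (E1 Y') // bY.
Qed.

(** The components of [X] are cut off to global functions, since the axioms of a connection admit no
    others as coefficients. *)
Lemma frame_expansion X c x B : chart_at x c -> frame_at c x B -> smooth_field X ->
  exists a : 'I_n -> M -> R, [/\ forall i y, smooth_fun (a i) y,
    forall i, \near x, a i x = fco X c i x
  & \near x, X x = sumf (index_enum _) (fun i => scalef (a i) (B i)) x].
Proof.
move=> xc fB sX; have [b [sb b1 bO]] := manifold_bump xc (cdom_open c) xc.2.
exists (fun i y => b y * fco X c i y); split.
- move=> i y; have [[_ yc]|b0] := bO y.
    by apply: smooth_funM => //; exact: smooth_fco.
  apply: (@smooth_fun_ext _ _ _ (fun=> 0)); last exact: smooth_fun_cst.
  by apply: filterS b0 => z ->; rewrite mul0r.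
- by move=> i; apply: filterS b1 => y ->; rewrite mul1r.
- apply: filterS3 b1 (chart_at_near xc) (frame_near fB) => y b1 yc fBy.
  apply/funext => f; rewrite (field_frame _ yc fBy sX) /sumf.
  by apply: eq_bigr => i _; rewrite /scalef b1 mul1r.
Qed.

(* Locality of the connection, obtained with bump functions, reduces it to its
   values on a local coordinate frame. *)
Lemma nabla_coord c x B X Y f : chart_at x c -> frame_at c x B ->
  smooth_field X -> smooth_field Y ->
  nabla X Y x f = \sum_j X x (fco Y c j) * B j x f +
    \sum_i \sum_j fco X c i x * fco Y c j x * nabla (B i) (B j) x f.
Proof.
move=> xc fB sX sY; have sB := fB.1.
have [a [sa aX Xa]] := frame_expansion xc fB sX.
have [b [sb bY Yb]] := frame_expansion xc fB sY.
have saB i : smooth_field (scalef (a i) (B i)) by exact: smooth_scalef.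
have sbB i : smooth_field (scalef (b i) (B i)) by exact: smooth_scalef.
rewrite (nabla_locall sX (smooth_sumf _ saB) sY Xa).
rewrite (nabla_localr (smooth_sumf _ saB) sY (smooth_sumf _ sbB) Yb).
rewrite (nabla_suml _ saB (smooth_sumf _ sbB)) /sumf.
under eq_bigr do rewrite (nabla_sumr _ sbB (saB _)) /sumf.
have [_ _ _ Hs HL] := nablaP.
have E1 i j : nabla (scalef (a i) (B i)) (scalef (b j) (B j)) x f =
    fco X c i x * B i x (fco Y c j) * B j x f + fco X c i x * fco Y c j x * nabla (B i) (B j) x f.
  rewrite Hs // HL // /scalef /addf (nbhs_singleton (aX i)) (nbhs_singleton (bY j)).
  rewrite (tangent_near (field_tangent x (sB i)) (bY j)).
  move: (fco _ _ _ _) (fco _ _ _ _) (B i x _) (B j x f) (nabla _ _ _ _) => p q r s t; ring.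
under eq_bigr do under eq_bigr do rewrite E1.
under eq_bigr do rewrite big_split/=.
rewrite big_split/=; congr (_ + _); rewrite exchange_big/=; apply: eq_bigr => j _.
by rewrite -mulr_suml (field_frame _ xc fB sX).
Qed.

(** The Hessian of [f] evaluated on [X] twice. It depends only on the value of [X] at [x] and equals
    the second derivative of [f] along a geodesic with velocity [X x], so it carries the geodesic
    equation from one chart to another. *)
Definition hess X f x := X x (fun y => X y f) - nabla X X x f.

(** The derivatives of the components of [X] occur in both terms of [hess] and cancel, which leaves
    an expression quadratic in [X x]. *)
Lemma hess_coord c x B X f : chart_at x c -> frame_at c x B -> smooth_field X -> smooth_fun f x ->
  hess X f x = \sum_i \sum_j fco X c i x * fco X c j x *
    ('D_(delta_mx 0 i) ('D_(delta_mx 0 j) (f \o cinv c)) (c x) - nabla (B i) (B j) x f).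
Proof.
move=> xc fB sX sf; have tX := field_tangent x sX.
pose D j y := 'D_(delta_mx 0 j) (f \o cinv c) (c y).
have sD j : smooth_fun (D j) x by exact: smooth_fun_partial.
have E1 : X x (fun y => X y f) = X x (fun y => \sum_j fco X c j y * D j y).
  apply: (tangent_near tX); apply: filterS2 (chart_at_near xc) (smooth_fun_near sf) => y yc sfy.
  exact: field_sum.
have BD j : B j x f = D j x by rewrite (frame_self fB) coord_tvec_smooth.
rewrite /hess E1 (tangent_bigsum _ tX); last first.
  by move=> j; apply: smooth_funM => //; exact: smooth_fco.
rewrite (nabla_coord f xc fB sX sX) opprD addrA.
have -> : \sum_i X x (fun y => fco X c i y * D i y) - \sum_j X x (fco X c j) * B j x f =
    \sum_i \sum_j fco X c i x * fco X c j x * 'D_(delta_mx 0 i) ('D_(delta_mx 0 j) (f \o cinv c)) (c x).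
  rewrite -sumrB exchange_big/=; apply: eq_bigr => j _.
  rewrite (tangent_M tX (smooth_fco j sX xc) (sD j)) BD [X x (fco X c j) * _]mulrC addrK.
  rewrite (field_frame _ xc fB sX) mulr_sumr; apply: eq_bigr => i _.
  by rewrite (frame_self fB) partial_coord // mulrCA mulrA.
rewrite -sumrB; apply: eq_bigr => i _; rewrite -sumrB; apply: eq_bigr => j _.
by rewrite mulrBr.
Qed.

Hypothesis torsion0 : forall X Y, smooth_field X -> smooth_field Y ->
    (fun x f => nabla X Y x f - nabla Y X x f) = bracket X Y.

(** Coordinate fields commute by the symmetry of second derivatives, so the absence of torsion gives
    the symmetry in [i] and [j]. *)
Lemma frame_symmetric c x B i j f : chart_at x c -> frame_at c x B ->
  nabla (B i) (B j) x f = nabla (B j) (B i) x f.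
Proof.
move=> xc fB; have sB := fB.1; apply/eqP; rewrite -subr_eq0; apply/eqP.
have /(congr1 (fun F : field => F x f)) /= -> := torsion0 (sB i) (sB j).
rewrite /bracket; case: asboolP => // sf.
have E1 k l : B k x (fun y => B l y f) = 'D_(delta_mx 0 k) ('D_(delta_mx 0 l) (f \o cinv c)) (c x).
  rewrite -(partial_coord _ _ xc sf) -(frame_self fB).
  apply: (tangent_near (field_tangent x (sB k))).
  by apply: filterS2 fB.2 (smooth_fun_near sf) => y -> sfy; rewrite coord_tvec_smooth.
by rewrite !E1 (smooth_at_sym _ _ ((smooth_fun_chart _ xc).1 sf)) subrr.
Qed.

End Connections.

(** * The connection of a symmetry jet *)

Section Symmetries.
Context {R : realType} {n : nat} {M : manifold R n}.
Local Notation E := 'rV[R]_n.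
Implicit Types (c d : chart R n M) (x y : M) (f g : M -> R) (X Y Z : @field R n M).
Implicit Types (s t : M -> M).

Lemma choose_inP (T : Type) (x0 : T) (P : set T) : (exists z : T, P z) -> P (choose_in x0 P).
Proof. by move=> H; rewrite /choose_in; case: pselect => // H'; case: cid. Qed.

Lemma linvP x s : local_diffeo x s -> local_inverse x s (linv x s).
Proof. exact: choose_inP. Qed.

Lemma local_inverse_near x s t : local_inverse x s t -> s x = x ->
  [/\ t x = x, smooth_map s x, smooth_map t x,
    \forall y \near x, smooth_map s y & \forall y \near x, s (t y) = y /\ smooth_map s (t y)].
Proof.
move=> [U [V [oU oV Ux HU HV]]] sx; have [Vx tx ssx] := HU x Ux; rewrite sx in Vx tx.
have [_ _ stx] := HV x Vx; split => //.
  have : \forall y \near x, U y by exact: open_nbhs_nbhs.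
  by apply: filterS => y Uy; have [] := HU y Uy.
have : \forall y \near x, V y by exact: open_nbhs_nbhs.
apply: filterS => y Vy; have [Uty sty _] := HV y Vy; split => //.
by have [] := HU _ Uty.
Qed.

Lemma tangent_comp z (v : tvec) s c f : tangent z v -> smooth_map s z ->
  chart_at (s z) c -> smooth_fun f (s z) ->
  v (f \o s) = \sum_k v (ccoord c k \o s) * 'D_(delta_mx 0 k) (f \o cinv c) (c (s z)).
Proof.
move=> tv ss szc sf; have [d zd] := exists_chart z.
have sfs : smooth_fun (f \o s) z := smooth_map_comp ss sf.
have scs k : smooth_fun (ccoord c k \o s) z := smooth_map_comp ss (smooth_fun_coord k szc).
rewrite (tangent_sum zd tv sfs).
under [RHS]eq_bigr do rewrite (tangent_sum zd tv (scs _)) mulr_suml.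
rewrite exchange_big/=; apply: eq_bigr => i _.
have ez : cinv d (d z) = z := cmapK zd.2.
have sfc : smooth_at (f \o cinv c) (c (s (cinv d (d z)))).
  by rewrite ez; exact/smooth_fun_chart.
have vs := smooth_map_chart ss zd szc.
have -> : 'D_(delta_mx 0 i) ((f \o s) \o cinv d) (d z) =
    'D_(delta_mx 0 i) (fun u => (f \o cinv c) (c (s (cinv d u)))) (d z).
  apply: near_eq_derive.
  apply: (near_chart zd.2 (P := fun y => (f \o s) y = (f \o cinv c) (c (s y)))).
  by apply: filterS (near_continuous ss.1 (near_cdom szc.2)) => y cy /=; rewrite cmapK.
rewrite (derive_comp_sum (g := fun u => c (s (cinv d u))) _ sfc vs) mulr_sumr.
by apply: eq_bigr => k _; rewrite mulrA ez.
Qed.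

(** Coordinate form of the condition on the differential in [symmetry_at]. *)
Definition flips x s := s x = x /\ forall c, chart_at x c -> forall v k,
  'D_v (in_charts c c s k) (c x) = - v 0 k.

Definition sym_jet x s := local_diffeo x s /\ flips x s.

Lemma smooth_in_charts x s c k : smooth_map s x -> s x = x -> chart_at x c ->
  smooth_at (in_charts c c s k) (c x).
Proof.
move=> ss sx xc; have xc' : chart_at (s x) c by rewrite sx.
exact: (smooth_map_chart ss xc xc').
Qed.

Lemma flips_tangent x s (v : tvec) f : smooth_map s x -> flips x s -> tangent x v ->
  smooth_fun f x -> v (f \o s) = - v f.
Proof.
move=> ss [sx Ds] tv sf; have [c xc] := exists_chart x.
have xc' : chart_at (s x) c by rewrite sx.
have sf' : smooth_fun f (s x) by rewrite sx.
rewrite (tangent_comp tv ss xc' sf') (tangent_sum xc tv sf) -sumrN.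
apply: eq_bigr => k _; rewrite sx -mulNr; congr (_ * _).
rewrite (tangentE xc tv) coord_tvec_smooth; last exact: smooth_map_comp ss (smooth_fun_coord k xc').
rewrite (_ : (ccoord c k \o s) \o cinv c = in_charts c c s k) // Ds //.
by rewrite coord_tvec_coord.
Qed.

(** Differentiating [s \o t = id] at the fixed point shows that minus the differential of [t] is the
    identity. *)
Lemma flips_inverse x s t : local_inverse x s t -> flips x s -> flips x t.
Proof.
move=> inv [sx Ds]; have [tx ss st _ near_st] := local_inverse_near inv sx.
split => // c xc v k.
have xc' : chart_at (s x) c by rewrite sx.
have xct : chart_at (t x) c by rewrite tx.
have tv := tangent_coord_tvec v xc.
have sk : smooth_fun (ccoord c k \o s) (t x).
  by rewrite tx; exact: smooth_map_comp ss (smooth_fun_coord k xc').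
have := tangent_comp tv st xct sk.
have -> : coord_tvec c x v ((ccoord c k \o s) \o t) = v 0 k.
  rewrite -(coord_tvec_coord v k xc); apply: (tangent_near tv).
  by apply: filterS near_st => y [/= -> _].
have Dt j : coord_tvec c x v (ccoord c j \o t) = 'D_v (in_charts c c t j) (c x).
  by rewrite coord_tvec_smooth //; exact: smooth_map_comp st (smooth_fun_coord j xct).
under eq_bigr do rewrite Dt tx (_ : (ccoord c k \o s) \o cinv c = in_charts c c s k) // Ds //.
rewrite (bigD1 k) //= big1 => [|j jk]; last by rewrite mxE eqxx /= eq_sym (negbTE jk) oppr0 mulr0.
by rewrite addr0 mxE !eqxx mulrN1 => ->; rewrite opprK.
Qed.

Definition sym_coord (sigma : M -> M -> M) X Y c x : E :=
  \row_k (X x (fco Y c k) - 2^-1 * \sum_i \sum_j fco X c i x * fco Y c j x *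
     'D_(delta_mx 0 i) ('D_(delta_mx 0 j) (in_charts c c (sigma x) k)) (c x)).

(** Near [x] the k-th component of [Y + s_* Y] is [fco Y c k + h k \o t], where [h k] is [Y] applied
    to the k-th coordinate of [s] and [t] inverts [s]. Only its derivative along [X] enters. *)
Lemma symmetry_formula_coord (sigma : M -> M -> M) X Y c x : sym_jet x (sigma x) ->
  smooth_field X -> smooth_field Y -> chart_at x c ->
  symmetry_formula sigma X Y x = coord_tvec c x (sym_coord sigma X Y c x).
Proof.
move=> [diff fl] sX sY xc; have [sx Ds] := fl.
have inv := linvP diff.
set s := sigma x in diff fl sx Ds inv *; set t := linv x s in inv *.
have [tx ss st near_s near_st] := local_inverse_near inv sx.
have flt := flips_inverse inv fl.
have tX := field_tangent x sX; have tY := field_tangent x sY.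
apply/funext => f; rewrite /symmetry_formula /bracket.
case: asboolP => [sf|nf]; last by rewrite coord_tvec_nsmooth // mulr0.
rewrite -/s.
have xcs : chart_at (s x) c by rewrite sx.
have xct : chart_at (t x) c by rewrite tx.
have scs k : smooth_fun (ccoord c k \o s) x := smooth_map_comp ss (smooth_fun_coord k xcs).
(* [s] acts as -1 on the tangent space, so [Y] and its push-forward cancel at [x]; one half of the
   bracket vanishes. *)
have -> : addf Y (push_field x s Y) x (fun y => X y f) = 0.
  rewrite /addf /push_field -/t tx.
  by rewrite (flips_tangent ss fl tY (field_smooth sX sf)) subrr.
rewrite subr0.
pose h k y := Y y (ccoord c k \o s).
have sh k : smooth_fun (h k) x by exact: field_smooth.
have sht k : smooth_fun (h k \o t) x by apply: smooth_map_comp => //; rewrite tx.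
pose D k y := 'D_(delta_mx 0 k) (f \o cinv c) (c y).
have sD k : smooth_fun (D k) x by exact: smooth_fun_partial.
have sY' k : smooth_fun (fco Y c k) x by exact: smooth_fco.
have E1 : X x (fun y => addf Y (push_field x s Y) y f) =
    X x (fun y => \sum_k (fco Y c k y + (h k \o t) y) * D k y).
  apply: (tangent_near tX).
  apply: filterS3 (chart_at_near xc) (smooth_fun_near sf) near_st => y yc sfy [sty ssty].
  rewrite /addf /push_field -/t (field_sum sY yc sfy).
  have yc' : chart_at (s (t y)) c by rewrite sty.
  have sfy' : smooth_fun f (s (t y)) by rewrite sty.
  rewrite (tangent_comp (field_tangent _ sY) ssty yc' sfy') sty -big_split/=.
  by apply: eq_bigr => k _; rewrite mulrDl.
rewrite E1 (tangent_bigsum _ tX); last first.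
  by move=> k; apply: smooth_funM => //; exact: smooth_funD.
rewrite coord_tvec_sum // mulr_sumr; apply: eq_bigr => k _.
rewrite (tangent_M tX (smooth_funD (sY' k) (sht k)) (sD k)).
rewrite /= tx {1}/h (flips_tangent ss fl tY (smooth_fun_coord k xc)).
rewrite -[Y x (ccoord c k)]/(fco Y c k x) subrr mul0r add0r.
rewrite -/(D k x) mulrCA [RHS]mulrC; congr (_ * _).
(* The inverse [t] contributes another sign, after which [h k] is differentiated as a sum of
   products. *)
rewrite (tangent_D tX (sY' k) (sht k)) (flips_tangent st flt tX (sh k)).
have sj j : smooth_fun (fun y => 'D_(delta_mx 0 j) ((ccoord c k \o s) \o cinv c) (c y)) x.
  exact: smooth_fun_partial.
have -> : X x (h k) = X x (fun y => \sum_j fco Y c j y *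
    'D_(delta_mx 0 j) ((ccoord c k \o s) \o cinv c) (c y)).
  apply: (tangent_near tX).
  apply: filterS2 (chart_at_near xc) (smooth_fun_near (scs k)) => y yc scy.
  exact: field_sum.
rewrite (tangent_bigsum _ tX); last by move=> j; exact: smooth_funM.
under eq_bigr do rewrite (tangent_M tX (sY' _) (sj _)).
rewrite big_split/= mxE.
(* The first derivatives of [s] are minus the identity, so with the sign from [t] this sum doubles
   [X x (fco Y c k)]; the factor 1/2 of the formula undoes the doubling. *)
have -> : \sum_i 'D_(delta_mx 0 i) ((ccoord c k \o s) \o cinv c) (c x) * X x (fco Y c i) =
    - X x (fco Y c k).
  rewrite (bigD1 k) //= big1 => [|j jk].
    by rewrite addr0 [X in X * _](Ds c xc) mxE !eqxx mulN1r.
  by rewrite [X in X * _](Ds c xc) mxE eqxx /= eq_sym (negbTE jk) oppr0 mul0r.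
have -> : \sum_i fco Y c i x * X x (fun y => 'D_(delta_mx 0 i) ((ccoord c k \o s) \o cinv c) (c y)) =
   \sum_i \sum_j fco X c i x * fco Y c j x *
     'D_(delta_mx 0 i) ('D_(delta_mx 0 j) (in_charts c c s k)) (c x).
  rewrite exchange_big/=; apply: eq_bigr => j _.
  rewrite {1}(tangentE xc tX) coord_tvec_delta // mulr_sumr; apply: eq_bigr => i _.
  rewrite (partial_coord _ _ xc (scs k)) mxE mulrA [fco Y c j x * _]mulrC //.
by rewrite -/s; move: (X x (fco Y c k)) (\sum_i _) => p q; field.
Qed.

(** The symmetry and the point of differentiation vary together. This is the only coordinate of the
    jet that the symmetry condition leaves free, so all smoothness of the jet lies in it. *)
Definition sym_hessian (sigma : M -> M -> M) c k i j : M -> R := fun y =>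
  'D_(delta_mx 0 i) ('D_(delta_mx 0 j) (in_charts c c (sigma y) k)) (c y).

Section SymmetryConnection.
Variable sigma : M -> M -> M.
Hypothesis sym : forall x, sym_jet x (sigma x).
Hypothesis smooth_hessian : forall c x, chart_at x c -> forall k i j,
  smooth_fun (sym_hessian sigma c k i j) x.

Let nabla := symmetry_formula sigma.

Lemma symmetry_connection_smooth X Y : smooth_field X -> smooth_field Y ->
  smooth_field (nabla X Y).
Proof.
move=> sX sY; apply: smooth_field_local => x; have [c xc] := exists_chart x.
exists c, (sym_coord sigma X Y c); split => //.
  move=> k; under eq_fun do rewrite mxE.
  apply: smooth_funB; first by apply: field_smooth => //; exact: smooth_fco.
  apply: smooth_funM; first exact: smooth_fun_cst.
  apply: smooth_fun_sum => i; apply: smooth_fun_sum => j.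
  apply: smooth_funM; last exact: (smooth_hessian xc k i j).
  by apply: smooth_funM; exact: smooth_fco.
by apply: filterS (chart_at_near xc) => y yc; exact: symmetry_formula_coord.
Qed.

Lemma big_lin2 (I : finType) (r p q h : I -> I -> R) (a b : R) :
  (forall i j, r i j = a * p i j + b * q i j) ->
  \sum_i \sum_j r i j * h i j = a * (\sum_i \sum_j p i j * h i j) + b * (\sum_i \sum_j q i j * h i j).
Proof.
move=> H; rewrite !mulr_sumr -big_split/=; apply: eq_bigr => i _.
rewrite !mulr_sumr -big_split/=; apply: eq_bigr => j _.
by rewrite H mulrDl !mulrA.
Qed.

(** In [sym_coord] the term [X x (fco Y c k)] carries the Leibniz rule and the Hessian term is
    bilinear over functions. The latter is symmetric, so antisymmetrizing in [X] and [Y] leaves the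
    coordinates of the bracket. *)
Theorem symmetry_connection : torsionless_connection nabla.
Proof.
have main X Y x c : smooth_field X -> smooth_field Y -> chart_at x c ->
  nabla X Y x = coord_tvec c x (sym_coord sigma X Y c x).
  by move=> sX sY xc; exact: symmetry_formula_coord.
have tan X x : smooth_field X -> tangent x (X x) by move=> sX; exact: field_tangent.
split; first split.
- exact: symmetry_connection_smooth.
- move=> X X' Y sX sX' sY; apply/funext => x; have [c xc] := exists_chart x.
  rewrite (main _ _ _ _ (smooth_addf sX sX') sY xc); apply/funext => f.
  rewrite /addf (main _ _ _ _ sX sY xc) (main _ _ _ _ sX' sY xc) -coord_tvecD //.
  congr (coord_tvec c x _ f); apply/rowP => k; rewrite !mxE.
  rewrite (@big_lin2 _ _ (fun i j => fco X c i x * fco Y c j x)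
    (fun i j => fco X' c i x * fco Y c j x) _ (1) (1)).
    by move: (X x _) (X' x _) (\sum_i _) (\sum_i _) => p q r t; ring.
  by move=> i j; rewrite !mul1r -mulrDl.
- move=> X Y Y' sX sY sY'; apply/funext => x; have [c xc] := exists_chart x.
  rewrite (main _ _ _ _ sX (smooth_addf sY sY') xc); apply/funext => f.
  rewrite /addf (main _ _ _ _ sX sY xc) (main _ _ _ _ sX sY' xc) -coord_tvecD //.
  congr (coord_tvec c x _ f); apply/rowP => k; rewrite !mxE.
  rewrite (@big_lin2 _ _ (fun i j => fco X c i x * fco Y c j x)
    (fun i j => fco X c i x * fco Y' c j x) _ (1) (1)).
    rewrite [X in X - _](_ : _ = X x (fun y => fco Y c k y + fco Y' c k y)) //.
    rewrite (tangent_D (tan X x sX) (smooth_fco k sY xc) (smooth_fco k sY' xc)).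
    by move: (X x _) (X x _) (\sum_i _) (\sum_i _) => p q r t; ring.
  by move=> i j; rewrite !mul1r -mulrDr.
- move=> g X Y sg sX sY; apply/funext => x; have [c xc] := exists_chart x.
  rewrite (main _ _ _ _ (smooth_scalef sg sX) sY xc); apply/funext => f.
  rewrite /scalef (main _ _ _ _ sX sY xc) -coord_tvecZ //.
  congr (coord_tvec c x _ f); apply/rowP => k; rewrite !mxE.
  rewrite (@big_lin2 _ _ (fun i j => fco X c i x * fco Y c j x)
    (fun i j => 0) _ (g x) (0)).
    by move: (X x _) (\sum_i _) (\sum_i _) => p r t; ring.
  by move=> i j; rewrite mul0r addr0 mulrA.
- move=> g X Y sg sX sY; apply/funext => x; have [c xc] := exists_chart x.
  rewrite (main _ _ _ _ sX (smooth_scalef sg sY) xc); apply/funext => f.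
  rewrite /addf /scalef (main _ _ _ _ sX sY xc).
  rewrite (tangentE xc (tan Y x sY)) -!coord_tvecZ // -coord_tvecD //.
  congr (coord_tvec c x _ f); apply/rowP => k; rewrite !mxE.
  rewrite (@big_lin2 _ _ (fun i j => fco X c i x * fco Y c j x)
    (fun i j => 0) _ (g x) (0)).
    rewrite [X in X - _](_ : _ = X x (fun y => g y * fco Y c k y)) //.
    rewrite (tangent_M (tan X x sX) (sg x) (smooth_fco k sY xc)) -/(fco Y c k x).
    by move: (X x _) (X x _) (fco Y c k x) (\sum_i _) (\sum_i _) => p q r t w; ring.
  by move=> i j; rewrite mul0r addr0 mulrCA.
- move=> X Y sX sY; apply/funext => x; have [c xc] := exists_chart x.
  apply/funext => f; rewrite (main _ _ _ _ sX sY xc) (main _ _ _ _ sY sX xc).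
  rewrite /bracket; case: asboolP => [sf|nf]; last by rewrite !coord_tvec_nsmooth // subr0.
  have XYf X' Y' : smooth_field X' -> smooth_field Y' -> X' x (fun y => Y' y f) =
      \sum_k X' x (fco Y' c k) * 'D_(delta_mx 0 k) (f \o cinv c) (c x) +
      \sum_i \sum_j fco X' c i x * fco Y' c j x * 'D_(delta_mx 0 i) ('D_(delta_mx 0 j) (f \o cinv c)) (c x).
    move=> sX' sY'; have tX' := tan X' x sX'.
    have sD k : smooth_fun (fun y => 'D_(delta_mx 0 k) (f \o cinv c) (c y)) x.
      exact: smooth_fun_partial.
    have -> : X' x (fun y => Y' y f) = X' x (fun y => \sum_k fco Y' c k y * 'D_(delta_mx 0 k) (f \o cinv c) (c y)).
      apply: (tangent_near tX').
      by apply: filterS2 (chart_at_near xc) (smooth_fun_near sf) => y yc sfy; exact: field_sum.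
    rewrite (tangent_bigsum _ tX'); last by move=> k; apply: smooth_funM => //; exact: smooth_fco.
    under eq_bigr do rewrite (tangent_M tX' (smooth_fco _ sY' xc) (sD _)).
    rewrite big_split/= addrC; congr (_ + _); first by apply: eq_bigr => k _; rewrite mulrC.
    rewrite exchange_big/=; apply: eq_bigr => j _.
    rewrite {1}(tangentE xc tX') coord_tvec_delta // mulr_sumr; apply: eq_bigr => i _.
    by rewrite (partial_coord _ _ xc sf) mxE mulrA [fco Y' c j x * _]mulrC.
  rewrite !coord_tvec_sum // (XYf X Y) // (XYf Y X) //.
  (* Exchanging the summation indices makes the second-order terms in [f] coincide; [sym_sum] does
     the same for those of the symmetry. *)
  have -> : \sum_i \sum_j fco Y c i x * fco X c j x * 'D_(delta_mx 0 i) ('D_(delta_mx 0 j) (f \o cinv c)) (c x) =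
      \sum_i \sum_j fco X c i x * fco Y c j x * 'D_(delta_mx 0 i) ('D_(delta_mx 0 j) (f \o cinv c)) (c x).
    rewrite exchange_big/=; apply: eq_bigr => i _; apply: eq_bigr => j _.
    by rewrite (smooth_at_sym _ _ ((smooth_fun_chart _ xc).1 sf)) [fco Y c j x * _]mulrC.
  have sym_sum k : \sum_i \sum_j fco Y c i x * fco X c j x *
      'D_(delta_mx 0 i) ('D_(delta_mx 0 j) (in_charts c c (sigma x) k)) (c x) =
      \sum_i \sum_j fco X c i x * fco Y c j x *
      'D_(delta_mx 0 i) ('D_(delta_mx 0 j) (in_charts c c (sigma x) k)) (c x).
    have [diff fl] := sym x; have [_ ss _ _ _] := local_inverse_near (linvP diff) fl.1.
    rewrite exchange_big/=; apply: eq_bigr => i _; apply: eq_bigr => j _.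
    by rewrite (smooth_at_sym _ _ (smooth_in_charts k ss fl.1 xc)) [fco Y c j x * _]mulrC.
  rewrite opprD addrACA subrr addr0 -!sumrB; apply: eq_bigr => k _.
  rewrite !mxE sym_sum -!mulrBl; congr (_ * _).
  by move: (X x _) (Y x _) (\sum_i _) => p q r; ring.
Qed.

End SymmetryConnection.
End Symmetries.

(** * Geodesics and the exponential map *)

Section Geodesics.
Context {R : realType} {n : nat} {M : manifold R n}.
Local Notation E := 'rV[R]_n.
Implicit Types (c d : chart R n M) (x y : M) (f : M -> R) (X Y V : @field R n M).
Implicit Types (g : R -> M).

Lemma second_derive_comp (W : normedModType R) m (f : 'rV[R]_m -> R) (h : W -> 'rV[R]_m) t v w :
  smooth_at f (h t) -> vsmooth_at h t ->
  'D_v ('D_w (fun r => f (h r))) t =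
  \sum_j 'D_v ('D_w (fun r => h r 0 j)) t * 'D_(delta_mx 0 j) f (h t) +
  \sum_i \sum_j 'D_v (fun r => h r 0 i) t * 'D_w (fun r => h r 0 j) t *
    'D_(delta_mx 0 i) ('D_(delta_mx 0 j) f) (h t).
Proof.
move=> sf sh; have ch := vsmooth_at_continuous sh.
have -> : 'D_v ('D_w (fun r => f (h r))) t =
    'D_v (fun r => \sum_j 'D_w (fun r => h r 0 j) r * 'D_(delta_mx 0 j) f (h r)) t.
  apply: near_eq_derive.
  apply: filterS2 (near_continuous ch (smooth_at_near sf)) (vsmooth_at_near sh) => r sfr shr.
  exact: derive_comp_sum.
have sD j : smooth_at (fun r => 'D_(delta_mx 0 j) f (h r)) t.
  by apply: (smooth_at_comp (f := 'D_(delta_mx 0 j) f)) => //; exact: smooth_at_derive.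
rewrite derive_bigsum; last first.
  by move=> j; apply: smooth_atM => //; apply: smooth_at_derive; exact: sh.
rewrite exchange_big -big_split/=; apply: eq_bigr => j _.
rewrite derive_mul //; last by apply: smooth_at_derive; exact: sh.
rewrite (derive_comp_sum (f := 'D_(delta_mx 0 j) f)) //; last exact: smooth_at_derive.
rewrite [LHS]addrC; congr (_ + _); first exact: mulrC.
rewrite mulr_sumr.
by apply: eq_bigr => i _; rewrite mulrA [X in X * _]mulrC.
Qed.

Lemma derive_curve g t c f v : smooth_curve g t -> chart_at (g t) c -> smooth_fun f (g t) ->
  'D_v (fun r => f (g r)) t = 'D_v (fun r => (f \o cinv c) (c (g r))) t.
Proof.
move=> sg gc sf; apply: near_eq_derive.
by apply: filterS (smooth_into_local sg gc) => r /= <-.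
Qed.

Lemma second_derive_chart g t c f : smooth_curve g t -> chart_at (g t) c -> smooth_fun f (g t) ->
  'D_1 ('D_1 (fun r => f (g r))) t =
  \sum_j 'D_1 ('D_1 (fun r => c (g r) 0 j)) t * 'D_(delta_mx 0 j) (f \o cinv c) (c (g t)) +
  \sum_i \sum_j 'D_1 (fun r => c (g r) 0 i) t * 'D_1 (fun r => c (g r) 0 j) t *
    'D_(delta_mx 0 i) ('D_(delta_mx 0 j) (f \o cinv c)) (c (g t)).
Proof.
move=> sg gc sf; have sfc := (smooth_fun_chart f gc).1 sf.
transitivity ('D_1 ('D_1 (fun r => (f \o cinv c) (c (g r)))) t); last first.
  exact: (second_derive_comp (h := fun r => c (g r)) 1 1 sfc (smooth_into_chart sg gc)).
apply: near_eq_derive; apply: filterS3 (near_continuous sg.1 (chart_at_near gc))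
  (near_continuous sg.1 (smooth_fun_near sf)) (smooth_into_near sg) => r gcr sfr sgr.
exact: derive_curve.
Qed.

Definition christoffel (nabla : field -> field -> field) (B : 'I_n -> @field R n M) c k i j : M -> R :=
  fun y => nabla (B i) (B j) y (ccoord c k).

Variable nabla : @field R n M -> @field R n M -> @field R n M.
Hypothesis nablaP : affine_connection nabla.

Lemma smooth_christoffel B c k i j x : frame_at c x B -> chart_at x c ->
  smooth_fun (christoffel nabla B c k i j) x.
Proof.
move=> [sB _] xc; apply: field_smooth; last exact: smooth_fun_coord.
exact: nabla_smooth.
Qed.

Lemma christoffel_sum B c x i j f : frame_at c x B -> chart_at x c ->
  nabla (B i) (B j) x f = \sum_k christoffel nabla B c k i j x * B k x f.
Proof.
move=> fB xc; have sN : smooth_field (nabla (B i) (B j)) by apply: nabla_smooth => //; exact: fB.1.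
rewrite {1}(tangentE xc (field_tangent x sN)) coord_tvec_delta //.
by apply: eq_bigr => k _; rewrite mxE (frame_self fB).
Qed.

Lemma hess_christoffel c x B V k : chart_at x c -> frame_at c x B -> smooth_field V ->
  hess nabla V (ccoord c k) x =
  - \sum_i \sum_j fco V c i x * fco V c j x * christoffel nabla B c k i j x.
Proof.
move=> xc fB sV; rewrite (hess_coord nablaP xc fB sV (smooth_fun_coord k xc)) -sumrN.
apply: eq_bigr => i _; rewrite -sumrN; apply: eq_bigr => j _.
(* A coordinate function has constant first partial derivatives in its own chart. *)
rewrite [X in _ * (X - _)](_ : _ = 0) ?sub0r ?mulrN //.
rewrite -(derive_cst ((delta_mx 0 j : E) 0 k) (c x) (delta_mx 0 i)).
apply: near_eq_derive; have := near_chart xc.2 (chart_at_near xc).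
apply: filterS2 (near_cimg xc.2) => u /cinvK[cu eu] uc.
by have := derive_ccoord k (delta_mx 0 j) uc; rewrite eu.
Qed.

(** Testing the equation of [geodesic_at] on [f] and combining it with the chain rule for [f \o g]
    gives a formula free of the chart hidden in that definition. *)
Lemma geodesic_hess g t V f : smooth_curve g t -> geodesic_at nabla g t ->
  smooth_field V -> V (g t) = velocity g t -> smooth_fun f (g t) ->
  'D_1 ('D_1 (fun r => f (g r))) t = hess nabla V f (g t).
Proof.
move=> sg [c [B [gc sB HB H]]] sV Vg sf; have fB : frame_at c (g t) B by split.
rewrite (second_derive_chart sg gc sf) (hess_coord nablaP gc fB sV sf).
have Vco i : fco V c i (g t) = 'D_1 (fun r => c (g r) 0 i) t.
  by rewrite /fco Vg (velocity_coord sg gc) coord_tvec_coord // mxE.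
have := H f; rewrite addrC => /eqP; rewrite addr_eq0 => /eqP Hf.
under [RHS]eq_bigr do under eq_bigr do rewrite mulrBr !Vco.
under [RHS]eq_bigr do rewrite sumrB.
rewrite sumrB Hf opprK addrC; congr (_ + _).
by apply: eq_bigr => k _; rewrite (frame_self fB) coord_tvec_smooth.
Qed.

(** [geodesic_at] provides some chart and frame; the Hessian, applied to the coordinate functions of
    another chart, transfers the equation to it. *)
Theorem geodesic_chart g t c B : smooth_curve g t -> chart_at (g t) c -> frame_at c (g t) B ->
  geodesic_at nabla g t <-> forall k, 'D_1 ('D_1 (fun r => c (g r) 0 k)) t =
    - \sum_i \sum_j 'D_1 (fun r => c (g r) 0 i) t * 'D_1 (fun r => c (g r) 0 j) t *
      christoffel nabla B c k i j (g t).
Proof.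
move=> sg gc fB; split=> [geo k|H].
  have [V sV /nbhs_singleton Vg] := coord_field_exists (\row_k 'D_1 (fun r => c (g r) 0 k) t) gc.
  rewrite -(velocity_coord sg gc) in Vg.
  have := geodesic_hess sg geo sV Vg (smooth_fun_coord k gc) => /= ->.
  rewrite (hess_christoffel k gc fB sV); congr (- _).
  apply: eq_bigr => i _; apply: eq_bigr => j _; congr (_ * _ * _).
    by rewrite /fco Vg (velocity_coord sg gc) coord_tvec_coord // mxE.
  by rewrite /fco Vg (velocity_coord sg gc) coord_tvec_coord // mxE.
exists c, B; split => //; [exact: fB.1|exact: fB.2|].
move=> q f; under [X in _ + X]eq_bigr do under eq_bigr do
  rewrite (christoffel_sum _ _ f fB gc) mulr_sumr.
under [X in _ + X]eq_bigr do rewrite exchange_big.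
rewrite exchange_big -big_split/=; apply: big1 => k _.
under eq_bigr do under eq_bigr do rewrite mulrA.
under eq_bigr do rewrite -mulr_suml.
by rewrite -mulr_suml -mulrDl [X in X + _]H addNr mul0r.
Qed.

End Geodesics.

(** * The geodesic spray as a first-order system *)

Section Spray.
Context {R : realType} {n : nat} {M : manifold R n}.
Local Notation E := 'rV[R]_n.
Implicit Types (c d : chart R n M) (x y : M) (f : M -> R) (X Y V : @field R n M).
Implicit Types (g : R -> M).
Variable nabla : @field R n M -> @field R n M -> @field R n M.
Hypothesis nablaP : affine_connection nabla.

(** The flow results ask for a field smooth on all of R^(n + n), so [F] is the spray only over the
    ball of radius [rho]; positions form the left half and velocities the right half. Zero velocity
    is an equilibrium, as [local_flow] requires. *)
Definition spray_at c x (B : 'I_n -> field) (F : 'rV[R]_(n + n) -> 'rV[R]_(n + n)) (rho : R) :=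
  [/\ forall u, vsmooth_at F u, forall w, lsubmx (F w) = rsubmx w,
      forall u, F (row_mx u 0) = 0,
      forall u, `|u - c x| < rho ->
        [/\ cimg c u, chart_at (cinv c u) c & frame_at c (cinv c u) B]
    & forall u p k, `|u - c x| < rho -> (rsubmx (F (row_mx u p))) 0 k =
        - \sum_i \sum_j p 0 i * p 0 j * christoffel nabla B c k i j (cinv c u)].

Lemma spray_exists c x B : chart_at x c -> frame_at c x B ->
  exists F rho, 0 < rho /\ spray_at c x B F rho.
Proof.
move=> xc fB; have /near_normP[r r0 Hr] : \forall u \near c x,
    cimg c u /\ (chart_at (cinv c u) c /\ frame_at c (cinv c u) B).
  apply: filterI; first exact: near_cimg xc.2.
  apply: (near_chart xc.2 (P := fun y => chart_at y c /\ frame_at c y B)).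
  by apply: filterI; [exact: chart_at_near|exact: frame_near].
have r2 : 0 < r / 2 by rewrite divr_gt0.
have r2r : r / 2 < r by rewrite ltr_pdivrMr // ltr_pMr // ltr1n.
have r4r : r / 2 / 2 < r / 2 by rewrite ltr_pdivrMr // ltr_pMr // ltr1n.
have [b [sb b1 b0]] := bump_exists (c x) r2.
pose Gam k i j u := b u * christoffel nabla B c k i j (cinv c u).
have sGam k i j u : smooth_at (Gam k i j) u.
  apply: smooth_atM0 => //; have [ur|ur] := ltP `|u - c x| r.
    have [/cinvK[cu eu] [uc fBu]] := Hr u ur; left.
    have := smooth_christoffel nablaP k i j fBu uc.
    by rewrite (smooth_fun_chart _ uc) eu.
  right; apply: (near_normP u _).2; exists (r / 2) => // y yu; apply: b0.
  have : `|u - c x| <= `|y - u| + `|y - c x|.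
    by rewrite [`|y - u|]distrC -[X in `|X| <= _](subrKA y) ler_normD.
  by move: ur yu; move: `|_| `|_| `|_| => p q s; lra.
pose F (w : 'rV[R]_(n + n)) : 'rV[R]_(n + n) := row_mx (rsubmx w)
  (\row_k (- \sum_i \sum_j (rsubmx w) 0 i * (rsubmx w) 0 j * Gam k i j (lsubmx w))).
have sr (w : 'rV[R]_(n + n)) i : smooth_at (fun w : 'rV[R]_(n + n) => (rsubmx w) 0 i) w.
  by under eq_fun do rewrite mxE; exact: smooth_at_coord.
exists F, (r / 2 / 2); split; first by rewrite divr_gt0.
split.
- move=> w i; rewrite /F; case: (split_ordP i) => k ->.
    by under eq_fun do rewrite row_mxEl; exact: sr.
  under eq_fun do rewrite row_mxEr mxE.
  apply: smooth_atN; apply: smooth_at_sum => j; apply: smooth_at_sum => l.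
  apply: smooth_atM; first by apply: smooth_atM; exact: sr.
  by apply: (smooth_at_comp (f := Gam k j l)) => //; exact: vsmooth_lsubmx.
- by move=> w; rewrite /F row_mxKl.
- move=> u; rewrite /F row_mxKr -row_mx0; congr row_mx; apply/rowP => k.
  rewrite !mxE big1 ?oppr0 // => i _; rewrite big1 // => j _.
  by rewrite !mxE !mul0r.
- by move=> u ur; have [? []] := Hr u (lt_trans ur (lt_trans r4r r2r)).
- move=> u p k ur; rewrite /F row_mxKl !row_mxKr mxE; congr (- _).
  apply: eq_bigr => i _; apply: eq_bigr => j _.
  by rewrite /Gam b1 ?mul1r // ltW.
Qed.

Variables (c : chart R n M) (x : M) (B : 'I_n -> @field R n M).
Variables (F : 'rV[R]_(n + n) -> 'rV[R]_(n + n)) (rho : R).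
Hypothesis spr : spray_at c x B F rho.

Definition phase (g : R -> M) (s : R) : 'rV[R]_(n + n) :=
  row_mx (c (g s)) (\row_i 'D_1 (fun r => c (g r) 0 i) s).

Lemma geodesic_spray g t : smooth_curve g t -> chart_at (g t) c -> `|c (g t) - c x| < rho ->
  geodesic_at nabla g t <-> forall k, 'D_1 ('D_1 (fun r => c (g r) 0 k)) t =
    (rsubmx (F (phase g t))) 0 k.
Proof.
move=> sg gc gr; have [_ _ _ Hin HF] := spr.
have [_ _ fB] := Hin _ gr; rewrite (cmapK gc.2) in fB.
rewrite (geodesic_chart nablaP sg gc fB); split=> H k; have := H k.
  move=> ->; rewrite HF // (cmapK gc.2); congr (- _).
  by apply: eq_bigr => i _; apply: eq_bigr => j _; rewrite !mxE.
move=> ->; rewrite HF // (cmapK gc.2); congr (- _).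
by apply: eq_bigr => i _; apply: eq_bigr => j _; rewrite !mxE.
Qed.

Lemma geodesic_solution g t : smooth_curve g t -> chart_at (g t) c -> `|c (g t) - c x| < rho ->
  geodesic_at nabla g t -> is_derive t (1 : R) (phase g) (F (phase g t)).
Proof.
move=> sg gc gr /(geodesic_spray sg gc gr) H; have [_ Fl _ _ _] := spr.
have sq := smooth_into_chart sg gc.
rewrite -[F _]hsubmxK Fl; apply: is_derive_row_mx.
  apply: is_derive_rV => i; rewrite row_mxKr mxE; exact: smooth_at_is_derive.
apply: is_derive_rV => i; rewrite -H.
under eq_fun do rewrite mxE.
by apply: smooth_at_is_derive; apply: smooth_at_derive; exact: sq.
Qed.

(** The left half of the system says that the right half is the velocity, which turns the right half
    of the system into the geodesic equation. *)
Lemma solution_geodesic (X : R -> 'rV[R]_(n + n)) (a b : R) :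
  (forall t : R, a < t < b -> is_derive t (1 : R) X (F (X t))) ->
  (forall t, a < t < b -> `|lsubmx (X t) - c x| < rho) ->
  forall t, a < t < b -> let g s := cinv c (lsubmx (X s)) in
  [/\ smooth_curve g t, geodesic_at nabla g t, chart_at (g t) c & phase g t = X t].
Proof.
move=> DX Xr t tab g; have [sF Fl _ Hin _] := spr.
have sX := solution_smooth sF DX.
have nab : \forall s \near t, a < s < b.
  have : open [set` `]a, b[%R] by exact: interval_open.
  move=> o; have := open_nbhs_nbhs (conj o (_ : [set` `]a, b[%R] t)).
  by rewrite /= in_itv /= => /(_ tab); apply: filterS => s /=; rewrite in_itv.
have [ct gc fB] := Hin _ (Xr t tab).
have cg s : a < s < b -> c (g s) = lsubmx (X s).
  by move=> sab; have [cs _ _] := Hin _ (Xr s sab); have [] := cinvK cs.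
have sl s : a < s < b -> vsmooth_at (fun s => lsubmx (X s)) s.
  by move=> /sX H i; under eq_fun do rewrite mxE; exact: H.
have sg s : a < s < b -> smooth_curve g s.
  move=> sab; have [cs gs _] := Hin _ (Xr s sab).
  by apply: (smooth_into_of_chart gs) (sl s sab); have [] := cinvK cs.
have Dq s i : a < s < b -> 'D_1 (fun r => c (g r) 0 i) s = (rsubmx (X s)) 0 i.
  move=> sab; have nabs : \forall r \near s, a < r < b.
    have : open [set` `]a, b[%R] by exact: interval_open.
    move=> o; have := open_nbhs_nbhs (conj o (_ : [set` `]a, b[%R] s)).
    by rewrite /= in_itv /= => /(_ sab); apply: filterS => r /=; rewrite in_itv.
  have -> : 'D_1 (fun r => c (g r) 0 i) s = 'D_1 (fun r => X r 0 (lshift n i)) s.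
    by apply: near_eq_derive; apply: filterS nabs => r rab; rewrite cg // mxE.
  have H := is_derive_coord (DX s sab) (lshift n i); rewrite (@derive_val _ _ _ _ _ _ _ H).
  by rewrite -Fl mxE.
have ph : phase g t = X t.
  rewrite /phase cg // -[RHS]hsubmxK; congr row_mx; apply/rowP => i.
  by rewrite mxE Dq.
split => //; first exact: sg.
apply/(geodesic_spray (sg t tab) gc); first by rewrite cg //; exact: Xr.
move=> k; rewrite ph.
have -> : 'D_1 ('D_1 (fun r => c (g r) 0 k)) t = 'D_1 (fun r => X r 0 (rshift n k)) t.
  by apply: near_eq_derive; apply: filterS nab => r rab; rewrite Dq // mxE.
have H := is_derive_coord (DX t tab) (rshift n k).
by rewrite (@derive_val _ _ _ _ _ _ _ H) mxE.
Qed.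

End Spray.

(** * Uniqueness and rescaling of geodesics *)

Section GeodesicUniqueness.
Context {R : realType} {n : nat} {M : manifold R n}.
Local Notation E := 'rV[R]_n.
Implicit Types (c d : chart R n M) (x y : M) (g h : R -> M).
Variable nabla : @field R n M -> @field R n M -> @field R n M.
Hypothesis nablaP : affine_connection nabla.

Lemma velocity_ccoord g t c i : smooth_curve g t -> chart_at (g t) c ->
  velocity g t (ccoord c i) = 'D_1 (fun r => c (g r) 0 i) t.
Proof. by move=> sg gc; rewrite (velocity_coord sg gc) coord_tvec_coord // mxE. Qed.

Lemma velocity_eq g h t c : smooth_curve g t -> smooth_curve h t -> g t = h t ->
  chart_at (g t) c ->
  (forall i, 'D_1 (fun r => c (g r) 0 i) t = 'D_1 (fun r => c (h r) 0 i) t) ->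
  velocity g t = velocity h t.
Proof.
move=> sg sh gh gc D; have hc : chart_at (h t) c by rewrite -gh.
rewrite (velocity_coord sg gc) (velocity_coord sh hc) gh; congr (coord_tvec c (h t) _).
by apply/rowP => i; rewrite !mxE.
Qed.

Lemma curve_coord_derivable g t c i : smooth_curve g t -> chart_at (g t) c ->
  derivable (fun r => c (g r) 0 i : R) t 1.
Proof. by move=> sg gc; apply: smooth_at_derivable; exact: smooth_into_chart. Qed.

(** Real induction on equality of position and velocity: it passes to limits by continuity, and
    extends to the right by uniqueness for the spray in a chart around the common point. *)
Theorem geodesic_unique g h :
  (forall t, 0 <= t <= 1 -> smooth_curve g t /\ geodesic_at nabla g t) ->
  (forall t, 0 <= t <= 1 -> smooth_curve h t /\ geodesic_at nabla h t) ->
  g 0 = h 0 -> velocity g 0 = velocity h 0 -> forall t, 0 <= t <= 1 -> g t = h t.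
Proof.
move=> Hg Hh g0 v0 t t01.
suff : g t = h t /\ velocity g t = velocity h t by case.
apply: (real_induction (P := fun t => g t = h t /\ velocity g t = velocity h t)) t01 => {}t t01.
- move=> IH; have [sg _] := Hg t t01; have [sh _] := Hh t t01.
  have [->//|tn0] := eqVneq t 0.
  have t0 : 0 < t by case/andP: t01 => t0 _; rewrite lt_neqAle eq_sym tn0.
  have gh : g t = h t.
    (* Neighbourhoods of [g t] and [h t] meet, since both contain the common point of the curves at
       a slightly earlier time. *)
    apply: (@manifold_hausdorff _ _ M) => A C Ag Ch.
    have : \forall s \near t, A (g s) /\ C (h s).
      by apply: filterI; [exact: near_continuous sg.1 Ag|exact: near_continuous sh.1 Ch].
    move=> /(near_normP t _).1[r r0 Hr].
    pose m := Num.min r t; have m0 : 0 < m by rewrite lt_min r0.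
    have [mr mt] : m <= r /\ m <= t by rewrite !ge_min !lexx orbT.
    have [] := Hr (t - m / 2); first by rewrite addrAC subrr add0r normrN gtr0_norm ?divr_gt0 //; lra.
    move=> As Cs; exists (g (t - m / 2)); split => //.
    have iv : 0 <= t - m / 2 < t by apply/andP; split; lra.
    by have [->] := IH _ iv.
  split => //; have [c gc] := exists_chart (g t); have hc : chart_at (h t) c by rewrite -gh.
  apply: (velocity_eq sg sh gh gc) => i.
  (* The curves are known to agree before [t] only, hence the sign -1. *)
  apply: (@derive_one_sided _ _ _ _ (-1) t) => //.
  + by rewrite normrN1.
  + exact: curve_coord_derivable.
  + exact: curve_coord_derivable.
  move=> s /andP[s0 st]; rewrite mulN1r.
  have [->|sn0] := eqVneq s 0; first by rewrite subr0 gh.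
  have s0' : 0 < s by rewrite lt_neqAle eq_sym sn0.
  have iv : 0 <= t - s < t by apply/andP; split; lra.
  by have [->] := IH _ iv.
- move=> IH; have [t0 t1] : 0 <= t /\ t < 1 by case/andP: t01.
  have t01' : 0 <= t <= 1 by rewrite t0 ltW.
  have [gh vgh] : g t = h t /\ velocity g t = velocity h t by apply: IH; rewrite t0 lexx.
  have [sg _] := Hg t t01'; have [sh _] := Hh t t01'.
  have [c gc] := exists_chart (g t); have hc : chart_at (h t) c by rewrite -gh.
  have [B fB] := frame_exists gc.
  have [F [rho [rho0 spr]]] := spray_exists nablaP gc fB.
  have near_rho k : smooth_curve k t -> k t = g t -> \forall s \near t,
      chart_at (k s) c /\ `|c (k s) - c (g t)| < rho.
    move=> sk kg.
    have : \forall y \near k t, chart_at y c /\ `|c y - c (g t)| < rho.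
      rewrite kg; apply: filterI; first exact: chart_at_near.
      apply: (near_chartV gc.2 (P := fun u => `|u - c (g t)| < rho)).
      by apply: (near_normP (c (g t)) _).2; exists rho.
    exact: near_continuous sk.1.
  have /(near_normP t _).1[r r0 Hr] := near_rho g sg erefl.
  have /(near_normP t _).1[r' r'0 Hr'] := near_rho h sh (esym gh).
  pose d := Num.min (1 - t) (Num.min r r').
  have d0 : 0 < d by rewrite !lt_min subr_gt0 t1 r0.
  have [d1 [dr dr']] : d <= 1 - t /\ d <= r /\ d <= r' by rewrite !ge_min !lexx !orbT.
  have in01 s : t <= s < t + d -> 0 <= s <= 1 by move=> /andP[? ?]; apply/andP; split; lra.
  have inr s : t <= s < t + d -> `|s - t| < r /\ `|s - t| < r'.
    by move=> /andP[? ?]; rewrite ger0_norm ?subr_ge0 //; split; lra.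
  have Dg (s : R) : t <= s < t + d -> is_derive s (1 : R) (phase c g) (F (phase c g s)).
    move=> st; have [sgs geo] := Hg s (in01 s st); have [gsc gsr] := Hr s (inr s st).1.
    exact: (geodesic_solution nablaP spr).
  have Dh (s : R) : t <= s < t + d -> is_derive s (1 : R) (phase c h) (F (phase c h s)).
    move=> st; have [shs geo] := Hh s (in01 s st); have [hsc hsr] := Hr' s (inr s st).2.
    exact: (geodesic_solution nablaP spr).
  have pt : phase c g t = phase c h t.
    rewrite /phase gh; congr row_mx; apply/rowP => i; rewrite !mxE.
    by rewrite -(velocity_ccoord i sg gc) -(velocity_ccoord i sh hc) vgh.
  have [sF _ _ _ _] := spr.
  have [e e0 He] := local_uniqueness sF d0 Dg Dh pt.
  exists (Num.min e d); first by rewrite lt_min e0.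
  move=> s /andP[ts]; rewrite -ltrBlDl lt_min => /andP[se sd] s1.
  have sd' : t <= s < t + d by apply/andP; split; lra.
  have se' : t <= s < t + e by apply/andP; split; lra.
  have [gsc _] := Hr s (inr s sd').1; have [hsc _] := Hr' s (inr s sd').2.
  have [q1 q2] := eq_row_mx (He s se').
  have ghs : g s = h s by rewrite -(cmapK gsc.2) q1 (cmapK hsc.2).
  split => //; have [sgs _] := Hg s (in01 s sd'); have [shs _] := Hh s (in01 s sd').
  apply: (velocity_eq sgs shs ghs gsc) => i.
  by have /rowP/(_ i) := q2; rewrite !mxE.
Qed.

Lemma derive_rescale (q : R -> R) (a t : R) : smooth_at q (a * t) ->
  'D_1 (fun r => q (a * r)) t = a * 'D_1 q (a * t).
Proof.
move=> sq; have dq : differentiable q (a * t).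
  by apply/derivable1_diffP; exact: smooth_at_derivable.
have Da : is_derive t (1 : R) (fun r : R => a * r) a.
  by rewrite -[X in is_derive _ _ _ X]mulr1; apply: is_deriveZ.
have H := @is_derive_comp _ _ _ _ q (fun r : R => a * r) _ _ _ dq Da.
rewrite (@derive_val _ _ _ _ _ _ _ H).
have := is_derive_scale a (smooth_at_is_derive (1 : R) sq) => E1.
rewrite [_ *: 1]mulr1 in E1.
by rewrite (@derive_val _ _ _ _ _ _ _ E1).
Qed.

Lemma smooth_mull (a t : R) : smooth_at (fun r => a * r) t.
Proof. by apply: (@smooth_atM _ _ (cst a)); [exact: smooth_at_cst|exact: smooth_at_id]. Qed.

Lemma smooth_curve_rescale g (a t : R) : smooth_curve g (a * t) ->
  smooth_curve (fun r => g (a * r)) t.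
Proof.
move=> sg; have [cg [c gc sc]] := sg; split.
  apply: (@continuous_comp _ _ _ (fun r => a * r) g) => //.
  exact: smooth_at_continuous (smooth_mull a t).
exists c => // k; apply: (@smooth_at_comp1 _ _ (fun z => c (g z) 0 k)); first exact: sc.
exact: smooth_mull.
Qed.

Lemma velocity_rescale g (a t : R) : smooth_curve g (a * t) ->
  velocity (fun r => g (a * r)) t = (fun f => a * velocity g (a * t) f).
Proof.
move=> sg; have [c gc] := exists_chart (g (a * t)); apply/funext => f.
rewrite (velocity_coord (smooth_curve_rescale sg) gc) (velocity_coord sg gc) -coord_tvecZ //.
congr (coord_tvec c _ _ f); apply/rowP => k; rewrite !mxE.
by rewrite (derive_rescale (q := fun r => c (g r) 0 k)) //; exact: smooth_into_chart.
Qed.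

(** Rescaling time by [a] multiplies the acceleration and the term quadratic in the velocity by the
    same [a * a]. *)
Lemma geodesic_rescale g (a t : R) : smooth_curve g (a * t) ->
  geodesic_at nabla g (a * t) -> geodesic_at nabla (fun r => g (a * r)) t.
Proof.
move=> sg; have [c gc] := exists_chart (g (a * t)); have [B fB] := frame_exists gc.
move=> /(geodesic_chart nablaP sg gc fB) H.
apply/(geodesic_chart nablaP (smooth_curve_rescale sg) gc fB) => k.
have sq := smooth_into_chart sg gc.
have D1 i : 'D_1 (fun r => c (g (a * r)) 0 i) t = a * 'D_1 (fun r => c (g r) 0 i) (a * t).
  by rewrite (derive_rescale (q := fun r => c (g r) 0 i)).
have -> : 'D_1 ('D_1 (fun r => c (g (a * r)) 0 k)) t =
    'D_1 (fun r => a * ('D_1 (fun r => c (g r) 0 k)) (a * r)) t.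
  apply: near_eq_derive.
  apply: filterS (near_continuous (smooth_at_continuous (smooth_mull a t)) (vsmooth_at_near sq)) => r sr.
  by rewrite (derive_rescale (q := fun r => c (g r) 0 k)).
have sD : smooth_at ('D_1 (fun r => c (g r) 0 k)) (a * t) by apply: smooth_at_derive; exact: sq.
rewrite (@derive_scl _ _ a (fun r => 'D_1 (fun r => c (g r) 0 k) (a * r))); last first.
  by apply: (@smooth_at_comp1 _ _ ('D_1 (fun r => c (g r) 0 k))) => //; exact: smooth_mull.
rewrite (derive_rescale (q := 'D_1 (fun r => c (g r) 0 k))) // H !mulrN; congr (- _).
rewrite !mulr_sumr; apply: eq_bigr => i _; rewrite !mulr_sumr; apply: eq_bigr => j _.
rewrite !D1 [in RHS]mulrACA -!mulrA; congr (_ * (_ * _)); rewrite !mulrA //.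
Qed.

Lemma exp_at_unique x v y y' : exp_at nabla x v y -> exp_at nabla x v y' -> y = y'.
Proof.
move=> [g [[e e0 Hg] g0 gv <-]] [h [[e' e'0 Hh] h0 hv <-]].
apply: (@geodesic_unique g h) => //.
- by move=> t /andP[t0 t1]; apply: Hg; apply/andP; split; lra.
- by move=> t /andP[t0 t1]; apply: Hh; apply/andP; split; lra.
- by rewrite g0.
- by rewrite gv.
- by rewrite ler01 lexx.
Qed.

Lemma expmE x v y : exp_at nabla x v y -> expm nabla x v = y.
Proof.
move=> H; have H' : exp_at nabla x v (expm nabla x v).
  by apply: (@choose_inP _ x (exp_at nabla x v)); exists y.
exact: exp_at_unique H' H.
Qed.

(** The geodesic run at speed [a] reaches [g a] at time 1; [0 <= a <= 1] keeps its time within the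
    domain of [g]. *)
Lemma exp_at_geodesic x v g (e : R) : 0 < e ->
  (forall t, - e < t < 1 + e -> smooth_curve g t /\ geodesic_at nabla g t) ->
  g 0 = x -> velocity g 0 = v ->
  forall a, 0 <= a <= 1 -> exp_at nabla x (fun f => a * v f) (g a).
Proof.
move=> e0 Hg g0 gv a /andP[a0 a1]; exists (fun r => g (a * r)).
have ain t : - e < t < 1 + e -> - e < a * t < 1 + e.
  move=> /andP[te1 te2]; have [t0|t0] := leP 0 t.
    have : a * t <= t by rewrite ler_piMl.
    have : 0 <= a * t by rewrite mulr_ge0.
    by move: (a * t) => s ? ?; apply/andP; split; lra.
  have : t <= a * t by rewrite ler_niMl // ltW.
  have : a * t <= 0 by rewrite mulr_ge0_le0 // ltW.
  by move: (a * t) => s ? ?; apply/andP; split; lra.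
split.
- exists e => // t /ain /Hg[sg geo]; split; first exact: smooth_curve_rescale.
  exact: geodesic_rescale.
- by rewrite mulr0.
- have i0 : - e < 0 < 1 + e by apply/andP; split; lra.
  have [sg _] := Hg 0 i0.
  by rewrite velocity_rescale ?mulr0 // gv.
- by rewrite mulr1.
Qed.

End GeodesicUniqueness.

(** * The exponential map near 0 *)

Section ExponentialMap.
Context {R : realType} {n : nat} {M : manifold R n}.
Local Notation E := 'rV[R]_n.
Implicit Types (c d : chart R n M) (x y : M) (g h : R -> M).
Variable nabla : @field R n M -> @field R n M -> @field R n M.
Hypothesis nablaP : affine_connection nabla.

Lemma smooth_line (u : E) (t : R) : vsmooth_at (fun t : R => t *: u) t.
Proof.
move=> i; apply: (@smooth_at_ext _ _ (fun t : R => u 0 i * t)); last exact: smooth_mull.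
by near=> s; rewrite mxE mulrC.
Unshelve. all: by end_near. Qed.

Lemma vsmooth_row_mx m (a : 'rV[R]_m) (u : E) : vsmooth_at (fun u : E => row_mx a u) u.
Proof.
move=> i; case: (split_ordP i) => l ->.
  by under eq_fun do rewrite row_mxEl; exact: smooth_at_cst.
by under eq_fun do rewrite row_mxEr; exact: smooth_at_coord.
Qed.

Lemma lsubmx_norm_le n1 n2 (w : 'rV[R]_(n1 + n2)) : `|lsubmx w| <= `|w|.
Proof. by apply: rV_norm_le => // i; rewrite mxE rV_coord_le. Qed.

Lemma star_shaped_nbhs (W : set E) (u : E) : open W -> W 0 ->
  exists2 a : R, 0 < a & forall t, `|t| <= 1 -> W (t *: (a *: u)).
Proof.
move=> oW W0; have /near_normP[r r0 Hr] := open_nbhs_nbhs (conj oW W0).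
have u1 : 0 < `|u| + 1 by rewrite ltr_wpDl.
exists (r / (`|u| + 1)) => [|t t1]; first by rewrite divr_gt0.
apply: Hr; rewrite subr0 scalerA normrZ normrM.
have -> : `|r / (`|u| + 1)| = r / (`|u| + 1) by rewrite gtr0_norm // divr_gt0.
apply: (@le_lt_trans _ _ (1 * (r / (`|u| + 1)) * `|u|)).
  by apply: ler_wpM2r => //; apply: ler_wpM2r => //; rewrite ltW // divr_gt0.
by rewrite mul1r mulrAC ltr_pdivrMr // ltr_pM2l // ltrDl.
Qed.

(** In a chart the exponential map is the position after time 1 of the spray flow, started at [x]
    with velocity [u], hence smooth near 0. Its differential there is the identity because
    [e (s *: u)] is the position at time [s] of one geodesic. *)
Lemma exp_chart x : exists c (W : set E) (e : E -> E),
  [/\ chart_at x c, open W /\ W 0, forall u, W u -> vsmooth_at e u,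
      forall u, W u -> cimg c (e u) /\ exp_at nabla x (coord_tvec c x u) (cinv c (e u))
    & forall v, jac e 0 v = v].
Proof.
have [c xc] := exists_chart x; have [B fB] := frame_exists xc.
have [F [rho [rho0 spr]]] := spray_exists nablaP xc fB.
have [sF Fl F0 Hin _] := spr.
have [U [phi [oU Uz0 flowU Hphi]]] := local_flow sF (F0 (c x)) rho0.
pose z u : 'rV[R]_(n + n) := row_mx (c x) u.
have oW : open (setT `&` z @^-1` U).
  exact: (open_preimage openT oU (fun u _ => vsmooth_at_continuous (vsmooth_row_mx (c x) u))).
pose W : set E := setT `&` z @^-1` U.
pose e u := lsubmx (phi (z u) 1).
have lr u t : `|phi (z u) t - z 0| < rho -> `|lsubmx (phi (z u) t) - c x| < rho.
  apply: le_lt_trans; apply: le_trans (lsubmx_norm_le _).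
  by rewrite /z raddfB /= row_mxKl.
have geo u : W u -> exists2 eps : R, 0 < eps &
    let g s := cinv c (lsubmx (phi (z u) s)) in
    [/\ forall t, - eps < t < 1 + eps -> smooth_curve g t /\ geodesic_at nabla g t,
      g 0 = x, velocity g 0 = coord_tvec c x u &
      forall t, - eps < t < 1 + eps -> cimg c (lsubmx (phi (z u) t))].
  move=> [_ Uu]; have [eps eps0 He] := Hphi _ Uu; exists eps => // g.
  have HX := solution_geodesic nablaP spr (fun t Ht => (He t Ht).2) (fun t Ht => lr _ _ (He t Ht).1).
  have i0 : - eps < 0 < 1 + eps by apply/andP; split; lra.
  have p0 : phi (z u) 0 = z u := (flowU _ Uu).1.
  have g0 : g 0 = x by rewrite /g p0 row_mxKl (cmapK xc.2).
  split => //.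
  - by move=> t Ht; have [] := HX t Ht.
  - have [sg _ gc ph] := HX 0 i0.
    rewrite (velocity_coord sg gc); rewrite p0 in ph; have [_ ->] := eq_row_mx ph.
    by rewrite -[cinv _ _]/(g 0) g0.
  - by move=> t Ht; have [] := Hin _ (lr _ _ (He t Ht).1).
have expW u : W u -> cimg c (e u) /\ exp_at nabla x (coord_tvec c x u) (cinv c (e u)).
  move=> Wu; have [eps eps0 [Hg g0 gv Hc]] := geo u Wu.
  split; first by apply: Hc; apply/andP; split; lra.
  exists (fun s => cinv c (lsubmx (phi (z u) s))); split => //.
  by exists eps.
have se u : W u -> vsmooth_at e u.
  move=> [_ Uu] i; rewrite /e; under eq_fun do rewrite mxE.
  have s1 : smooth_at (fun w => phi w 1 0 (lshift n i)) (z u).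
    exists U => // k; apply: (flow_smooth k sF oU flowU) => //.
    by rewrite ler01 lexx.
  exact: (smooth_at_comp (g := z) s1 (vsmooth_row_mx (c x) u)).
exists c, W, e; split => // v.
have W0 : W 0 by split.
(* [v] may lie outside [W], so the differential is computed on a small multiple of [v] and divided
   by [a] at the end. *)
have [a a0 Ha] := star_shaped_nbhs v oW W0.
pose u := a *: v.
have Wu : W u by have := Ha 1; rewrite normr1 lexx scale1r; exact.
have [eps eps0 [Hg g0 gv Hc]] := geo u Wu.
apply/rowP => i; rewrite mxE.
have line s : 0 <= s < 1 -> e (s *: u) 0 i = (phi (z u) s) 0 (lshift n i).
  move=> /andP[s0 s1]; have s01 : 0 <= s <= 1 by rewrite s0 ltW.
  have Ws : W (s *: u) by apply: Ha; rewrite ger0_norm // ltW.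
  have [cs es] := expW _ Ws.
  have E1 := exp_at_geodesic nablaP eps0 Hg g0 gv s01.
  have E2 : (fun f => s * coord_tvec c x u f) = coord_tvec c x (s *: u).
    by apply/funext => f; rewrite (@coord_tvecZ _ _ _ c x s u f xc).
  rewrite E2 in E1; have E3 := exp_at_unique nablaP es E1.
  have cs' : cimg c (lsubmx (phi (z u) s)) by apply: Hc; apply/andP; split; lra.
  have : e (s *: u) = lsubmx (phi (z u) s).
    by rewrite -(cinvK cs).2 E3 (cinvK cs').2.
  by move=> ->; rewrite mxE.
have De : is_derive (0 : R) (1 : R) (fun s => e (s *: u) 0 i) ('D_u (fun w => e w 0 i) 0).
  have := @is_derive_line _ _ _ (fun w => e w 0 i) 0 u 0 ('D_u (fun w => e w 0 i) 0).
  rewrite scale0r addr0 => /(_ (smooth_at_is_derive u (se 0 W0 i))).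
  by under eq_fun do rewrite add0r.
have Dp : is_derive (0 : R) (1 : R) (fun s => phi (z u) s 0 (lshift n i)) (u 0 i).
  have i0 : 0 <= (0 : R) <= 1 by rewrite lexx ler01.
  have := is_derive_coord ((flowU _ Wu.2).2 0 i0) (lshift n i).
  by rewrite (flowU _ Wu.2).1 -[F _]hsubmxK row_mxEl Fl row_mxKr.
(* [line] covers nonnegative times only, which suffices for derivatives at 0. *)
have := derive_one_sided (normr1 _) ltr01 (@ex_derive _ _ _ _ _ _ _ De) (@ex_derive _ _ _ _ _ _ _ Dp).
rewrite (@derive_val _ _ _ _ _ _ _ De) (@derive_val _ _ _ _ _ _ _ Dp).
have H s : 0 <= s < 1 -> e ((0 + 1 * s) *: u) 0 i = phi (z u) (0 + 1 * s) 0 (lshift n i).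
  by rewrite add0r mul1r; exact: line.
move=> /(_ H); rewrite /u (derive_scale_dir _ _ (se 0 W0 i)) mxE.
by apply: mulfI; rewrite gt_eqF.
Qed.

Lemma is_log_exists x : exists l, is_log nabla x l.
Proof.
have [c [W [e [xc [oW W0] se He je]]]] := exp_chart x.
have [W' [N' [L [[oW' W'0] WW [oN' N'0] H1 H2]]]] := inverse_function oW W0 se je.
have expmW u : W' u -> expm nabla x (coord_tvec c x u) = cinv c (e u).
  by move=> /WW/He[_ H]; exact: expmE.
(* Rescaling by 0 turns the geodesic of zero initial velocity into the constant one. *)
have e0 : e 0 = c x.
  have [c0 [g [[eps eps0 Hg] g0 gv g1]]] := He 0 W0.
  have i0 : 0 <= (0 : R) <= 1 by rewrite lexx ler01.
  have := exp_at_geodesic nablaP eps0 Hg g0 gv i0.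
  have -> : (fun f => 0 * coord_tvec c x 0 f) = coord_tvec c x 0.
    by apply/funext => f; rewrite mul0r coord_tvec0.
  move=> /(exp_at_unique nablaP (He 0 W0).2) E1.
  by rewrite -(cinvK c0).2 E1 g0.
exists (fun y => coord_tvec c x (L (c y))), c, W', (cdom c `&` cmap c @^-1` N'), (fun y => L (c y)).
split => //.
- split; last by split; [exact: xc.2|rewrite /= -e0].
  exact: (open_preimage (cdom_open c) oN' (fun y cy => cmap_continuous cy)).
- move=> u Wu; have [Nu Lu] := H1 u Wu; have [cu eu] := He u (WW _ Wu).
  have [cd ceu] := cinvK cu; rewrite (expmW u Wu); split.
  + by exists (cinv c (e u)).
  + by split => //=; rewrite ceu.
  + by rewrite ceu.
  + apply: (@smooth_into_ext _ _ _ _ (fun u => cinv c (e u))).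
      have : \forall w \near u, W' w by exact: open_nbhs_nbhs.
      by apply: filterS => w /expmW.
    have uc : chart_at (cinv c (e u)) c by split => //; exact: xc.1.
    by apply: (smooth_into_of_chart uc) => //; exact: se (WW _ Wu).
- move=> y [cy Ny]; have [WL eL sL] := H2 _ Ny; split => //.
  + by rewrite (expmW _ WL) eL (cmapK cy).
  + have yc : chart_at y c by split => //; exact: xc.1.
    move=> k; exact: (smooth_fun_of_chart (h := fun u => L u 0 k) yc (sL k)).
Qed.

End ExponentialMap.

(** * Geodesic symmetries *)

Section GeodesicSymmetry.
Context {R : realType} {n : nat} {M : manifold R n}.
Local Notation E := 'rV[R]_n.
Implicit Types (c d : chart R n M) (x y : M) (g h : R -> M).

Lemma smooth_into_comp {V : normedModType R} (phi : E -> M) (h : V -> E) a :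
  smooth_param phi (h a) -> vsmooth_at h a -> smooth_into (@smooth_at R V) (fun z => phi (h z)) a.
Proof.
move=> sphi sh; have ch := vsmooth_at_continuous sh; have [cphi [c hc sc]] := sphi; split.
  exact: (@continuous_comp _ _ _ h phi a ch cphi).
by exists c => // k; exact: (smooth_at_comp (f := fun z => c (phi z) 0 k)).
Qed.

Lemma smooth_map_comp_into (phi : E -> M) (L : M -> E) y : smooth_param phi (L y) ->
  (forall k, smooth_fun (fun z => L z 0 k) y) -> smooth_map (fun z => phi (L z)) y.
Proof.
move=> sphi sL; have cL : {for y, continuous L}.
  by apply: rV_continuous => i; exact: smooth_fun_continuous.
have [d yd] := exists_chart (phi (L y)); apply: (smooth_map_of_charts (d := d)) => //.
  exact: (@continuous_comp _ _ _ L phi y cL sphi.1).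
move=> k; have [c yc] := exists_chart y; apply/(smooth_fun_chart _ yc).
apply: (smooth_at_comp (f := fun u => d (phi u) 0 k) (g := L \o cinv c)).
  by rewrite /= (cmapK yc.2); exact: smooth_into_chart.
by move=> i; have := sL i; rewrite (smooth_fun_chart _ yc).
Qed.

(** Evaluating the quadratic form on [delta_mx 0 i + delta_mx 0 j] leaves [S i j + S j i]. *)
Lemma polarization (S : 'I_n -> 'I_n -> R) : (forall i j, S i j = S j i) ->
  (forall v : E, \sum_i \sum_j v 0 i * v 0 j * S i j = 0) -> forall i j, S i j = 0.
Proof.
move=> symS H; pose b (v w : E) := \sum_i \sum_j v 0 i * w 0 j * S i j.
have bD v v' w : b (v + v') w = b v w + b v' w.
  rewrite /b -big_split/=; apply: eq_bigr => i _; rewrite -big_split/=.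
  by apply: eq_bigr => j _; rewrite mxE !mulrDl.
have bDr v w w' : b v (w + w') = b v w + b v w'.
  rewrite /b -big_split/=; apply: eq_bigr => i _; rewrite -big_split/=.
  by apply: eq_bigr => j _; rewrite mxE mulrDr mulrDl.
have be i j : b (delta_mx 0 i) (delta_mx 0 j) = S i j.
  rewrite /b (bigD1 i) //= [X in _ + X]big1 ?addr0 => [|k ki].
    rewrite (bigD1 j) //= [X in _ + X]big1 ?addr0 => [|k kj].
      by rewrite !mxE !eqxx !mul1r.
    by rewrite !mxE (negbTE kj) andbF mulr0 mul0r.
  by apply: big1 => l _; rewrite !mxE (negbTE ki) andbF !mul0r.
have b0 v : b v v = 0 := H v.
move=> i j; have := b0 (delta_mx 0 i + delta_mx 0 j).
rewrite bD !bDr !b0 !be addr0 add0r [S j i]symS => /eqP.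
by rewrite -mulr2n mulrn_eq0 /= => /eqP.
Qed.

Variable nabla : @field R n M -> @field R n M -> @field R n M.
Hypothesis nablaP : affine_connection nabla.

Let s x := geodesic_symmetry nabla x.

Lemma logmP x : is_log nabla x (logm nabla x).
Proof. by apply: (@choose_inP _ _ (is_log nabla x)); exact: is_log_exists. Qed.

Definition exp_coord c x (u : E) := expm nabla x (coord_tvec c x u).

(** [is_log] made explicit for the chosen logarithm: [L] gives normal coordinates, in which the
    geodesic symmetry is [u -> - u]. *)
Definition normal_chart c x (W : set E) (N : set M) (L : M -> E) :=
  [/\ chart_at x c, open W /\ W 0, open N /\ N x,
    forall u, W u -> [/\ exp_at nabla x (coord_tvec c x u) (exp_coord c x u),
      N (exp_coord c x u), L (exp_coord c x u) = u & smooth_param (exp_coord c x) u]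
  & forall y, N y -> [/\ W (L y), exp_coord c x (L y) = y, s x y = exp_coord c x (- L y)
      & forall k, smooth_fun (fun z => L z 0 k) y]].

Lemma normal_chart_exists x : exists c W N L, normal_chart c x W N L.
Proof.
have [c [W [N [L [xc [oW W0] [oN Nx] HW HN]]]]] := logmP x.
exists c, W, N, L; split => //.
- move=> u /HW[[y exy] Nu Lu su]; split => //.
  by rewrite /exp_coord (expmE nablaP exy).
- move=> y /HN[WL eL lL sL]; split => //.
  rewrite /s /geodesic_symmetry lL /exp_coord; congr (expm nabla x _).
  by apply/funext => f; rewrite -(scaleN1r (L y)) (@coord_tvecZ _ _ _ c x (-1) (L y) f xc) mulN1r.
Qed.

Lemma exp_coord0 c x W N L : normal_chart c x W N L -> exp_coord c x 0 = x.
Proof.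
move=> [xc [_ W0] _ HW _]; have [[g [[e e0 Hg] g0 gv g1]] _ _ _] := HW 0 W0.
have i0 : 0 <= (0 : R) <= 1 by rewrite lexx ler01.
have := exp_at_geodesic nablaP e0 Hg g0 gv i0.
have -> : (fun f => 0 * coord_tvec c x 0 f) = coord_tvec c x 0.
  by apply/funext => f; rewrite mul0r coord_tvec0.
by move=> /(expmE nablaP); rewrite g0.
Qed.

(** The symmetry is involutive near [x], so it serves as its own local inverse. *)
Lemma geodesic_symmetry_diffeo x : local_diffeo x (s x) /\ s x x = x.
Proof.
have [c [W [N [L nc]]]] := normal_chart_exists x.
have ex0 := exp_coord0 nc; have [xc [oW W0] [oN Nx] HW HN] := nc.
have Lx : L x = 0 by have [_ _ Le _] := HW 0 W0; rewrite ex0 in Le.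
have sx : s x x = x by have [_ _ -> _] := HN x Nx; rewrite Lx oppr0.
split => //; exists (s x).
(* On [U] both [L y] and [- L y] lie in [W], which makes [U] stable under the symmetry. *)
pose U := N `&` (fun y => - L y) @^-1` W.
have cL y : N y -> {for y, continuous (fun y => - L y)}.
  move=> /HN[_ _ _ sL]; apply: rV_continuous => i.
  have -> : (fun z => (- L z) 0 i) = (fun z => - L z 0 i) by apply/funext => z; rewrite mxE.
  by apply: smooth_fun_continuous; exact: smooth_funN (sL i).
have oU : open U := open_preimage oN oW cL.
have Ux : U x by split => //=; rewrite Lx oppr0.
have HU y : U y -> [/\ U (s x y), s x (s x y) = y & smooth_map (s x) y].
  move=> [Ny WNy]; have [WL eL sy sL] := HN y Ny.
  have [_ Ns Ls ss] := HW _ WNy; rewrite -sy in Ns Ls.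
  have [_ _ ssy _] := HN _ Ns; rewrite Ls opprK eL in ssy.
  split => //; first by split => //=; rewrite Ls opprK.
  have H : smooth_map (fun z => exp_coord c x (- L z)) y.
    apply: (smooth_map_comp_into (L := fun z => - L z)) => //.
    by move=> k; under eq_fun do rewrite mxE; exact: smooth_funN.
  have e : \near y, exp_coord c x (- L y) = s x y.
    have : \forall z \near y, N z by exact: open_nbhs_nbhs.
    by apply: filterS => z /HN[].
  have ey := nbhs_singleton e; case: H => cH [d yd sd]; split.
    by rewrite /prop_for /continuous_at -ey; apply: cvg_trans (near_eq_cvg e) cH.
  exists d; first by rewrite -ey.
  by move=> k; apply: smooth_fun_ext (sd k); apply: filterS e => z ->.
by exists U, U; split.
Qed.

(* The geodesic symmetry reverses the geodesics through [x]; differentiating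
   [s (g t) = g (- t)] twice gives its 2-jet. *)
Lemma reversed_curve x d (v : E) : chart_at x d -> exists (a : R) (g : R -> M),
  [/\ 0 < a, smooth_curve g 0 /\ g 0 = x, \forall t \near 0, s x (g t) = g (- t),
    forall i, 'D_1 (fun r => d (g r) 0 i) 0 = a * v 0 i
  & forall B, frame_at d x B -> forall k, 'D_1 ('D_1 (fun r => d (g r) 0 k)) 0 =
     - \sum_i \sum_j (a * v 0 i) * (a * v 0 j) * christoffel nabla B d k i j x].
Proof.
move=> xd; have [c [W [N [L nc]]]] := normal_chart_exists x.
have ex0 := exp_coord0 nc; have [xc [oW W0] [oN Nx] HW HN] := nc.
(* The vector is given in the chart [d], whereas the exponential map is parametrized through the
   chart [c] of its logarithm. *)
pose u0 := vco c (coord_tvec d x v).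
have cu0 : coord_tvec c x u0 = coord_tvec d x v.
  by rewrite /u0 -(tangentE xc) //; exact: tangent_coord_tvec.
have [a a0 Ha] := star_shaped_nbhs u0 oW W0.
pose u := a *: u0; pose g (t : R) := exp_coord c x (t *: u).
have coord_scale (t : R) w : coord_tvec c x (t *: w) = (fun f => t * coord_tvec c x w f).
  by apply/funext => f; rewrite (@coord_tvecZ _ _ _ c x t w f xc).
have g0 : g 0 = x by rewrite /g scale0r.
have sg : smooth_curve g 0.
  apply: (smooth_into_comp (h := fun t : R => t *: u)); last exact: smooth_line.
  by rewrite scale0r; have [] := HW 0 W0.
have Wu : W u by have := Ha 1; rewrite normr1 lexx scale1r; exact.
(* [g] is reversed by the symmetry and [q] is a geodesic; they are known to coincide on [0, 1] only,
   which by [derive_one_sided] transfers the first two derivatives of [q] at 0 to [g]. *)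
have [[q [[e e0 Hq] q0 qv q1]] _ _ _] := HW u Wu.
have gq t : 0 <= t <= 1 -> g t = q t.
  move=> t01; rewrite /g /exp_coord coord_scale; apply: (expmE nablaP).
  exact: (exp_at_geodesic nablaP e0 Hq q0 qv t01).
have i0 : - e < 0 < 1 + e by apply/andP; split; lra.
have [sq geoq] := Hq 0 i0.
have gd : chart_at (g 0) d by rewrite g0.
have qd : chart_at (q 0) d by rewrite q0.
have sdg := smooth_into_chart sg gd; have sdq := smooth_into_chart sq qd.
have D1 i : 'D_1 (fun r => d (g r) 0 i) 0 = 'D_1 (fun r => d (q r) 0 i) 0.
  apply: (@derive_one_sided _ _ _ 0 1 1) => //; first exact: normr1.
  - exact: smooth_at_derivable (sdg i).
  - exact: smooth_at_derivable (sdq i).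
  by move=> t /andP[t0 t1]; rewrite add0r mul1r gq // t0 ltW.
have Dq i : 'D_1 (fun r => d (q r) 0 i) 0 = a * v 0 i.
  rewrite -(velocity_ccoord i sq qd) qv /u coord_scale cu0.
  by rewrite coord_tvec_coord.
exists a, g; split => //.
- apply: (near_normP (0 : R) _).2; exists 1 => // t; rewrite subr0 => t1.
  have Wt : W (t *: u) by apply: Ha; exact: ltW.
  have [_ Nt Lt _] := HW _ Wt; have [_ _ -> _] := HN _ Nt.
  by rewrite Lt /g scaleNr.
- by move=> i; rewrite D1.
move=> B fB k; have fBq : frame_at d (q 0) B by rewrite q0.
have := (geodesic_chart nablaP sq qd fBq).1 geoq k.
under eq_bigr do under eq_bigr do rewrite !Dq.
rewrite q0 => <-; apply: (@derive_one_sided _ _ _ 0 1 1) => //; first exact: normr1.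
- by apply: smooth_at_derivable; apply: smooth_at_derive; exact: sdg.
- by apply: smooth_at_derivable; apply: smooth_at_derive; exact: sdq.
move=> t /andP[t0 t1]; rewrite add0r mul1r.
have [->|tn0] := eqVneq t 0; first exact: D1.
have tpos : 0 < t by rewrite lt_neqAle eq_sym tn0.
apply: near_eq_derive; apply: (near_normP t _).2.
exists (Num.min t (1 - t)); first by rewrite lt_min tpos subr_gt0.
move=> r; rewrite lt_min !ltr_norml => /andP[/andP[r1 _] /andP[_ r2]].
by rewrite gq //; apply/andP; split; lra.
Qed.

Lemma reversed_derive (q : R -> R) : smooth_at q 0 ->
  'D_1 (fun r => q (- r)) 0 = - 'D_1 q 0.
Proof.
move=> sq; have sq' : smooth_at q (-1 * 0) by rewrite mulr0.
have := derive_rescale sq'; rewrite mulr0 mulN1r => <-.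
have -> // : (fun r => q (-1 * r)) = (fun r => q (- r)) by apply/funext => r; rewrite mulN1r.
Qed.

Lemma reversed_second_derive (q : R -> R) : smooth_at q 0 ->
  'D_1 ('D_1 (fun r => q (- r))) 0 = 'D_1 ('D_1 q) 0.
Proof.
move=> sq; have cN : {for (0 : R), continuous (fun r : R => - r)} by exact: opp_continuous.
have nq : \forall r \near (0 : R), smooth_at q (- r).
  by apply: (near_continuous cN); rewrite oppr0; exact: smooth_at_near.
have sD : smooth_at ('D_1 q) 0 by exact: smooth_at_derive.
have -> : 'D_1 ('D_1 (fun r => q (- r))) 0 = 'D_1 (fun r => -1 * 'D_1 q (- r)) 0.
  apply: near_eq_derive; apply: filterS nq => r sqr.
  have sqr' : smooth_at q (-1 * r) by rewrite mulN1r.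
  have := derive_rescale sqr'; rewrite !mulN1r => <-.
  have -> // : (fun r => q (-1 * r)) = (fun r => q (- r)) by apply/funext => r'; rewrite mulN1r.
rewrite (@derive_scl _ _ (-1) (fun r => 'D_1 q (- r))).
  by rewrite (reversed_derive sD) mulN1r opprK.
apply: (@smooth_at_comp1 _ _ ('D_1 q)); first by rewrite oppr0.
by apply: smooth_atN; exact: smooth_at_id.
Qed.

Theorem geodesic_symmetry_sym_jet x : sym_jet x (s x).
Proof.
have [diff sx] := geodesic_symmetry_diffeo x; split => //; split => // d xd v k.
have [_ ss _ _ _] := local_inverse_near (linvP diff) sx.
have sk := smooth_in_charts k ss sx xd.
have [a [g [a0 [sg g0] Hs Dg _]]] := reversed_curve v xd.
have gd : chart_at (g 0) d by rewrite g0.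
have sdg := smooth_into_chart sg gd.
have sk' : smooth_at (in_charts d d (s x) k) (d (g 0)) by rewrite g0.
have := derive_comp_sum (g := fun r => d (g r)) 1 sk' sdg.
have -> : 'D_1 (fun r => in_charts d d (s x) k (d (g r))) 0 = 'D_1 (fun r => d (g (- r)) 0 k) 0.
  apply: near_eq_derive; apply: filterS2 Hs (near_continuous sg.1 (near_cdom gd.2)) => r sr gr.
  by rewrite /in_charts (cmapK gr) sr.
rewrite (reversed_derive (q := fun r => d (g r) 0 k)) // Dg => H.
have : a * 'D_v (in_charts d d (s x) k) (d x) = a * (- v 0 k).
  rewrite mulrN H (derive_coords _ sk) g0 mulr_sumr; apply: eq_bigr => j _.
  by rewrite Dg mulrA.
by apply: mulfI; rewrite gt_eqF.
Qed.

Hypothesis torsion0 : forall X Y, smooth_field X -> smooth_field Y ->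
    (fun x f => nabla X Y x f - nabla Y X x f) = bracket X Y.

Theorem geodesic_symmetry_hessian x d B k i j : chart_at x d -> frame_at d x B ->
  'D_(delta_mx 0 i) ('D_(delta_mx 0 j) (in_charts d d (s x) k)) (d x) =
  - 2 * christoffel nabla B d k i j x.
Proof.
move=> xd fB; have [diff [sx flip]] := geodesic_symmetry_sym_jet x.
have [_ ss _ _ _] := local_inverse_near (linvP diff) sx.
have sk := smooth_in_charts k ss sx xd.
(* [S] is symmetric by the absence of torsion, so it is enough to show that its quadratic form
   vanishes. *)
pose S i j := 'D_(delta_mx 0 i) ('D_(delta_mx 0 j) (in_charts d d (s x) k)) (d x)
  + 2 * christoffel nabla B d k i j x.
suff S0 : S i j = 0 by move/eqP: S0; rewrite addr_eq0 -mulNr => /eqP.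
apply: polarization => {i j} [i j|v].
  rewrite /S (smooth_at_sym _ _ sk); congr (_ + _ * _).
  exact: (frame_symmetric torsion0 i j (ccoord d k) xd fB).
have [a [g [a0 [sg g0] Hs Dg DDg]]] := reversed_curve v xd.
have gd : chart_at (g 0) d by rewrite g0.
have sdg := smooth_into_chart sg gd.
have sk' : smooth_at (in_charts d d (s x) k) (d (g 0)) by rewrite g0.
have := second_derive_comp (h := fun r => d (g r)) 1 1 sk' sdg.
have -> : 'D_1 ('D_1 (fun r => in_charts d d (s x) k (d (g r)))) 0 =
    'D_1 ('D_1 (fun r => d (g (- r)) 0 k)) 0.
  apply: near_eq_derive.
  apply: filterS2 (near_join Hs) (near_join (near_continuous sg.1 (near_cdom gd.2))) => r sr gr.
  apply: near_eq_derive; apply: filterS2 sr gr => r' sr gr.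
  by rewrite /in_charts (cmapK gr) sr.
rewrite (reversed_second_derive (q := fun r => d (g r) 0 k)) // g0 (DDg B fB).
(* The differential -id turns the acceleration into its opposite. As reversal of time preserves the
   acceleration, the Hessian of the symmetry on the velocity is twice the acceleration. *)
have -> : \sum_j 'D_1 ('D_1 (fun r => d (g r) 0 j)) 0 * 'D_(delta_mx 0 j) (in_charts d d (s x) k) (d x)
    = - 'D_1 ('D_1 (fun r => d (g r) 0 k)) 0.
  rewrite (bigD1 k) //= big1 => [|j jk].
    by rewrite addr0 flip // !mxE !eqxx mulrN1.
  by rewrite flip // !mxE /= eq_sym (negbTE jk) oppr0 mulr0.
rewrite (DDg B fB) opprK.
under [X in _ = _ + X]eq_bigr do under eq_bigr do rewrite !Dg.
set P := \sum_i \sum_j _ * _ * christoffel _ _ _ _ _ _ _; set Q := (X in _ = _ + X) => H.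
have lin (p q : R) : - p = p + q -> q + 2 * p = 0 by move=> Epq; lra.
have PQ := lin P Q H.
have a2 : a * a != 0 by rewrite mulf_neq0 // gt_eqF.
apply: (mulfI a2); rewrite mulr0 -[RHS]PQ /P /Q !mulr_sumr -big_split/=.
apply: eq_bigr => i _; rewrite !mulr_sumr -big_split/=; apply: eq_bigr => j _.
rewrite /S; move: (christoffel _ _ _ _ _ _ _) ('D_(delta_mx 0 i) _ _) => p q; ring.
Qed.

End GeodesicSymmetry.

(** * Jets of symmetries *)

Section Jets.
Context {R : realType} {n : nat} {M : manifold R n}.
Local Notation E := 'rV[R]_n.
Implicit Types (c d : chart R n M) (x y : M) (f g : M -> R) (s : M -> M).
Implicit Types (X Y Z : @field R n M) (sigma : M -> M -> M).

Lemma second_derive_coords m (f : 'rV[R]_m -> R) u v w : smooth_at f u ->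
  'D_v ('D_w f) u = \sum_i \sum_j v 0 i * w 0 j * 'D_(delta_mx 0 i) ('D_(delta_mx 0 j) f) u.
Proof.
move=> sf; have := second_derive_comp (h := id) v w sf (@vsmooth_at_id _ _ u).
rewrite big1 => [|j _]; last first.
  have -> : 'D_w (fun r : 'rV[R]_m => id r 0 j) = cst (w 0 j).
    by apply/funext => r; rewrite derive_coord_proj.
  by rewrite derive_cst mul0r.
rewrite add0r => ->; apply: eq_bigr => i _; apply: eq_bigr => j _.
by rewrite !derive_coord_proj.
Qed.

(** [symmetry_at] also tests functions that are not smooth at [x]. On them both sides are 0, because
    composing with the local inverse shows that [f \o s] is smooth only if [f] is. *)
Lemma symmetry_atE x s : symmetry_at x s <-> sym_jet x s.
Proof.
split=> [[diff sx H]|[diff fl]].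
  split => //; split => // c xc v k; have [_ ss _ _ _] := local_inverse_near (linvP diff) sx.
  have xcs : chart_at (s x) c by rewrite sx.
  have /(congr1 (fun F : tvec => F (ccoord c k))) := H _ (tangent_coord_tvec v xc).
  rewrite coord_tvec_coord // coord_tvec_smooth //.
  exact: smooth_map_comp ss (smooth_fun_coord k xcs).
have sx := fl.1; have [tx ss st _ near_st] := local_inverse_near (linvP diff) sx.
split => // v tv; apply/funext => f.
have [sf|nf] := pselect (smooth_fun f x); first exact: (flips_tangent ss fl tv sf).
rewrite (tangent_nsmooth tv nf) oppr0 (tangent_nsmooth tv) // => sfs; apply: nf.
have sfs' : smooth_fun (f \o s) (linv x s x) by rewrite tx.
by apply: smooth_fun_ext (smooth_map_comp st sfs'); apply: filterS near_st => y [/= ->].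
Qed.

Lemma eq_jet2_sym x s s' : eq_jet2 x s s' -> eq_jet2 x s' s.
Proof.
move=> [ss H]; split; first exact: esym ss.
move=> c d xc; rewrite -ss => xd k v w.
by have [-> ->] := H c d xc xd k v w.
Qed.

Lemma eq_jet2_trans x s s' s'' : eq_jet2 x s s' -> eq_jet2 x s' s'' -> eq_jet2 x s s''.
Proof.
move=> [ss H] [ss' H']; split; first by rewrite ss.
move=> c d xc xd k v w; have [-> ->] := H c d xc xd k v w.
by apply: H' => //; rewrite -ss.
Qed.

Lemma jet2_eq x s s' : eq_jet2 x s s' -> jet2 x s = jet2 x s'.
Proof.
move=> H; apply/seteqP; split=> t [dt jt].
- by split; [exact: dt|exact: eq_jet2_trans (eq_jet2_sym H) jt].
- by split; [exact: dt|exact: eq_jet2_trans H jt].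
Qed.

Lemma sym_jet_smooth x s c k : sym_jet x s -> chart_at x c ->
  smooth_at (in_charts c c s k) (c x).
Proof.
move=> [diff [sx _]] xc; have [_ ss _ _ _] := local_inverse_near (linvP diff) sx.
exact: smooth_in_charts.
Qed.

Lemma in_charts_change x s c d k : sym_jet x s -> chart_at x c -> chart_at x d ->
  \forall u \near c x, (ccoord d k \o cinv c) (c (s (cinv c u))) = in_charts c d s k u.
Proof.
move=> [diff [sx _]] xc xd; have [_ ss _ _ _] := local_inverse_near (linvP diff) sx.
have xcs : chart_at (s x) c by rewrite sx.
apply: (near_chart xc.2 (P := fun y => (ccoord d k \o cinv c) (c (s y)) = d (s y) 0 k)).
by apply: filterS (near_continuous ss.1 (near_cdom xcs.2)) => y cy; rewrite /= (cmapK cy).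
Qed.

(** [eq_jet2] compares coordinates in all pairs of charts. The chain rule reduces them to a single
    chart, where the symmetry condition already fixes values and first derivatives. *)
Lemma eq_jet2_of_hessian x s s' : sym_jet x s -> sym_jet x s' ->
  (forall c k i j, chart_at x c ->
    'D_(delta_mx 0 i) ('D_(delta_mx 0 j) (in_charts c c s k)) (c x) =
    'D_(delta_mx 0 i) ('D_(delta_mx 0 j) (in_charts c c s' k)) (c x)) ->
  eq_jet2 x s s'.
Proof.
move=> js js' H; have sx := js.2.1; have sx' := js'.2.1; split; first by rewrite sx.
rewrite sx => c d xc xd k v w.
have sf : smooth_at (ccoord d k \o cinv c) (c x).
  by apply/(smooth_fun_chart _ xc); exact: smooth_fun_coord.
pose h r := fun u : E => c (r (cinv c u)).
have ch r : sym_jet x r ->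
    'D_v (in_charts c d r k) (c x) =
      \sum_j 'D_v (in_charts c c r j) (c x) * 'D_(delta_mx 0 j) (ccoord d k \o cinv c) (c x) /\
    'D_v ('D_w (in_charts c d r k)) (c x) =
      \sum_j 'D_v ('D_w (in_charts c c r j)) (c x) * 'D_(delta_mx 0 j) (ccoord d k \o cinv c) (c x) +
      \sum_i \sum_j 'D_v (in_charts c c r i) (c x) * 'D_w (in_charts c c r j) (c x) *
        'D_(delta_mx 0 i) ('D_(delta_mx 0 j) (ccoord d k \o cinv c)) (c x).
  move=> jr; have near_h := in_charts_change k jr xc xd.
  have hx : h r (c x) = c x by rewrite /h (cmapK xc.2) jr.2.1.
  have sh : vsmooth_at (h r) (c x) by move=> i; exact: sym_jet_smooth.
  have sfh : smooth_at (ccoord d k \o cinv c) (h r (c x)) by rewrite hx.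
  split.
    by have := derive_comp_sum v sfh sh; rewrite hx => <-; apply/esym; exact: near_eq_derive.
  have := second_derive_comp v w sfh sh; rewrite hx => <-; apply/esym.
  by apply: near_eq_derive; apply: filterS (near_join near_h) => u; exact: near_eq_derive.
have [-> ->] := ch s js; have [-> ->] := ch s' js'.
have D1 r u i : sym_jet x r -> 'D_u (in_charts c c r i) (c x) = - u 0 i.
  by move=> jr; rewrite jr.2.2.
split; first by apply: eq_bigr => j _; rewrite !D1.
apply: (f_equal2 (fun a b : R => a + b)).
  apply: eq_bigr => j _; rewrite (second_derive_coords v w (sym_jet_smooth j js xc)).
  rewrite (second_derive_coords v w (sym_jet_smooth j js' xc)).
  apply: (f_equal2 (fun a b : R => a * b)) => [|//].
  by apply: eq_bigr => i _; apply: eq_bigr => l _; rewrite H.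
by apply: eq_bigr => i _; apply: eq_bigr => j _; rewrite !D1.
Qed.

Lemma eq_jet2_hessian x s s' c k : eq_jet2 x s s' -> s x = x -> chart_at x c ->
  forall v w, 'D_v (in_charts c c s k) (c x) = 'D_v (in_charts c c s' k) (c x) /\
  'D_v ('D_w (in_charts c c s k)) (c x) = 'D_v ('D_w (in_charts c c s' k)) (c x).
Proof. by move=> [_ H] sx xc v w; apply: H => //; rewrite sx. Qed.

Lemma eq_jet2_sym_jet x s s' : eq_jet2 x s s' -> sym_jet x s -> local_diffeo x s' ->
  sym_jet x s'.
Proof.
move=> ss' [_ [sx flip]] diff; split => //; split; first by rewrite -ss'.1.
by move=> c xc v k; have [<- _] := eq_jet2_hessian k ss' sx xc v v; rewrite flip.
Qed.

Lemma jet2_choose x s : local_diffeo x s -> jet2 x s (choose_in id (jet2 x s)).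
Proof. by move=> diff; apply: choose_inP; exists s; split. Qed.

(** The chosen representatives may differ from those whose jets are assumed smooth, but
    [sym_hessian] is the same for both since it depends only on the jet at each point. *)
Lemma holonomic_choice (j : M -> set (M -> M)) : holonomic_symmetry_jet j ->
  let sigma x := choose_in id (j x) in
  [/\ forall x, sym_jet x (sigma x), forall x, j x = jet2 x (sigma x)
    & forall c x, chart_at x c -> forall k i l, smooth_fun (sym_hessian sigma c k i l) x].
Proof.
move=> [tau symj sm] sigma.
have jtau x : sym_jet x (tau x) by apply/symmetry_atE; have [] := symj x.
have P x : jet2 x (tau x) (sigma x).
  by rewrite /sigma; have [_ ->] := symj x; apply: jet2_choose; exact: (jtau x).1.
split=> [x|x|c x xc k i l].
- exact: eq_jet2_sym_jet (P x).2 (jtau x) (P x).1.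
- by have [_ ->] := symj x; apply: jet2_eq; exact: (P x).2.
have [_ _ sh] := sm c x xc k (delta_mx 0 i) (delta_mx 0 l).
apply: smooth_fun_ext (smooth_fun_of_chart xc sh); apply: filterS (chart_at_near xc) => y yc.
rewrite (cmapK yc.2) /sym_hessian.
by have [_ ->] := eq_jet2_hessian k (P y).2 (jtau y).2.1 yc (delta_mx 0 i) (delta_mx 0 l).
Qed.

(** At its own base point [u] a symmetry has value [u] and first derivatives [- v 0 k], both smooth
    in [u], so smoothness of the Hessian is the whole condition. *)
Lemma holonomic_of_sym sigma : (forall x, sym_jet x (sigma x)) ->
  (forall c x, chart_at x c -> forall k i j, smooth_fun (sym_hessian sigma c k i j) x) ->
  holonomic_symmetry_jet (fun x => jet2 x (sigma x)).
Proof.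
move=> sym sh; exists sigma; first by move=> x; split => //; apply/symmetry_atE.
move=> c x xc k v w F.
have near_u : \forall u \near c x, chart_at (cinv c u) c /\ c (cinv c u) = u.
  by apply: filterS2 (near_chart xc.2 (chart_at_near xc)) (near_cimg xc.2) => u uc /cinvK[].
split.
- apply: smooth_at_ext (smooth_at_coord (c x) k); apply: filterS near_u => u [uc cu].
  by rewrite /F /in_charts (sym _).2.1 cu.
- apply: smooth_at_ext (smooth_at_cst (- v 0 k) _); apply: filterS near_u => u [uc cu].
  by have := (sym (cinv c u)).2.2 c uc v k; rewrite cu => <-.
have : smooth_fun (fun y => \sum_i \sum_j v 0 i * w 0 j * sym_hessian sigma c k i j y) x.
  apply: smooth_fun_sum => i; apply: smooth_fun_sum => j; apply: smooth_funM; last exact: sh.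
  exact: smooth_fun_cst.
move=> /(smooth_fun_chart _ xc); apply: smooth_at_ext; apply: filterS near_u => u [uc cu].
have := second_derive_coords v w (sym_jet_smooth k (sym (cinv c u)) uc).
by rewrite /= /sym_hessian cu => <-.
Qed.

Theorem holonomic_connection (j : M -> set (M -> M)) : holonomic_symmetry_jet j ->
  torsionless_connection (jet_connection j).
Proof. by move=> /holonomic_choice[sym _ sh]; exact: symmetry_connection. Qed.

(** Both sides share the first-order term [X x (fco Y c k)]; what remains is the dictionary between
    the Hessian and the Christoffel symbols. *)
Lemma symmetry_formula_connection nabla sigma X Y x : affine_connection nabla ->
  sym_jet x (sigma x) ->
  (forall c B k i j, chart_at x c -> frame_at c x B ->
    sym_hessian sigma c k i j x = - 2 * christoffel nabla B c k i j x) ->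
  smooth_field X -> smooth_field Y -> symmetry_formula sigma X Y x = nabla X Y x.
Proof.
move=> nablaP sym hessE sX sY; have [c xc] := exists_chart x; have [B fB] := frame_exists xc.
rewrite (symmetry_formula_coord sym sX sY xc); apply: (tangent_eq xc).
- exact: tangent_coord_tvec.
- by apply: field_tangent; exact: nabla_smooth.
move=> k; rewrite coord_tvec_coord // mxE (nabla_coord nablaP _ xc fB sX sY); congr (_ + _).
  have Bk j := nbhs_singleton (frame_coord j k xc fB).
  rewrite (bigD1 k) //= big1 => [|j jk]; first by rewrite Bk eqxx mulr1 addr0.
  by rewrite Bk (negbTE jk) mulr0.
rewrite mulr_sumr -sumrN; apply: eq_bigr => i _; rewrite mulr_sumr -sumrN.
apply: eq_bigr => j _; rewrite -/(sym_hessian sigma c k i j x) (hessE _ _ _ _ _ xc fB) -/(christoffel nabla B c k i j x).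
by move: (_ * _) (christoffel _ _ _ _ _ _ _) => p q; field.
Qed.

(** Frame fields have constant components near [x], so only the Hessian term of [sym_coord]
    survives. *)
Lemma symmetry_connection_christoffel sigma c B k i j x : sym_jet x (sigma x) ->
  chart_at x c -> frame_at c x B ->
  christoffel (symmetry_formula sigma) B c k i j x = - 2^-1 * sym_hessian sigma c k i j x.
Proof.
move=> sym xc fB; have sB := fB.1.
rewrite /christoffel (symmetry_formula_coord sym (sB i) (sB j) xc) coord_tvec_coord // mxE.
have -> : B i x (fco (B j) c k) = 0.
  rewrite (tangent_near (field_tangent x (sB i)) (frame_coord j k xc fB)).
  exact: (tangent_cst _ (field_tangent x (sB i))).
rewrite sub0r mulNr; congr (- (_ * _)).
have Bk l m := nbhs_singleton (frame_coord l m xc fB).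
rewrite (bigD1 i) //= [X in _ + X]big1 ?addr0 => [|l li].
  rewrite (bigD1 j) //= [X in _ + X]big1 ?addr0 => [|l lj].
    by rewrite /fco !Bk !eqxx !mul1r.
  by rewrite /fco !Bk [j == l]eq_sym (negbTE lj) mulr0 mul0r.
by apply: big1 => m _; rewrite /fco !Bk [i == l]eq_sym (negbTE li) !mul0r.
Qed.

(** * From a connection to its geodesic jet and back *)

Section GeodesicJet.
Variable nabla : @field R n M -> @field R n M -> @field R n M.
Hypothesis nablaT : torsionless_connection nabla.

Lemma geodesic_sym_hessian x c B k i j : chart_at x c -> frame_at c x B ->
  sym_hessian (geodesic_symmetry nabla) c k i j x = - 2 * christoffel nabla B c k i j x.
Proof. by have [nablaP torsion0] := nablaT; exact: geodesic_symmetry_hessian. Qed.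

Theorem geodesic_jet_holonomic : holonomic_symmetry_jet (geodesic_jet nabla).
Proof.
have [nablaP _] := nablaT; apply: holonomic_of_sym; first exact: geodesic_symmetry_sym_jet.
move=> c x xc k i j; have [B fB] := frame_exists xc.
have sG : smooth_fun (fun y => - 2 * christoffel nabla B c k i j y) x.
  by apply: smooth_funM; [exact: smooth_fun_cst|exact: smooth_christoffel].
apply: smooth_fun_ext sG; apply: filterS2 (chart_at_near xc) (frame_near fB) => y yc fBy.
by rewrite (geodesic_sym_hessian _ _ _ yc fBy).
Qed.

Theorem geodesic_symmetry_formula X Y x : smooth_field X -> smooth_field Y ->
  symmetry_formula (geodesic_symmetry nabla) X Y x = nabla X Y x.
Proof.
apply: symmetry_formula_connection; first exact: nablaT.1.
- exact: (geodesic_symmetry_sym_jet nablaT.1).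
- by move=> c B k i j; exact: geodesic_sym_hessian.
Qed.

Theorem geodesic_jet_connection X Y : smooth_field X -> smooth_field Y ->
  jet_connection (geodesic_jet nabla) X Y = nabla X Y.
Proof.
move=> sX sY; apply/funext => x; have js := geodesic_symmetry_sym_jet nablaT.1 x.
have [diff eqj] := jet2_choose js.1.
apply: symmetry_formula_connection sX sY; first exact: nablaT.1.
- exact: eq_jet2_sym_jet eqj js diff.
move=> c B k i j xc fB; rewrite -(geodesic_sym_hessian k i j xc fB) /sym_hessian.
by have [_ ->] := eq_jet2_hessian k eqj js.2.1 xc (delta_mx 0 i) (delta_mx 0 j).
Qed.

End GeodesicJet.

(** Symmetry jets with equal Hessians agree, and the passage through Christoffel symbols multiplies
    the Hessian by -1/2 and then by -2. *)
Theorem geodesic_jet_of_holonomic (j : M -> set (M -> M)) : holonomic_symmetry_jet j ->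
  geodesic_jet (jet_connection j) = j.
Proof.
move=> Hj; have nablaT := holonomic_connection Hj; have [sym jE _] := holonomic_choice Hj.
apply/funext => x; rewrite [in RHS]jE; apply: jet2_eq.
apply: (eq_jet2_of_hessian (geodesic_symmetry_sym_jet nablaT.1 x) (sym x)) => c k i l xc.
have [B fB] := frame_exists xc.
have := geodesic_sym_hessian nablaT k i l xc fB.
rewrite (symmetry_connection_christoffel k i l (sym x) xc fB) mulrA.
have -> : - 2 * - 2^-1 = 1 :> R by rewrite mulrNN divff // pnatr_eq0.
by rewrite mul1r.
Qed.

End Jets.

(** Connections are total on all fields but constrained on smooth ones only, hence the comparison on
    smooth fields; jets are compared as sets of maps. *)
Theorem theorem1p12 (R : realType) (n : nat) (M : manifold R n) :
  [/\ forall j : M -> set (M -> M), holonomic_symmetry_jet j ->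
        torsionless_connection (jet_connection j),
      forall nabla : @field R n M -> @field R n M -> @field R n M,
        torsionless_connection nabla ->
        holonomic_symmetry_jet (geodesic_jet nabla),
      forall j : M -> set (M -> M), holonomic_symmetry_jet j ->
        geodesic_jet (jet_connection j) = j,
      forall nabla : @field R n M -> @field R n M -> @field R n M,
        torsionless_connection nabla ->
        forall X Y : @field R n M, smooth_field X -> smooth_field Y ->
        jet_connection (geodesic_jet nabla) X Y = nabla X Y
    & forall nabla : @field R n M -> @field R n M -> @field R n M,
        torsionless_connection nabla ->
        forall X Y : @field R n M, smooth_field X -> smooth_field Y ->
        forall x : M,
        nabla X Y x = symmetry_formula (geodesic_symmetry nabla) X Y x].
Proof.
split.
- exact: holonomic_connection.
- exact: geodesic_jet_holonomic.
- exact: geodesic_jet_of_holonomic.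
- exact: geodesic_jet_connection.
- by move=> nabla nablaT X Y sX sY x; rewrite geodesic_symmetry_formula.
Qed.
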